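(* Let $\mathfrak X_0=\mathrm{Spec}\,\mathbb Z_p$ and $\mathfrak o=\mathfrak o_p$, the valuation ring of $\mathbb C_p=\widehat{\overline{\mathbb Q}}_p$, and let $G=\mathrm{Gal}(\overline{\mathbb Q}_p/\mathbb Q_p)$. Under the identification $\mathcal Y_0=\mathrm{End}_{\mathrm{cont}}(\mathfrak o_p^b)/G$ (with $\sigma\in G$ acting by $\varphi^\sigma=\varphi\circ\sigma$), the subset $\check Y_0\subset\mathcal Y_0$ consists of the $F_p$-fixed point $s_0=(\mathfrak o_p^b\to\overline{\mathbb F}_p\to\mathfrak o_p^b)G$ and the (infinite) $F_p^{\mathbb Z}$-orbit of $\eta_0=(\mathfrak o_p^b\xrightarrow{\mathrm{id}}\mathfrak o_p^b)G$.
   Context: For a ring $A$, $\hat A$ denotes the $p$-adic completion; for a $p$-adically complete ring $A$, $A^b=\varprojlim_{(\,)^p}A/p$ is the tilt with the pro-discrete topology, and reduction gives a multiplicative homeomorphism $\varprojlim_{(\,)^p}A\cong A^b$. $\overline{\mathbb F}_p$ is the residue field of $\mathfrak o_p^b$ and also canonically a subfield of $\mathfrak o_p^b$. $\mathrm{End}_{\mathrm{cont}}$ denotes continuous ring endomorphisms. Let $K=\overline{\mathbb Q}_p$ and $\mathfrak X=\mathrm{Spec}\,\mathfrak o_K$. For $x\in\mathfrak X$, $y\in\overline{\{x\}}$ let $\mathcal O_{\overline{\{x\}},y}$ be the local ring at $y$ of the reduced closed subscheme $\overline{\{x\}}$. $\hat{\mathfrak X}_c(\mathfrak o_p)$ is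 the set of triples $(x,y,\bar P^\times)$ with $x\in\mathfrak X$, $y\in\overline{\{x\}}$ and $\bar P^\times:\varprojlim_{(\,)^p}\kappa(x)^\times\to\mathbb C_p^\times$ a homomorphism, with extension by zero $\bar P$ to $\varprojlim_{(\,)^p}\kappa(x)$, for which there are multiplicative maps (sending $0\mapsto0$, $1\mapsto1$) $\hat P_y:\varprojlim_{(\,)^p}\hat{\mathcal O}_{\overline{\{x\}},y}\to\mathfrak o_p$, continuous for the projective limit of the $p$-adic topologies and the $p$-adic topology of $\mathfrak o_p$, and $\tilde P_y:\varprojlim_{(\,)^p}\kappa(y)\to\overline{\mathbb F}_p$ such that on $\varprojlim_{(\,)^p}\mathcal O_{\overline{\{x\}},y}$ the map $\hat P_y$ agrees with $\bar P$ and its reduction to $\overline{\mathbb F}_p$ agrees with $\tilde P_y$ composed with the natural map to $\varprojlim_{(\,)^p}\kappa(y)$. These maps are determined by $(x,y,\bar P^\times)$, and one writes $(x,y,\hat P_y)$. $\mathcal Y\subset\hat{\mathfrak X}_c(\mathfrak o_p)$ (in the paper: $Y$ with a superscript diamond) consists of the triples such that $\hat P_y$, viewed as a map $\hat{\mathcal O}^b_{\overline{\{x\}},y}\to\mathfrak o_p$, is additive modulo $p$. $\check Y\subset\mathcal Y$ consists of those triples for which $\hat P_y$ factors as $\varprojlim_{(\,)^p}\hat{\mathcal O}_{\overline{\{x\}},y}\xrightarrow{\mathrm{pr}_i}\hat{\mathcal O}_{\overline{\{x\}},y}\xrightarrow{\chi}\mathfrak o_p$ for some $i\ge0$ and some continuous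 multiplicative map $\chi$ ($\mathrm{pr}_i$ the $i$-th projection). $G$ acts by $(x,y,\hat P_y)^\sigma=(x^\sigma,y^\sigma,\hat P_y\circ\sigma)$ and $F_p$ by $\hat P_y\mapsto\hat P_y\circ(\,)^p$; $\mathcal Y_0=\mathcal Y/G$, $\check Y_0=\check Y/G$. The ($G$- and $F_p$-equivariant) identification $\mathcal Y=\mathrm{End}_{\mathrm{cont}}(\mathfrak o_p^b)$ sends $(x,y,\hat P_y)$ to the composition of $\mathfrak o_p^b=\hat{\mathfrak o}_K^b\to\hat{\mathcal O}^b_{\overline{\{x\}},y}$ with the ring homomorphism $\hat P_y^b:\hat{\mathcal O}^b_{\overline{\{x\}},y}\to\mathfrak o_p^b$, $(a_\nu)_\nu\mapsto(\hat P_y((a_{\nu+n})_\nu)\bmod p)_n$, where $(a_\nu)\in\varprojlim_{(\,)^p}\hat{\mathcal O}_{\overline{\{x\}},y}$; on $\mathrm{End}_{\mathrm{cont}}(\mathfrak o_p^b)$, $F_p(\varphi)=\varphi\circ(\,)^p$. *)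

(* Defs.v *)
From HB Require Import structures.
From mathcomp Require Import all_boot all_order all_algebra.
From mathcomp Require Import boolp classical_sets functions cardinality reals.

Set Implicit Arguments.
Unset Strict Implicit.
Unset Printing Implicit Defensive.

Import Order.TTheory GRing.Theory Num.Theory.
Local Open Scope ring_scope.
Local Open Scope quotient_scope.

(* The quotient A / aA; the zero ring is allowed. *)
Section PrincipalQuotient.
Variables (A : comPzRingType) (a : A).

Definition multiples : {pred A} := fun x => `[< exists y, x = a * y >].

Lemma multiplesP x : reflect (exists y, x = a * y) (x \in multiples).
Proof. exact: asboolP. Qed.

Lemma multiples_zmod : zmod_closed multiples.
Proof.
split=> [|x y /multiplesP[u ->] /multiplesP[v ->]]; apply/multiplesP.
  by exists 0; rewrite mulr0.
by exists (u - v); rewrite mulrBr.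
Qed.
HB.instance Definition _ := GRing.isZmodClosed.Build A multiples multiples_zmod.

Lemma multiplesMl x y : y \in multiples -> x * y \in multiples.
Proof.
by move=> /multiplesP[u ->]; apply/multiplesP; exists (x * u); rewrite mulrCA.
Qed.

Definition pquot := Quotient.quot multiples.
HB.instance Definition _ := GRing.Zmodule.on pquot.
HB.instance Definition _ := EqQuotient.on pquot.

Definition pquot_of (x : A) : pquot := \pi_pquot x.

Lemma pquot_eq x y : (pquot_of x == pquot_of y) = (x - y \in multiples).
Proof. by rewrite [RHS]Quotient.idealrBE. Qed.

Lemma pquot_reprK : cancel (repr : pquot -> A) pquot_of.
Proof. exact: reprK. Qed.

Definition pquot_mul (u v : pquot) : pquot := pquot_of (repr u * repr v).

Lemma pquot_ofB : {morph pquot_of : x y / x - y}.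
Proof. by move=> x y; rewrite /pquot_of !piE. Qed.

Lemma pquot_ofD : {morph pquot_of : x y / x + y}.
Proof. by move=> x y; rewrite /pquot_of !piE. Qed.

Lemma pquot_ofM x y : pquot_of (x * y) = pquot_mul (pquot_of x) (pquot_of y).
Proof.
apply/eqP; rewrite pquot_eq.
set x' := repr _; set y' := repr _.
have hx : x - x' \in multiples by rewrite -pquot_eq pquot_reprK.
have hy : y - y' \in multiples by rewrite -pquot_eq pquot_reprK.
have -> : x * y - x' * y' = y * (x - x') + x' * (y - y').
  by rewrite !mulrBr [y * x]mulrC [y * x']mulrC addrA subrK.
by rewrite rpredD ?multiplesMl.
Qed.

Lemma pquot_mulA : associative pquot_mul.
Proof.
move=> u v w; rewrite -[u]pquot_reprK -[v]pquot_reprK -[w]pquot_reprK.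
by rewrite -!pquot_ofM mulrA.
Qed.
Lemma pquot_mulC : commutative pquot_mul.
Proof. by move=> u v; rewrite /pquot_mul mulrC. Qed.
Lemma pquot_mul1 : left_id (pquot_of 1) pquot_mul.
Proof. by move=> u; rewrite -[u]pquot_reprK -!pquot_ofM mul1r. Qed.
Lemma pquot_mulDl : left_distributive pquot_mul +%R.
Proof.
move=> u v w; rewrite -[u]pquot_reprK -[v]pquot_reprK -[w]pquot_reprK.
by rewrite -pquot_ofD -!pquot_ofM -pquot_ofD mulrDl.
Qed.
HB.instance Definition _ := GRing.Zmodule_isComPzRing.Build pquot
  pquot_mulA pquot_mulC pquot_mul1 pquot_mulDl.

Lemma pquot_of_monoid : monoid_morphism pquot_of.
Proof. by split=> // x y; apply: pquot_ofM. Qed.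
HB.instance Definition _ := GRing.isZmodMorphism.Build A pquot pquot_of pquot_ofB.
HB.instance Definition _ := GRing.isMonoidMorphism.Build A pquot pquot_of
  pquot_of_monoid.

End PrincipalQuotient.

(* The map A/aA -> B/bB induced by f, meaningful when f a is a multiple of b. *)
Definition pquot_map (A B : comPzRingType) (a : A) (b : B) (f : A -> B)
  (u : pquot a) : pquot b := pquot_of b (f (repr u)).

Lemma pquot_map_of (A B : comPzRingType) (a : A) (b : B) (f : {rmorphism A -> B}) :
  f a \in multiples b -> forall x, pquot_map b f (pquot_of a x) = pquot_of b (f x).
Proof.
move=> fab x; apply/eqP; rewrite pquot_eq -rmorphB.
have /multiplesP[y ->] : repr (pquot_of a x) - x \in multiples a.
  by rewrite -pquot_eq pquot_reprK.
by rewrite rmorphM mulrC multiplesMl.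
Qed.

Section DependentProduct.
Variables (I : Type) (T : I -> comPzRingType).

Definition dprod := forall i, T i.
HB.instance Definition _ := gen_eqMixin dprod.
HB.instance Definition _ := gen_choiceMixin dprod.

Implicit Types f g h : dprod.
Definition dprod_add f g : dprod := fun i => f i + g i.
Definition dprod_opp f : dprod := fun i => - f i.
Definition dprod_mul f g : dprod := fun i => f i * g i.

Lemma dprod_addA : associative dprod_add.
Proof. by move=> f g h; apply/functional_extensionality_dep => i; apply: addrA. Qed.
Lemma dprod_addC : commutative dprod_add.
Proof. by move=> f g; apply/functional_extensionality_dep => i; apply: addrC. Qed.
Lemma dprod_add0 : left_id (fun=> 0) dprod_add.
Proof. by move=> f; apply/functional_extensionality_dep => i; apply: add0r. Qed.
Lemma dprod_addN : left_inverse (fun=> 0) dprod_opp dprod_add.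
Proof. by move=> f; apply/functional_extensionality_dep => i; apply: addNr. Qed.
HB.instance Definition _ := GRing.isZmodule.Build dprod
  dprod_addA dprod_addC dprod_add0 dprod_addN.

Lemma dprod_mulA : associative dprod_mul.
Proof. by move=> f g h; apply/functional_extensionality_dep => i; apply: mulrA. Qed.
Lemma dprod_mulC : commutative dprod_mul.
Proof. by move=> f g; apply/functional_extensionality_dep => i; apply: mulrC. Qed.
Lemma dprod_mul1 : left_id (fun=> 1) dprod_mul.
Proof. by move=> f; apply/functional_extensionality_dep => i; apply: mul1r. Qed.
Lemma dprod_mulDl : left_distributive dprod_mul +%R.
Proof. by move=> f g h; apply/functional_extensionality_dep => i; apply: mulrDl. Qed.
HB.instance Definition _ := GRing.Zmodule_isComPzRing.Build dprod
  dprod_mulA dprod_mulC dprod_mul1 dprod_mulDl.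

Lemma dprodB f g i : (f - g) i = f i - g i. Proof. by []. Qed.
Lemma dprodM f g i : (f * g) i = f i * g i. Proof. by []. Qed.

End DependentProduct.

(* The p-adic completion, as the limit of the rings A / p^n A; it is the zero *)
(* ring when p is invertible in A.                                            *)
Section Completion.
Variables (p : nat) (A : comPzRingType).

Definition pow_quot (n : nat) : comPzRingType := pquot (p%:R ^+ n : A).

Definition pow_quot_red n : pow_quot n.+1 -> pow_quot n := pquot_map _ idfun.

Lemma pow_quot_redE n x : pow_quot_red (pquot_of _ x : pow_quot n.+1) = pquot_of _ x.
Proof.
apply: (pquot_map_of (f := idfun)); apply/multiplesP; exists p%:R.
by rewrite exprSr.
Qed.

Definition coherent : {pred dprod pow_quot} :=
  fun z => `[< forall n, pow_quot_red (z n.+1) = z n >].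

Lemma coherent_subring : subring_closed coherent.
Proof.
split=> [|y z /asboolP yc /asboolP zc|y z /asboolP yc /asboolP zc];
  apply/asboolP => n.
- exact: pow_quot_redE.
- rewrite !dprodB -(yc n) -(zc n) -[y n.+1]pquot_reprK -[z n.+1]pquot_reprK.
  by rewrite -rmorphB !pow_quot_redE rmorphB.
- rewrite !dprodM -(yc n) -(zc n) -[y n.+1]pquot_reprK -[z n.+1]pquot_reprK.
  by rewrite -rmorphM !pow_quot_redE rmorphM.
Qed.
HB.instance Definition _ :=
  GRing.isSubringClosed.Build (dprod pow_quot) coherent coherent_subring.

Record completion := Completion
  { completion_val :> dprod pow_quot; _ : completion_val \in coherent }.
HB.instance Definition _ := [isSub for completion_val].
HB.instance Definition _ := [Choice of completion by <:].
HB.instance Definition _ := 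
  GRing.SubChoice_isSubComPzRing.Build _ _ completion coherent_subring.

Fact completion_of_subproof (x : A) :
  (fun n => pquot_of (p%:R ^+ n) x : pow_quot n) \in coherent.
Proof. by apply/asboolP => n; apply: pow_quot_redE. Qed.
Definition completion_of x := Completion (completion_of_subproof x).

Lemma completion_of_zmod : zmod_morphism completion_of.
Proof.
move=> x y; apply/val_inj/functional_extensionality_dep => n.
exact: (rmorphB (pquot_of _)).
Qed.
Lemma completion_of_monoid : monoid_morphism completion_of.
Proof.
split=> [|x y]; apply/val_inj/functional_extensionality_dep => n //.
exact: (rmorphM (pquot_of _)).
Qed.
HB.instance Definition _ :=
  GRing.isZmodMorphism.Build A completion completion_of completion_of_zmod.
HB.instance Definition _ :=
  GRing.isMonoidMorphism.Build A completion completion_of completion_of_monoid.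

End Completion.

(* The multiplicative monoid of sequences (a_n) with a_(n+1)^p = a_n. *)
Section PowerLimit.
Variable p : nat.

Definition is_power_seq (A : pzRingType) (a : nat -> A) :=
  `[< forall n, a n.+1 ^+ p = a n >].

Record plim (A : pzRingType) := Plim
  { plim_val :> nat -> A; _ : is_power_seq plim_val }.
HB.instance Definition _ A := [isSub for @plim_val A].
HB.instance Definition _ A := gen_eqMixin (plim A).
HB.instance Definition _ A := gen_choiceMixin (plim A).

Lemma plimP A (a : plim A) n : a n.+1 ^+ p = a n.
Proof. by case: a => a /= /asboolP. Qed.

Fact plim1_subproof (A : pzRingType) : is_power_seq (fun=> 1 : A).
Proof. by apply/asboolP => n; rewrite expr1n. Qed.
Definition plim1 A := Plim (plim1_subproof A).

Fact plim_mul_subproof (A : comPzRingType) (a b : plim A) :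
  is_power_seq (fun n => a n * b n).
Proof. by apply/asboolP => n; rewrite exprMn !plimP. Qed.
Definition plim_mul (A : comPzRingType) (a b : plim A) := Plim (plim_mul_subproof a b).

Fact plim_shift_subproof (A : pzRingType) (k : nat) (a : plim A) :
  is_power_seq (fun n => a (n + k)%N).
Proof. by apply/asboolP => n; rewrite addSn plimP. Qed.
Definition plim_shift A k (a : plim A) := Plim (plim_shift_subproof k a).

Fact plim_map_subproof (A B : pzRingType) (f : {rmorphism A -> B}) (a : plim A) :
  is_power_seq (fun n => f (a n)).
Proof. by apply/asboolP => n; rewrite -rmorphXn plimP. Qed.
Definition plim_map (A B : pzRingType) (f : {rmorphism A -> B}) (a : plim A) :=
  Plim (plim_map_subproof f a).

(* Multiplicative with 1 |-> 1 and 0 |-> 0, where 0 is the zero sequence. *)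
Definition plim_multiplicative (A B : comPzRingType) (P : plim A -> B) :=
  [/\ P (plim1 A) = 1,
      forall a : plim A, (forall n, a n = 0) -> P a = 0 &
      forall a b, P (plim_mul a b) = P a * P b].

End PowerLimit.

Lemma frobenius_add (p : nat) (B : comPzRingType) :
  prime p -> p%:R = 0 :> B -> forall x y : B, (x + y) ^+ p = x ^+ p + y ^+ p.
Proof.
case: p => // q q_pr q0 x y.
rewrite exprDn big_ord_recl /= bin0 subn0 expr0 mulr1 mulr1n; congr (_ + _).
rewrite big_ord_recr /= /bump leq0n add1n binn subnn expr0 mul1r mulr1n.
rewrite big1 ?add0r // => i _; rewrite /bump leq0n add1n.
have /dvdnP[m ->] : (q.+1 %| 'C(q.+1, i.+1))%N.
  by apply: prime_dvd_bin; rewrite ?ltnS ?ltn_ord.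
by rewrite -mulr_natr natrM q0 !mulr0.
Qed.

(* The tilt lim A/p, with componentwise ring operations. *)
Section Tilt.
Variables (p : nat) (p_pr : prime p) (A : comPzRingType).

Definition modp : comPzRingType := pquot (p%:R : A).

Lemma modp_p0 : p%:R = 0 :> modp.
Proof.
rewrite -(rmorph_nat (pquot_of (p%:R : A))) -(rmorph0 (pquot_of (p%:R : A))).
by apply/eqP; rewrite pquot_eq subr0; apply/multiplesP; exists 1; rewrite mulr1.
Qed.

Lemma modp_frobB (x y : modp) : (x - y) ^+ p = x ^+ p - y ^+ p.
Proof. by apply/eqP; rewrite eq_sym subr_eq -(frobenius_add p_pr modp_p0) subrK. Qed.

(* The vacuous [p_pr] makes the type [tilt] remember that p is prime, which its *)
(* ring structure needs.                                                       *)
Definition tilt_pred : {pred nat -> modp} :=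
  let _ := p_pr in fun a => is_power_seq p a.

Lemma tilt_subring : subring_closed tilt_pred.
Proof.
split=> [|a b /asboolP ha /asboolP hb|a b /asboolP ha /asboolP hb];
  apply/asboolP => n.
- exact: expr1n.
- rewrite -[(a - b) n.+1]/(a n.+1 - b n.+1) -[(a - b) n]/(a n - b n) -(ha n) -(hb n).
  exact: modp_frobB.
- rewrite -[(a * b) n.+1]/(a n.+1 * b n.+1) -[(a * b) n]/(a n * b n) -(ha n) -(hb n).
  exact: exprMn.
Qed.
HB.instance Definition _ :=
  GRing.isSubringClosed.Build (nat -> modp) tilt_pred tilt_subring.

Record tilt := Tilt { tilt_val :> nat -> modp; _ : tilt_val \in tilt_pred }.
HB.instance Definition _ := [isSub for tilt_val].
HB.instance Definition _ := [Choice of tilt by <:].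
HB.instance Definition _ := 
  GRing.SubChoice_isSubComPzRing.Build _ _ tilt tilt_subring.

Lemma tiltP (a : tilt) n : a n.+1 ^+ p = a n.
Proof. by case: a => a /= /asboolP. Qed.

Fact tilt_red_subproof (a : plim p A) :
  (fun n => pquot_of p%:R (a n) : modp) \in tilt_pred.
Proof. by apply/asboolP => n; rewrite -rmorphXn plimP. Qed.
Definition tilt_red a := Tilt (tilt_red_subproof a).

(* The inverse of the reduction lim A -> tilt A, for A p-adically complete. *)
Definition untilt (a : tilt) : plim p A :=
  xget (plim1 p A) [set u | tilt_red u = a]%classic.

Fact tilt_root_subproof (k : nat) (a : tilt) :
  (fun n => a (n + k)%N) \in tilt_pred.
Proof. by apply/asboolP => n; rewrite addSn tiltP. Qed.
Definition tilt_root k a := Tilt (tilt_root_subproof k a).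

(* The integral powers of the bijective Frobenius; Negz k stands for -(k+1). *)
Definition tilt_frob (m : int) (a : tilt) : tilt :=
  match m with
  | Posz k => a ^+ (p ^ k)
  | Negz k => tilt_root k.+1 a
  end.

Definition tilt_continuous (f : tilt -> tilt) :=
  forall (a : tilt) n, exists k, forall b : tilt,
    (forall i, (i <= k)%N -> b i = a i) -> forall i, (i <= n)%N -> f b i = f a i.

End Tilt.

Section TiltMap.
Variables (p : nat) (p_pr : prime p) (A B : comPzRingType) (f : {rmorphism A -> B}).

Lemma modp_map_of x :
  pquot_map (p%:R : B) f (pquot_of (p%:R : A) x) = pquot_of (p%:R : B) (f x).
Proof.
by apply: pquot_map_of; rewrite rmorph_nat; apply/multiplesP; exists 1; rewrite mulr1.
Qed.

Fact tilt_map_subproof (a : tilt p_pr A) :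
  (fun n => pquot_map (p%:R : B) f (a n) : modp p B) \in @tilt_pred p p_pr B.
Proof.
apply/asboolP => n; rewrite -(tiltP a n) -[a n.+1]pquot_reprK; set r := repr _.
transitivity (pquot_of (p%:R : B) (f r ^+ p)).
  by rewrite rmorphXn; congr (_ ^+ p); apply: modp_map_of.
by rewrite -rmorphXn -modp_map_of; congr pquot_map; apply: rmorphXn.
Qed.
Definition tilt_map (a : tilt p_pr A) : tilt p_pr B := Tilt (tilt_map_subproof a).

End TiltMap.

Section PadicContinuity.
Variable p : nat.

Definition padic_close (A : comPzRingType) (n : nat) (x y : A) :=
  x - y \in multiples (p%:R ^+ n).

Definition padic_continuous (A B : comPzRingType) (f : A -> B) :=
  forall x n, exists m, forall y, padic_close m y x -> padic_close n (f y) (f x).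

(* Continuity on lim A for the projective limit of the p-adic topologies; the *)
(* target carries its p-adic topology.                                        *)
Definition plim_continuous (A B : comPzRingType) (P : plim p A -> B) :=
  forall (a : plim p A) n, exists k m, forall b : plim p A,
    (forall i, (i <= k)%N -> padic_close m (b i) (a i)) -> padic_close n (P b) (P a).

End PadicContinuity.

(* The domain A/x for a prime ideal x. *)
Section PrimeQuotient.
Variables (A : comNzRingType) (x : prime_idealr A).

Definition dquot := {ideal_quot x}.
HB.instance Definition _ := GRing.ComNzRing.on dquot.
HB.instance Definition _ := EqQuotient.on dquot.

Definition dquot_of (a : A) : dquot := \pi_dquot a.

Lemma dquot_eq a b : (dquot_of a == dquot_of b) = (a - b \in x).
Proof. by rewrite [RHS]Quotient.idealrBE. Qed.

Lemma dquot_eq0 a : (dquot_of a == 0) = (a \in x).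
Proof.
have -> : 0 = dquot_of 0 by rewrite /dquot_of !piE.
by rewrite dquot_eq subr0.
Qed.

Lemma dquot_of_zmod : zmod_morphism dquot_of.
Proof. by move=> a b; rewrite /dquot_of !piE. Qed.
Lemma dquot_of_monoid : monoid_morphism dquot_of.
Proof. by split=> [|a b]; rewrite /dquot_of !piE. Qed.
HB.instance Definition _ := GRing.isZmodMorphism.Build A dquot dquot_of dquot_of_zmod.
HB.instance Definition _ := GRing.isMonoidMorphism.Build A dquot dquot_of
  dquot_of_monoid.

Definition dquot_unit : {pred dquot} := fun u => `[< exists v, v * u = 1 >].
Definition dquot_inv (u : dquot) : dquot :=
  if pselect (exists v, v * u = 1) is left ex then projT1 (cid ex) else u.

Lemma dquot_mulV : {in dquot_unit, left_inverse 1 dquot_inv *%R}.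
Proof.
move=> u /asboolP exu; rewrite /dquot_inv; case: pselect => [ex|//].
by case: cid.
Qed.
Lemma dquot_unitP u v : v * u = 1 -> dquot_unit u.
Proof. by move=> vu; apply/asboolP; exists v. Qed.
Lemma dquot_inv_out : {in [predC dquot_unit], dquot_inv =1 id}.
Proof.
move=> u /negP nu; rewrite /dquot_inv; case: pselect => [ex|//].
by case: nu; apply/asboolP.
Qed.
HB.instance Definition _ := GRing.ComNzRing_hasMulInverse.Build dquot
  dquot_mulV dquot_unitP dquot_inv_out.

Lemma dquot_domain (u v : dquot) : u * v = 0 -> (u == 0) || (v == 0).
Proof. exact: Quotient.rquot_IdomainAxiom. Qed.
HB.instance Definition _ := GRing.ComUnitRing_isIntegral.Build dquot dquot_domain.

Definition resfield : fieldType := {fraction dquot}.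

Definition to_resfield (a : A) : resfield := FracField.tofrac (dquot_of a).
HB.instance Definition _ := GRing.RMorphism.copy to_resfield
  (@FracField.tofrac dquot \o dquot_of).

Lemma to_resfield_eq0 a : (to_resfield a == 0) = (a \in x).
Proof. by rewrite tofrac_eq0 dquot_eq0. Qed.

Lemma resfield_frac (z : resfield) :
  exists a s, to_resfield s != 0 /\ z = to_resfield a / to_resfield s.
Proof.
elim/quotW: z => -[[n d] /= d0].
exists (repr n), (repr d); rewrite /to_resfield /dquot_of !reprK tofrac_eq0.
split=> //; apply: (mulIf (x := FracField.tofrac d)); first by rewrite tofrac_eq0.
rewrite mulfVK ?tofrac_eq0 //.
rewrite /FracField.tofrac; unlock; rewrite -[LHS]FracField.pi_mul.
apply/eqmodP; rewrite /= FracField.equivfE /FracField.mulf /=.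
by rewrite !numden_Ratio ?mulf_neq0 ?oner_eq0 // !mulr1 mulrC.
Qed.

End PrimeQuotient.

(* A ring morphism g from A to a field that vanishes on x extends to the      *)
(* fractions a/s in the residue field of x with g s <> 0.                     *)
Section FractionLift.
Variables (A : comNzRingType) (x : prime_idealr A) (F : fieldType).
Variable g : {rmorphism A -> F}.
Hypothesis gx : forall a, a \in x -> g a = 0.

Definition is_fraction (z : resfield x) (q : A * A) :=
  g q.2 != 0 /\ z = to_resfield x q.1 / to_resfield x q.2.

Definition fraction_lift (z : resfield x) : F :=
  let q := xget (0, 1) [set q | is_fraction z q]%classic in g q.1 / g q.2.

Lemma fraction_lift_nz s : g s != 0 -> to_resfield x s != 0.
Proof. by rewrite to_resfield_eq0; apply: contra => /gx ->. Qed.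

Lemma fraction_liftE a s : g s != 0 ->
  fraction_lift (to_resfield x a / to_resfield x s) = g a / g s.
Proof.
move=> gs; rewrite /fraction_lift; set z := to_resfield x a / _.
case: (xgetP (0, 1) [set q | is_fraction z q]%classic) => [q _|/(_ (a, s)) []] //=.
case: q => b t [/= gt zE]; apply/eqP.
rewrite eqr_div // -subr_eq0 -!rmorphM -rmorphB gx //.
rewrite -to_resfield_eq0 rmorphB !rmorphM subr_eq0.
rewrite -eqr_div ?fraction_lift_nz //; by apply/eqP; rewrite -zE.
Qed.

Definition liftable (z : resfield x) := exists q, is_fraction z q.

Lemma fraction_lift1 : fraction_lift 1 = 1.
Proof.
by rewrite -[1 in LHS](divr1) -(rmorph1 (to_resfield x)) fraction_liftE
           ?rmorph1 ?oner_neq0 ?divr1.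
Qed.

Lemma fraction_liftM z w : liftable z -> liftable w ->
  fraction_lift (z * w) = fraction_lift z * fraction_lift w.
Proof.
move=> [[a s] [/= gs ->]] [[b t] [/= gt ->]].
by rewrite mulf_div -!rmorphM !fraction_liftE ?rmorphM ?mulf_neq0 // mulf_div.
Qed.

Lemma fraction_liftB z w : liftable z -> liftable w ->
  fraction_lift (z - w) = fraction_lift z - fraction_lift w.
Proof.
move=> [[a s] [/= gs ->]] [[b t] [/= gt ->]].
have -> : to_resfield x a / to_resfield x s - to_resfield x b / to_resfield x t =
    to_resfield x (a * t - b * s) / to_resfield x (s * t).
  by rewrite rmorphB !rmorphM -[- (_ b / _)]mulNr addf_div ?fraction_lift_nz // mulNr.
have gst : g (s * t) != 0 by rewrite rmorphM mulf_neq0.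
by rewrite !fraction_liftE // rmorphB !rmorphM -[- (g b / _)]mulNr addf_div // mulNr.
Qed.

End FractionLift.

Section Preimage.
Variables (A B : comNzRingType) (f : {rmorphism A -> B}) (x : prime_idealr B).

Definition preimage_pred : A -> bool := fun a => f a \in x.

Lemma preimage_memE a : (a \in preimage_pred) = (f a \in x). Proof. by []. Qed.

Lemma preimage_idealr : idealr_closed preimage_pred.
Proof.
split=> [||a u v]; rewrite !preimage_memE ?rmorph0 ?rmorph1 ?idealr0 ?idealr1 // => ux vx.
by rewrite rmorphD rmorphM rpredD ?idealMr.
Qed.
HB.instance Definition _ := isIdealr.Build A preimage_pred preimage_idealr.

Lemma preimage_prime : prime_idealr_closed preimage_pred.
Proof. by move=> u v; rewrite !preimage_memE rmorphM prime_idealrM. Qed.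
HB.instance Definition _ := isPrimeIdealrClosed.Build A preimage_pred preimage_prime.

Definition preimage_ideal : prime_idealr A := preimage_pred.

Lemma mem_preimage a : (a \in preimage_ideal) = (f a \in x).
Proof. by []. Qed.

Local Notation g := (to_resfield x \o f).

Definition resfield_map : resfield preimage_ideal -> resfield x := fraction_lift g.

Lemma resfield_map_eq0 a : a \in preimage_ideal -> g a = 0.
Proof. by move=> ax; apply/eqP; rewrite to_resfield_eq0 -mem_preimage. Qed.

Lemma resfield_liftable (z : resfield preimage_ideal) : liftable g z.
Proof.
have [a [s [s0 ->]]] := resfield_frac z.
by exists (a, s); split=> //=; rewrite to_resfield_eq0 -mem_preimage -to_resfield_eq0.
Qed.

Lemma resfield_map_zmod : zmod_morphism resfield_map.
Proof.
move=> z w; apply: (fraction_liftB resfield_map_eq0); exact: resfield_liftable.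
Qed.
Lemma resfield_map_monoid : monoid_morphism resfield_map.
Proof.
split=> [|z w]; first exact: (fraction_lift1 resfield_map_eq0).
apply: (fraction_liftM resfield_map_eq0); exact: resfield_liftable.
Qed.
HB.instance Definition _ := GRing.isZmodMorphism.Build _ _ resfield_map
  resfield_map_zmod.
HB.instance Definition _ := GRing.isMonoidMorphism.Build _ _ resfield_map
  resfield_map_monoid.

End Preimage.

(* A pair of points x, y of Spec A with y in the closure of x. *)
Record specialization (A : comNzRingType) := Specialization {
  generic_pt : prime_idealr A;
  special_pt : prime_idealr A;
  special_sub : {subset generic_pt <= special_pt} }.

(* The local ring at y of the reduced closed subscheme closure{x} = Spec A/x, *)
(* as the subring of the residue field of x formed by the a/s with s not in y. *)
Section LocalRing.
Variables (A : comNzRingType) (t : specialization A).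
Local Notation x := (generic_pt t).
Local Notation y := (special_pt t).

Definition local_pred : {pred resfield x} :=
  fun z => `[< exists a s, s \notin y /\ z = to_resfield x a / to_resfield x s >].

Lemma local_den_neq0 s : s \notin y -> to_resfield x s != 0.
Proof. by rewrite to_resfield_eq0; apply: contra; apply: special_sub. Qed.

Lemma local_subring : subring_closed local_pred.
Proof.
have dM s1 s2 : s1 \notin y -> s2 \notin y -> s1 * s2 \notin y.
  by move=> h1 h2; rewrite prime_idealrM negb_or h1.
split=> [|z w /asboolP[a [s [sy ->]]] /asboolP[b [r [ry ->]]]
         |z w /asboolP[a [s [sy ->]]] /asboolP[b [r [ry ->]]]]; apply/asboolP.
- by exists 1, 1; rewrite idealr1 rmorph1 divr1.
- exists (a * r - b * s), (s * r); rewrite dM //; split=> //.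
  by rewrite rmorphB !rmorphM -[- (_ b / _)]mulNr addf_div ?local_den_neq0 // mulNr.
- exists (a * b), (s * r); rewrite dM //; split=> //.
  by rewrite !rmorphM mulf_div.
Qed.
HB.instance Definition _ :=
  GRing.isSubringClosed.Build (resfield x) local_pred local_subring.

Record local_ring := LocalRing
  { local_val :> resfield x; _ : local_val \in local_pred }.
HB.instance Definition _ := [isSub for local_val].
HB.instance Definition _ := [Choice of local_ring by <:].
HB.instance Definition _ := [SubChoice_isSubComNzRing of local_ring by <:].

Definition local_incl : {rmorphism local_ring -> resfield x} := val.

Fact local_of_subproof a : to_resfield x a \in local_pred.
Proof. by apply/asboolP; exists a, 1; rewrite idealr1 rmorph1 divr1. Qed.
Definition local_of a : local_ring := LocalRing (local_of_subproof a).

Lemma local_of_zmod : zmod_morphism local_of.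
Proof. by move=> a b; apply: val_inj; rewrite /= rmorphB. Qed.
Lemma local_of_monoid : monoid_morphism local_of.
Proof. by split=> [|a b]; apply: val_inj; [apply: rmorph1 | apply: rmorphM]. Qed.
HB.instance Definition _ := GRing.isZmodMorphism.Build A local_ring local_of
  local_of_zmod.
HB.instance Definition _ := GRing.isMonoidMorphism.Build A local_ring local_of
  local_of_monoid.

Definition local_residue (z : local_ring) : resfield y :=
  fraction_lift (to_resfield y) (val z).

Lemma local_residue_eq0 a : a \in x -> to_resfield y a = 0.
Proof. by move=> ax; apply/eqP; rewrite to_resfield_eq0; apply: special_sub. Qed.

Lemma local_liftable (z : local_ring) : liftable (to_resfield y) (val z).
Proof.
case: z => z /= /asboolP[a [s [sy ->]]].
by exists (a, s); split; rewrite //= to_resfield_eq0.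
Qed.

Lemma local_residue_zmod : zmod_morphism local_residue.
Proof.
move=> z w; apply: (fraction_liftB local_residue_eq0); exact: local_liftable.
Qed.
Lemma local_residue_monoid : monoid_morphism local_residue.
Proof.
split=> [|z w]; first exact: (fraction_lift1 local_residue_eq0).
by apply: (fraction_liftM local_residue_eq0); apply: local_liftable.
Qed.
HB.instance Definition _ := GRing.isZmodMorphism.Build _ _ local_residue
  local_residue_zmod.
HB.instance Definition _ := GRing.isMonoidMorphism.Build _ _ local_residue
  local_residue_monoid.

End LocalRing.

Fact preimage_spec_subproof (A B : comNzRingType) (f : {rmorphism A -> B})
  (t : specialization B) :
  {subset preimage_ideal f (generic_pt t) <= preimage_ideal f (special_pt t)}.
Proof. by move=> a; rewrite !mem_preimage; apply: special_sub. Qed.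
Definition preimage_spec (A B : comNzRingType) (f : {rmorphism A -> B})
  (t : specialization B) : specialization A :=
  Specialization (@preimage_spec_subproof A B f t).

(* Q_p, an algebraic closure of it and the completion of the latter, with the *)
(* p-adic absolute value normalised by |p| = 1/p. The fields are determined up *)
(* to isomorphism: Qp is the completion of the rationals for |.|.             *)
Record padic_fields (p : nat) (R : realType) := PadicFields {
  Qp : fieldType;
  Qpbar : closedFieldType;
  Cp : fieldType;
  QpbarOf : {rmorphism Qp -> Qpbar};
  CpOf : {rmorphism Qpbar -> Cp};
  absp : Cp -> R;
  absp_ge0 : forall c, 0 <= absp c;
  absp_eq0 : forall c, absp c = 0 <-> c = 0;
  abspM : forall c d, absp (c * d) = absp c * absp d;
  abspD : forall c d, absp (c + d) <= Num.max (absp c) (absp d);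
  absp_p : absp p%:R = p%:R^-1;
  Qp_dense : forall (u : Qp) (e : R), 0 < e ->
    exists r : rat, absp (CpOf (QpbarOf (u - ratr r))) < e;
  Qp_complete : forall u : nat -> Qp,
    (forall e : R, 0 < e -> exists N, forall m n, (N <= m)%N -> (N <= n)%N ->
       absp (CpOf (QpbarOf (u m - u n))) < e) ->
    exists l, forall e : R, 0 < e -> exists N, forall n, (N <= n)%N ->
       absp (CpOf (QpbarOf (u n - l))) < e;
  Qpbar_algebraic : forall a : Qpbar, algebraicOver QpbarOf a;
  Qpbar_dense : forall (c : Cp) (e : R), 0 < e ->
    exists a : Qpbar, absp (c - CpOf a) < e;
  Cp_complete : forall u : nat -> Cp,
    (forall e : R, 0 < e -> exists N, forall m n, (N <= m)%N -> (N <= n)%N ->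
       absp (u m - u n) < e) ->
    exists l, forall e : R, 0 < e -> exists N, forall n, (N <= n)%N ->
       absp (u n - l) < e }.

Section Rings.
Variables (p : nat) (R : realType) (X : padic_fields p R).
Local Notation Qp := (Qp X).
Local Notation Qpbar := (Qpbar X).
Local Notation Cp := (Cp X).
Local Notation absp := (@absp p R X).

Lemma absp0 : absp 0 = 0. Proof. exact/absp_eq0. Qed.

Lemma absp1 : absp 1 = 1.
Proof.
have h : absp 1 != 0.
  by apply/eqP => /absp_eq0 /eqP; rewrite oner_eq0.
by apply: (mulfI h); rewrite -abspM !mulr1.
Qed.

Lemma abspN c : absp (- c) = absp c.
Proof.
have N1 : absp (-1) = 1.
  apply/eqP; have := sqrp_eq1 (absp_ge0 (-1)) => /(_ R) <-.
  by rewrite expr2 -abspM mulrNN mulr1 absp1.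
by rewrite -mulN1r abspM N1 mul1r.
Qed.

Lemma abspX c n : absp (c ^+ n) = absp c ^+ n.
Proof. by elim: n => [|n IH]; rewrite ?expr0 ?absp1 // !exprS abspM IH. Qed.

Lemma absp_int_subring : subring_closed [pred c : Cp | absp c <= 1].
Proof.
split=> [|c d|c d]; rewrite !inE ?absp1 //.
  move=> hc hd; apply: le_trans (abspD _ _) _.
  by rewrite abspN ge_max hc.
by move=> hc hd; rewrite abspM mulr_ile1 ?absp_ge0.
Qed.

(* o_p, the valuation ring of Cp *)
Definition op_pred : {pred Cp} := fun c => absp c <= 1.
HB.instance Definition _ := GRing.isSubringClosed.Build Cp op_pred absp_int_subring.

Record op := Op { op_val :> Cp; _ : op_val \in op_pred }.
HB.instance Definition _ := [isSub for op_val].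
HB.instance Definition _ := [Choice of op by <:].
HB.instance Definition _ := [SubChoice_isSubComNzRing of op by <:].

Lemma opP (c : op) : absp c <= 1. Proof. by case: c. Qed.

Definition op_max : op -> bool := fun c => absp c < 1.

Lemma op_maxE c : (c \in op_max) = (absp c < 1). Proof. by []. Qed.

Lemma op_max_idealr : idealr_closed op_max.
Proof.
split=> [||c d e]; rewrite !op_maxE /= ?absp0 ?absp1 ?ltr01 ?ltxx //.
move=> hd he; apply: le_lt_trans (abspD _ _) _; rewrite gt_max he andbT.
by rewrite abspM; apply: le_lt_trans hd; rewrite ler_piMl ?absp_ge0 ?opP.
Qed.
HB.instance Definition _ := isIdealr.Build op op_max op_max_idealr.

Lemma op_max_prime : prime_idealr_closed op_max.
Proof.
move=> c d; rewrite !op_maxE /= abspM => cd; apply/orP.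
case: (ltrP (absp c) 1) => [|c1]; [by left | right].
by rewrite ltNge; apply: contraTN cd => d1; rewrite -leNgt mulr_ege1.
Qed.
HB.instance Definition _ := isPrimeIdealrClosed.Build op op_max op_max_prime.

Definition op_max_ideal : prime_idealr op := op_max.
Definition Fpbar := dquot op_max_ideal.
HB.instance Definition _ := GRing.IntegralDomain.on Fpbar.
Definition op_residue : {rmorphism op -> Fpbar} := dquot_of op_max_ideal.

Definition Zp_pred : {pred Qp} := fun u => absp (CpOf X (QpbarOf X u)) <= 1.
Lemma Zp_subring : subring_closed Zp_pred.
Proof.
have [h1 hB hM] := absp_int_subring.
split=> [|u v hu hv|u v hu hv]; rewrite unfold_in /Zp_pred.
- by rewrite !rmorph1 absp1.
- by rewrite !rmorphB; apply: hB.
- by rewrite !rmorphM; apply: hM.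
Qed.
HB.instance Definition _ := GRing.isSubringClosed.Build Qp Zp_pred Zp_subring.

Record Zp := MkZp { Zp_val :> Qp; _ : Zp_val \in Zp_pred }.
HB.instance Definition _ := [isSub for Zp_val].
HB.instance Definition _ := [Choice of Zp by <:].
HB.instance Definition _ := [SubChoice_isSubComNzRing of Zp by <:].

Definition ZpQpbar : {rmorphism Zp -> Qpbar} := QpbarOf X \o val.

(* o_K, the integral closure of Z_p in K = Qpbar *)
Definition oK_pred : {pred Qpbar} := fun a => `[< integralOver ZpQpbar a >].
Lemma oK_subring : subring_closed oK_pred.
Proof.
split=> [|a b /asboolP ha /asboolP hb|a b /asboolP ha /asboolP hb]; apply/asboolP.
- exact: integral1.
- exact: integral_sub.
- exact: integral_mul.
Qed.
HB.instance Definition _ := GRing.isSubringClosed.Build Qpbar oK_pred oK_subring.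

Record oK := MkoK { oK_val :> Qpbar; _ : oK_val \in oK_pred }.
HB.instance Definition _ := [isSub for oK_val].
HB.instance Definition _ := [Choice of oK by <:].
HB.instance Definition _ := [SubChoice_isSubComNzRing of oK by <:].


Lemma absp_nat n : absp n%:R <= 1.
Proof.
elim: n => [|n IH]; first by rewrite absp0 ler01.
by rewrite -addn1 natrD; apply: le_trans (abspD _ _) _; rewrite ge_max IH absp1 /=.
Qed.

Lemma oK_op_subproof (a : oK) : CpOf X (val a) \in op_pred.
Proof.
case: a => a /= /asboolP[f f_monic fa0]; rewrite unfold_in /op_pred.
set c := CpOf X a; rewrite leNgt; apply/negP => c1.
pose h : {rmorphism Zp -> Cp} := CpOf X \o ZpQpbar.
have /eqP : (map_poly h f).[c] = 0.
  rewrite map_poly_comp horner_map; move/rootP: fa0 => ->; exact: rmorph0.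
rewrite horner_coef size_map_poly_id0; last first.
  by rewrite (monicP f_monic) rmorph1 oner_neq0.
have sf : (size f).-1.+1 = size f.
  by rewrite prednK // size_poly_gt0 monic_neq0.
set n := (size f).-1 in sf *; rewrite -sf big_ord_recr /= addrC addr_eq0 => /eqP eqn.
have lt_sum (m : nat) : (m <= n)%N ->
    absp (\sum_(i < m) (map_poly h f)`_i * c ^+ i) < absp c ^+ n.
  elim: m => [|m IH] mn; first by rewrite big_ord0 absp0 exprn_gt0 // (lt_trans ltr01).
  rewrite big_ord_recr /=; apply: le_lt_trans (abspD _ _) _.
  rewrite gt_max IH ?(ltnW mn) //= abspM abspX (coef_map h).
  apply: (@le_lt_trans _ _ (absp c ^+ m)).
    rewrite ler_piMl ?exprn_ge0 ?absp_ge0 //.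
    by case: (f`_m) => u /= hu; apply: hu.
  by rewrite ltr_eXn2l.
have := lt_sum n (leqnn n); rewrite -abspN -eqn abspM abspX (coef_map h).
have hn : h f`_n = 1.
  by have -> : f`_n = 1; [apply/eqP | apply: rmorph1].
by move: hn; rewrite /h /= => ->; rewrite absp1 mul1r ltxx.
Qed.
Definition oK_op (a : oK) : op := Op (oK_op_subproof a).

Lemma oK_op_zmod : zmod_morphism oK_op.
Proof. by move=> a b; apply: val_inj; apply: (rmorphB (CpOf X)). Qed.
Lemma oK_op_monoid : monoid_morphism oK_op.
Proof.
split=> [|a b]; apply: val_inj; first exact: (rmorph1 (CpOf X)).
exact: (rmorphM (CpOf X)).
Qed.
HB.instance Definition _ := GRing.isZmodMorphism.Build oK op oK_op oK_op_zmod.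
HB.instance Definition _ := GRing.isMonoidMorphism.Build oK op oK_op oK_op_monoid.

Record gal := Gal {
  gal_fun :> {rmorphism Qpbar -> Qpbar};
  gal_bij : bijective gal_fun;
  gal_fix : forall u, gal_fun (QpbarOf X u) = QpbarOf X u }.

Fact gal_oK_subproof (s : gal) (a : oK) : s (val a) \in oK_pred.
Proof.
case: a => a /= /asboolP[f f_monic fa0]; apply/asboolP; exists f => //.
have -> : map_poly ZpQpbar f = map_poly s (map_poly ZpQpbar f).
  rewrite -map_poly_comp; apply: eq_map_poly => u /=.
  by rewrite gal_fix.
exact: rmorph_root.
Qed.
Definition gal_oK (s : gal) (a : oK) : oK := MkoK (gal_oK_subproof s a).

Lemma gal_oK_zmod s : zmod_morphism (gal_oK s).
Proof. by move=> a b; apply: val_inj; apply: (rmorphB s). Qed.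
Lemma gal_oK_monoid s : monoid_morphism (gal_oK s).
Proof.
by split=> [|a b]; apply: val_inj; [apply: (rmorph1 s) | apply: (rmorphM s)].
Qed.
HB.instance Definition _ s := GRing.isZmodMorphism.Build oK oK (gal_oK s)
  (gal_oK_zmod s).
HB.instance Definition _ s := GRing.isMonoidMorphism.Build oK oK (gal_oK s)
  (gal_oK_monoid s).

Variable p_pr : prime p.
Local Notation opb := (tilt p_pr op).

(* The isomorphism lim o_K/p -> lim o_p/p, and its inverse; it identifies the *)
(* tilt of the completion of o_K with that of o_p.                            *)
Definition tilt_oK_op : tilt p_pr oK -> opb := tilt_map oK_op.
Definition tilt_op_oK (a : opb) : tilt p_pr oK :=
  xget 0 [set u | tilt_oK_op u = a]%classic.

Definition gal_tilt (s : gal) (a : opb) : opb :=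
  tilt_oK_op (tilt_map (gal_oK s) (tilt_op_oK a)).

Local Open Scope classical_set_scope.

Definition local_completion (t : specialization oK) : comPzRingType :=
  completion p (local_ring t).

(* (x, y, P) with y in the closure of x; the homomorphism from the units of   *)
(* lim kappa(x) to those of Cp is recorded by its extension by zero, and the  *)
(* predicate plim_multiplicative below.                                       *)
Record triple := Triple {
  triple_pts : specialization oK;
  triple_map : plim p (resfield (generic_pt triple_pts)) -> Cp }.

Section Triple.
Variable t : triple.
Local Notation O := (local_ring (triple_pts t)).
Local Notation hatO := (local_completion (triple_pts t)).

Definition is_hat (P : plim p hatO -> op) :=
  [/\ plim_multiplicative P, plim_continuous P &
      exists2 Q : plim p (resfield (special_pt (triple_pts t))) -> Fpbar,
        plim_multiplicative Q &
        forall a : plim p O,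
          val (P (plim_map (@completion_of p O) a)) =
            triple_map (plim_map (@local_incl _ _) a) /\
          op_residue (P (plim_map (@completion_of p O) a)) =
            Q (plim_map (@local_residue _ _) a)].

(* For t in Xhat exactly one map satisfies [is_hat]. *)
Definition hat : plim p hatO -> op := xget (fun=> 0) [set P | is_hat P].

Definition hat_tilt (a : tilt p_pr hatO) : op := hat (untilt a).

Definition additive_mod_p :=
  forall a b, padic_close p 1 (hat_tilt (a + b)) (hat_tilt a + hat_tilt b).

Definition hat_factors :=
  exists (i : nat) (chi : hatO -> op),
    [/\ padic_continuous p chi, {morph chi : z w / z * w} &
        forall a : plim p hatO, hat a = chi (a i)].

Definition tilt_to_local (a : opb) : tilt p_pr hatO :=
  tilt_map (@completion_of p O \o @local_of _ _) (tilt_op_oK a).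

(* The sequence lies in the tilt for t in Xhat, so the default 0 is not used. *)
Definition endo_of_triple (a : opb) : opb :=
  insubd 0 (fun n : nat =>
    pquot_of p%:R (hat (plim_shift n (untilt (tilt_to_local a)))) : modp p op).

End Triple.

Definition Xhat : set triple :=
  [set t | plim_multiplicative (@triple_map t) /\ exists P, @is_hat t P].
Definition Ydiamond : set triple := [set t | Xhat t /\ additive_mod_p t].
Definition Ycheck : set triple := [set t | Ydiamond t /\ hat_factors t].

Definition triple_act (s : gal) (t : triple) : triple :=
  @Triple (preimage_spec (gal_oK s) (triple_pts t))
    (fun a => triple_map (plim_map (@resfield_map _ _ (gal_oK s) _) a)).

Definition triple_orbit (t : triple) : set triple := [set triple_act s t | s in setT].
Definition Ydiamond0 : set (set triple) := triple_orbit @` Ydiamond.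
Definition Ycheck0 : set (set triple) := triple_orbit @` Ycheck.

Definition End_cont : set (opb -> opb) :=
  [set phi | (exists g : {rmorphism opb -> opb}, phi = g :> (opb -> opb)) /\
             tilt_continuous phi].
Definition endo_orbit (phi : opb -> opb) : set (opb -> opb) :=
  [set phi \o gal_tilt s | s in setT].
Definition End_cont0 : set (set (opb -> opb)) := endo_orbit @` End_cont.

Definition identification (O : set triple) : set (opb -> opb) :=
  endo_of_triple @` O.

(* F_p^m acting on G-orbits of endomorphisms. *)
Definition frob_act (m : int) (O : set (opb -> opb)) : set (opb -> opb) :=
  [set phi \o tilt_frob m | phi in O].
Definition frob_orbit (O : set (opb -> opb)) : set (set (opb -> opb)) :=
  [set frob_act m O | m in [set: int]].

Definition opb_residue (a : opb) : Fpbar := op_residue (repr (a 0%N)).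

(* The embedding of the residue field as a subfield of the tilt: the unique   *)
(* ring section of the residue map.                                           *)
Definition Fpbar_opb : Fpbar -> opb :=
  xget (fun=> 0) [set f |
    (exists g : {rmorphism Fpbar -> opb}, f = g :> (Fpbar -> opb)) /\
    cancel f opb_residue].

Definition s0 : set (opb -> opb) := endo_orbit (Fpbar_opb \o opb_residue).
Definition eta0 : set (opb -> opb) := endo_orbit idfun.

End Rings.

Arguments Ydiamond0 {p R} X p_pr.
Arguments Ycheck0 {p R} X p_pr.
Arguments End_cont0 {p R} X p_pr.
Arguments identification {p R} X p_pr O.
Arguments s0 {p R} X p_pr.
Arguments eta0 {p R} X p_pr.

(* Main.v *)
(* Write c^# for the image of c under o_p^b = lim o_p -> o_p. A triple has y = m,
   since otherwise p is a unit in the local ring and its completion vanishes, and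
   x = 0 or x = m; its endomorphism phi determines it through P(alpha) = phi(alpha)^#
   for alpha in lim o_K, and phi is injective or has kernel m^b accordingly.
   - If phi has kernel m^b, it is the Teichmueller section composed with an
     endomorphism of the residue field, and this lifts to an element of G. At the
     closed point P always factors through a projection.
   - If phi is injective and P = chi o pr_i, fix a compatible system eps of p-power
     roots of 1 with eps^# = 1, (eps^(1/p))^# <> 1, and twist phi by Frobenius so that
     phi(eps) has the same two properties. Let Gamma be the additive group generated
     by the triples (c^#, phi(c)^#, c). By successive p-adic approximation, using that
     xi = sum_(i < p) eps^(i/p) generates the elements c with c^# divisible by p, every
     (u, v, c) in Gamma with u divisible by p^n has v divisible by p^n. So
     c^# |-> phi(c)^# extends to a ring homomorphism o_K -> o_p, which is given by
     some g in G, and phi is g up to Frobenius.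
   - Powers of Frobenius separate the orbits of F_p^n because |p^flat| = 1/p has
     distinct p^n-th powers. *)
Require Import Defs.
From HB Require Import structures.
From mathcomp Require Import all_boot all_order all_algebra.
From mathcomp Require Import boolp classical_sets functions cardinality reals.
From mathcomp Require Import cyclic separable filter.

Set Implicit Arguments.
Unset Strict Implicit.
Unset Printing Implicit Defensive.
Import Order.TTheory GRing.Theory Num.Theory.
Local Open Scope ring_scope.
(** * p-adic closeness, compatible root systems and the untilt *)

(** In the injective case the obstacle is that the map c -> c^# is neither additive nor injective,
    and phi need not respect its fibres. What survives is the binomial expansion: modulo p^n, (c +
    d)^# - c^# - d^# is p times an integral combination of values f^#, with f a product of p-power
    roots of c and d, and ring endomorphisms commute with such roots. Keeping c next to u and v
    turns divisibility of u by p into divisibility of c by xi; a multiple c of xi gives a triple (0,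
    0, c), because the powers of a nontrivial p-th root of unity sum to 0 on both sides. This is why
    phi(eps) has to be normalised like eps. The factorisation through pr_i serves to force
    phi(eps^(p^i))^# = 1; injectivity keeps the p-power roots from all having sharp value 1. For the
    residue field, an endomorphism is first lifted on finite sets of algebraic numbers, by moving a
    root of unity of order prime to p to a conjugate; an ultrafilter then glues the partial lifts.
    Both cases rest on a coordinate bound over Q_p, which shows that conjugates of elements of the
    unit ball stay in it and identifies o_K with the unit ball of the algebraic closure. *)

Section PadicClose.
Variables (p : nat) (A : comPzRingType).
Implicit Types x y z : A.
Local Notation close := (padic_close p).

Lemma padic_closeP n x y : close n x y <-> exists z, x = y + p%:R ^+ n * z.
Proof.
split=> [/multiplesP[z e]|[z ->]].
  by exists z; rewrite -e addrC subrK.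
by apply/multiplesP; exists z; rewrite addrC addKr.
Qed.

Lemma padic_close_refl n x : close n x x.
Proof. by apply/padic_closeP; exists 0; rewrite mulr0 addr0. Qed.

Lemma padic_close_eq n x y : x = y -> close n x y.
Proof. by move=> ->; apply: padic_close_refl. Qed.

Lemma padic_close0n x y : close 0 x y.
Proof. by apply/padic_closeP; exists (x - y); rewrite expr0 mul1r addrC subrK. Qed.

Lemma padic_close_sym n x y : close n x y -> close n y x.
Proof. by rewrite /padic_close -rpredN opprB. Qed.

Lemma padic_close_trans n y x z : close n x y -> close n y z -> close n x z.
Proof.
rewrite /padic_close => h1 h2.
by have := rpredD h1 h2; rewrite addrA subrK.
Qed.

Lemma padic_closeD n x y x' y' :
  close n x x' -> close n y y' -> close n (x + y) (x' + y').
Proof. by rewrite /padic_close => h1 h2; rewrite opprD addrACA rpredD. Qed.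

Lemma padic_closeN n x y : close n x y -> close n (- x) (- y).
Proof. by rewrite /padic_close => h; rewrite -opprD rpredN. Qed.

Lemma padic_closeB n x y x' y' :
  close n x x' -> close n y y' -> close n (x - y) (x' - y').
Proof. by move=> h1 h2; apply: padic_closeD h1 (padic_closeN h2). Qed.

Lemma padic_closeM n x y x' y' :
  close n x x' -> close n y y' -> close n (x * y) (x' * y').
Proof.
rewrite /padic_close => h1 h2.
have -> : x * y - x' * y' = y * (x - x') + x' * (y - y').
  by rewrite !mulrBr [y * x]mulrC [y * x']mulrC addrA subrK.
by rewrite rpredD ?multiplesMl.
Qed.

Lemma padic_closeX n k x y : close n x y -> close n (x ^+ k) (y ^+ k).
Proof.
move=> h; elim: k => [|k IH]; first exact: padic_close_refl.
by rewrite !exprS; apply: padic_closeM.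
Qed.

Lemma padic_close_sum n (I : Type) (r : seq I) (F G : I -> A) :
  (forall i, close n (F i) (G i)) ->
  close n (\sum_(i <- r) F i) (\sum_(i <- r) G i).
Proof.
move=> h; elim/big_rec2: _ => [|i x y _ hxy]; first exact: padic_close_refl.
exact: padic_closeD.
Qed.

Lemma padic_closeW n m x y : (m <= n)%N -> close n x y -> close m x y.
Proof.
move=> mn /padic_closeP[u ->]; apply/padic_closeP; exists (p%:R ^+ (n - m) * u).
by rewrite mulrA -exprD subnKC.
Qed.

Lemma padic_close_pmul n k x y :
  close n x y -> close (k + n) (p%:R ^+ k * x) (p%:R ^+ k * y).
Proof.
move=> /padic_closeP[u ->]; apply/padic_closeP; exists u.
by rewrite mulrDr mulrA -exprD.
Qed.

Lemma padic_close_p0 n z : close n (p%:R ^+ n * z) 0.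
Proof. by apply/padic_closeP; exists z; rewrite add0r. Qed.

(* In [x^p - y^p = (x - y) * s] the factor [s] is congruent to [p * y^(p-1)]. *)
Lemma padic_closeXp n x y :
  close n.+1 x y -> close n.+2 (x ^+ p) (y ^+ p).
Proof.
move=> h; rewrite /padic_close subrXX.
have hs : close 1 (\sum_(i < p) x ^+ (p.-1 - i) * y ^+ i) 0.
  apply: (@padic_close_trans _ (\sum_(i < p) y ^+ p.-1)).
    apply: padic_close_sum => i.
    have -> : y ^+ p.-1 = y ^+ (p.-1 - i) * y ^+ i.
      by rewrite -exprD subnK // -ltnS prednK // (leq_ltn_trans _ (ltn_ord i)).
    apply: padic_closeM (padic_close_refl _ _).
    exact/padic_closeX/(padic_closeW _ h).
  by rewrite sumr_const card_ord -mulr_natl -{1}(expr1 p%:R); apply: padic_close_p0.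
move/multiplesP: h => [u ->]; move/padic_closeP: hs => [v ->].
by apply/multiplesP; exists (u * v); rewrite add0r expr1 [p%:R ^+ n.+2]exprSr -!mulrA [u * _]mulrCA.
Qed.

(** Each p-th power gains a factor p, but only from a congruence modulo p on: a congruence modulo 1
    carries no information, hence [n.+1]. *)
Lemma padic_closeXpn n k x y :
  close n.+1 x y -> close (n + k).+1 (x ^+ (p ^ k)) (y ^+ (p ^ k)).
Proof.
elim: k => [|k IH] h; first by rewrite addn0 expn0 !expr1.
by rewrite addnS expnSr !exprM; apply: padic_closeXp; apply: IH.
Qed.

(* [pquot_of p] with codomain the ring [modp p A] of the components of the tilt. *)
Definition modp_of : {rmorphism A -> Defs.modp p A} := pquot_of (p%:R : A).

Lemma modp_ofP x y : modp_of x = modp_of y <-> close 1 x y.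
Proof.
by rewrite /padic_close expr1 -pquot_eq; split=> [/(congr1 (fun u => u == modp_of y))|/eqP //];
  rewrite eqxx.
Qed.

Lemma modp_of_surj (u : Defs.modp p A) : exists x, modp_of x = u.
Proof. by exists (repr u); apply: pquot_reprK. Qed.

Definition modp_repr (u : Defs.modp p A) : A := repr u.

Lemma modp_reprK : cancel modp_repr modp_of.
Proof. exact: pquot_reprK. Qed.

Definition padic_separated := forall x, (forall n, close n x 0) -> x = 0.

Definition padic_complete := padic_separated /\
  forall u : nat -> A, (forall n, close n (u n.+1) (u n)) ->
    exists l, forall n, close n l (u n).

Lemma padic_separatedP x y :
  padic_separated -> (forall n, close n x y) -> x = y.
Proof.
move=> sep h; apply/eqP; rewrite -subr_eq0; apply/eqP/sep => n.
by have := h n; rewrite /padic_close subr0.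
Qed.

End PadicClose.
Arguments modp_of p {A}.

Lemma padic_close_map (p : nat) (A B : comPzRingType) (f : {rmorphism A -> B}) n x y :
  padic_close p n x y -> padic_close p n (f x) (f y).
Proof.
move=> /padic_closeP[u ->]; apply/padic_closeP; exists (f u).
by rewrite rmorphD rmorphM rmorphXn rmorph_nat.
Qed.

Section PlimExtra.
Variable p : nat.

Lemma plim_eq (A : pzRingType) (u v : plim p A) : (forall n, u n = v n) -> u = v.
Proof. by move=> h; apply: val_inj; apply/funext. Qed.

Lemma plimPn (A : pzRingType) (u : plim p A) n k : u (n + k)%N ^+ (p ^ k) = u n.
Proof.
elim: k => [|k IH]; first by rewrite addn0 expr1.
by rewrite addnS expnS exprM plimP.
Qed.

Lemma is_power_seqP (A : pzRingType) (u : nat -> A) :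
  (forall n, u n.+1 ^+ p = u n) -> is_power_seq p u.
Proof. by move=> h; apply/asboolP. Qed.

Lemma plim_mulE (A : comPzRingType) (u v : plim p A) n : plim_mul u v n = u n * v n.
Proof. by []. Qed.

Lemma plim_mapE (A B : pzRingType) (f : {rmorphism A -> B}) (u : plim p A) n :
  plim_map f u n = f (u n).
Proof. by []. Qed.

(* p-th roots give compatible systems of roots above any element. *)
Lemma plim_lift (A : pzRingType) (x : A) (k : nat) :
  (forall y : A, exists z, z ^+ p = y) -> exists u : plim p A, u k = x.
Proof.
move=> /choice[r rP]; pose f n := if (n <= k)%N then x ^+ (p ^ (k - n)) else iter (n - k) r x.
have fP n : f n.+1 ^+ p = f n.
  rewrite /f; case: ltnP => nk.
    by rewrite (ltnW nk) -exprM -expnSr subnSK.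
  rewrite subSn // iterS rP; case: (leqP n k) => // nk'.
  by have -> : n = k by [apply/eqP; rewrite eqn_leq nk' nk]; rewrite subnn expr1.
exists (Plim (is_power_seqP fP)).
by rewrite /= /f leqnn subnn expr1.
Qed.

End PlimExtra.

Section TiltExtra.
Variables (p : nat) (p_pr : prime p) (A : comPzRingType).
Implicit Types a b c : tilt p_pr A.

Lemma tilt_eq a b : (forall n, a n = b n) -> a = b.
Proof. by move=> h; apply: val_inj; apply/funext. Qed.

Lemma tiltPn a n k : a (n + k)%N ^+ (p ^ k) = a n.
Proof.
elim: k => [|k IH]; first by rewrite addn0 expr1.
by rewrite addnS expnS exprM tiltP.
Qed.

Lemma tilt_eq_le a b n m : (n <= m)%N -> a m = b m -> a n = b n.
Proof. by move=> nm; rewrite -(tiltPn a n (m - n)) -(tiltPn b n (m - n)) subnKC // => ->. Qed.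

Lemma tiltD a b n : (a + b) n = a n + b n. Proof. by []. Qed.
Lemma tiltB a b n : (a - b) n = a n - b n. Proof. by []. Qed.
Lemma tiltM a b n : (a * b) n = a n * b n. Proof. by []. Qed.
Lemma tilt1 n : (1 : tilt p_pr A) n = 1. Proof. by []. Qed.
Lemma tilt0 n : (0 : tilt p_pr A) n = 0. Proof. by []. Qed.
Lemma tiltX a k n : (a ^+ k) n = a n ^+ k.
Proof. by elim: k => // k IH; rewrite !exprS tiltM IH. Qed.

Lemma tilt_redE (u : plim p A) n : tilt_red p_pr u n = modp_of p (u n).
Proof. by []. Qed.

Lemma tilt_redM (u v : plim p A) :
  tilt_red p_pr (plim_mul u v) = tilt_red p_pr u * tilt_red p_pr v.
Proof. by apply: tilt_eq => n; rewrite tiltM !tilt_redE rmorphM. Qed.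

Lemma tilt_red1 : tilt_red p_pr (plim1 p A) = 1.
Proof. exact: tilt_eq. Qed.

Lemma tilt_rootE k a n : tilt_root k a n = a (n + k)%N. Proof. by []. Qed.

Lemma tilt_red_shift k (u : plim p A) :
  tilt_red p_pr (plim_shift k u) = tilt_root k (tilt_red p_pr u).
Proof. exact: tilt_eq. Qed.

Lemma tilt_nat k n : (k%:R : tilt p_pr A) n = k%:R.
Proof. by elim: k => // k IH; rewrite -addn1 !natrD tiltD IH. Qed.

Lemma tilt_p0 : p%:R = 0 :> tilt p_pr A.
Proof. by apply: tilt_eq => n; rewrite tilt_nat (modp_p0 p A). Qed.

Lemma tilt_rootXK k a : tilt_root k a ^+ (p ^ k) = a.
Proof. by apply: tilt_eq => n; rewrite tiltX tiltPn. Qed.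

Lemma tilt_rootK k a : tilt_root k (a ^+ (p ^ k)) = a.
Proof. by apply: tilt_eq => n; rewrite tilt_rootE tiltX tiltPn. Qed.

Lemma tilt_expD k a b : (a + b) ^+ (p ^ k) = a ^+ (p ^ k) + b ^+ (p ^ k).
Proof.
elim: k => [|k IH]; first by rewrite !expr1.
by rewrite expnSr !exprM IH (frobenius_add p_pr) // tilt_p0.
Qed.

Lemma tilt_expI k : injective (fun a => a ^+ (p ^ k)).
Proof. by move=> a b /= /(congr1 (tilt_root k)); rewrite !tilt_rootK. Qed.

Lemma tilt_rootM k a b : tilt_root k (a * b) = tilt_root k a * tilt_root k b.
Proof. exact: tilt_eq. Qed.
Lemma tilt_rootD k a b : tilt_root k (a + b) = tilt_root k a + tilt_root k b.
Proof. exact: tilt_eq. Qed.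

Section Complete.
Hypothesis Ac : padic_complete p A.

(** Agreement modulo p at level [n + k] becomes, after [p ^ k]-th powers, agreement modulo p^(k+1)
    at level [n]; separatedness concludes. *)
Lemma tilt_red_inj : injective (@tilt_red p p_pr A).
Proof.
move=> u v e; apply: plim_eq => n; apply: (padic_separatedP Ac.1) => k.
rewrite -(plimPn u n k) -(plimPn v n k).
apply: (@padic_closeW _ _ (0 + k).+1); first by rewrite add0n.
apply/padic_closeXpn/modp_ofP.
by have := congr1 (fun w : tilt p_pr A => w (n + k)%N) e; rewrite !tilt_redE.
Qed.

(** The component at [n] is the limit over k of the [p ^ k]-th powers of arbitrary lifts of
    [a (n + k)]. Changing a lift modulo p changes the power modulo p^(k+1) only, so the sequence
    converges. *)
Lemma tilt_red_surj a : exists u : plim p A, tilt_red p_pr u = a.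
Proof.
pose f n k : A := modp_repr (a (n + k)%N) ^+ (p ^ k).
have step n k : padic_close p k.+1 (f n k.+1) (f n k).
  rewrite /f expnS exprM; apply/(@padic_closeXpn p A 0 k)/modp_ofP.
  by rewrite rmorphXn !modp_reprK addnS tiltP.
have /choice[l lP] : forall n, exists l : A, forall k, padic_close p k l (f n k).
  by move=> n; apply: Ac.2 => k; apply: padic_closeW (step n k).
have lp n : l n.+1 ^+ p = l n.
  apply: (padic_separatedP Ac.1) => -[|k]; first exact: padic_close0n.
  apply: (padic_close_trans _ (padic_close_sym (lP n k.+1))).
  apply: (padic_close_trans _ (padic_closeW (leqnSn _) (step n k.+1))).
  have -> : f n k.+2 = f n.+1 k.+1 ^+ p by rewrite /f -exprM -expnSr addSnnS.
  exact/padic_closeX/lP.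
exists (Plim (is_power_seqP lp)); apply: tilt_eq => n; rewrite tilt_redE /=.
have /modp_ofP -> : padic_close p 1 (l n) (modp_repr (a n)).
  apply: (padic_close_trans (lP n 1%N)).
  apply/modp_ofP.
  by rewrite /f expn1 rmorphXn !modp_reprK addn1 tiltP.
exact: modp_reprK.
Qed.

Lemma untiltK a : tilt_red p_pr (untilt a) = a.
Proof.
rewrite /untilt; case: xgetP => [u _ //|/= nex].
by have [u /nex] := tilt_red_surj a.
Qed.

Lemma tilt_redK (u : plim p A) : untilt (tilt_red p_pr u) = u.
Proof. by apply: tilt_red_inj; rewrite untiltK. Qed.

Lemma untilt_root k a : untilt (tilt_root k a) = plim_shift k (untilt a).
Proof. by apply: tilt_red_inj; rewrite untiltK tilt_red_shift untiltK. Qed.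

Lemma untiltM a b : untilt (a * b) = plim_mul (untilt a) (untilt b).
Proof. by apply: tilt_red_inj; rewrite untiltK tilt_redM !untiltK. Qed.

Lemma untilt1 : untilt (1 : tilt p_pr A) = plim1 p A.
Proof. by apply: tilt_red_inj; rewrite untiltK tilt_red1. Qed.

Lemma untilt_red a n : modp_of p (untilt a n) = a n.
Proof. by rewrite -{2}(untiltK a). Qed.

Definition sharp a : A := untilt a 0.

Lemma sharp_root k a : sharp (tilt_root k a) = untilt a k.
Proof. by rewrite /sharp untilt_root /= add0n. Qed.

Lemma sharp_red (u : plim p A) : sharp (tilt_red p_pr u) = u 0%N.
Proof. by rewrite /sharp tilt_redK. Qed.

Lemma sharpM a b : sharp (a * b) = sharp a * sharp b.
Proof. by rewrite /sharp untiltM. Qed.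

Lemma sharp1 : sharp 1 = 1.
Proof. by rewrite /sharp untilt1. Qed.

Lemma sharpX a k : sharp (a ^+ k) = sharp a ^+ k.
Proof. by elim: k => [|k IH]; rewrite ?expr0 ?sharp1 // !exprS sharpM IH. Qed.

Lemma sharp_modp a : modp_of p (sharp a) = a 0%N.
Proof. exact: untilt_red. Qed.

Lemma tilt_zero_seq (u : plim p A) : (forall n, u n = 0) -> tilt_red p_pr u = 0.
Proof. by move=> u0; apply: tilt_eq => n; rewrite tilt_redE u0 rmorph0. Qed.

Lemma sharp0 : sharp 0 = 0.
Proof.
have z : is_power_seq p (fun=> 0 : A).
  by apply: is_power_seqP => n; rewrite expr0n -leqn0 leqNgt prime_gt0.
by rewrite -(@tilt_zero_seq (Plim z)) // sharp_red.
Qed.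

(* The sum in the tilt is the limit of the p^n-th powers of sums of p^n-th roots. *)
Lemma sharp_add a b n :
  padic_close p n.+1 (sharp (a + b)) ((untilt a n + untilt b n) ^+ (p ^ n)).
Proof.
rewrite /sharp -(plimPn _ 0 n) add0n; apply: (@padic_closeXpn p A 0 n).
by apply/modp_ofP; rewrite rmorphD !untilt_red.
Qed.

Lemma untilt_close a b n k : a (n + k)%N = b (n + k)%N ->
  padic_close p k.+1 (untilt a n) (untilt b n).
Proof.
move=> e; rewrite -(plimPn _ n k) -(plimPn (untilt b) n k).
by apply: (@padic_closeXpn p A 0 k); apply/modp_ofP; rewrite !untilt_red.
Qed.

End Complete.
End TiltExtra.

(** * p-adic completions *)

Section CompletionTheory.
Variables (p : nat) (A : comPzRingType).
Local Notation hatA := (completion p A).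
Implicit Types (z w : hatA) (a b : A).

Definition trunc z n : pow_quot p A n := completion_val z n.

Definition completion_repr z n : A := repr (trunc z n).

Lemma completion_reprK z n : pquot_of (p%:R ^+ n) (completion_repr z n) = trunc z n.
Proof. exact: pquot_reprK. Qed.

Lemma trunc_red z n : pow_quot_red (trunc z n.+1) = trunc z n.
Proof. by have /asboolP := valP z; apply. Qed.

Lemma completion_repr_le z m n : (m <= n)%N ->
  pquot_of (p%:R ^+ m) (completion_repr z n) = trunc z m.
Proof.
move=> /subnKC <-; elim: (n - m)%N => [|k IH]; first by rewrite addn0 completion_reprK.
rewrite addnS -IH; set k' := (m + k)%N.
have := trunc_red z k'.
rewrite -{1}(completion_reprK z k'.+1) pow_quot_redE -{1}(completion_reprK z k').
move/eqP; rewrite pquot_eq => h; apply/eqP; rewrite pquot_eq.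
by apply: (padic_closeW (leq_addr k m) h).
Qed.

Lemma completionD z w n : trunc (z + w) n = trunc z n + trunc w n. Proof. by []. Qed.
Lemma completionB z w n : trunc (z - w) n = trunc z n - trunc w n. Proof. by []. Qed.
Lemma completionM z w n : trunc (z * w) n = trunc z n * trunc w n. Proof. by []. Qed.

Lemma completion_eq z w : (forall n, trunc z n = trunc w n) -> z = w.
Proof. by move=> h; apply/val_inj/functional_extensionality_dep. Qed.

Lemma completion_ofE a n : trunc (completion_of p a) n = pquot_of _ a.
Proof. by []. Qed.

Lemma completion_of_pow k n : trunc (p%:R ^+ k) n = pquot_of _ (p%:R ^+ k).
Proof.
by rewrite -(rmorph_nat (completion_of (A := A) p)) -rmorphXn completion_ofE.
Qed.

(* The quotients by [p^n] are successively lifted so that they form a coherent *)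
(* family; dividing representatives independently could fail if [p] is a zero  *)
(* divisor.                                                                   *)
Lemma completion_div z n : trunc z n = 0 -> exists w, z = p%:R ^+ n * w.
Proof.
move=> zn0; pose e k := completion_repr z (n + k).
have e0 : exists y, e 0%N = p%:R ^+ n * y.
  apply/multiplesP; rewrite -[e _]subr0 -pquot_eq rmorph0 -zn0; apply/eqP.
  by rewrite /e addn0 completion_reprK.
have [x0 x0P] := e0.
have step k : exists y, e k.+1 - e k = p%:R ^+ (n + k) * y.
  apply/multiplesP; rewrite -pquot_eq; apply/eqP.
  by rewrite !completion_repr_le // addnS.
have [y yP] := choice step.
pose x k := x0 + \sum_(i < k) p%:R ^+ i * y i.
have xP k : e k = p%:R ^+ n * x k.
  elim: k => [|k IH]; first by rewrite /x big_ord0 addr0.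
  rewrite /x big_ord_recr /= addrA mulrDr -/(x k) -IH mulrA -exprD -yP.
  by rewrite addrC subrK.
have coh : (fun k => pquot_of (p%:R ^+ k) (x k) : pow_quot p A k) \in @coherent p A.
  apply/asboolP => k; rewrite pow_quot_redE; apply/eqP; rewrite pquot_eq.
  apply/multiplesP; exists (y k); rewrite /x big_ord_recr /= addrA.
  by set s := x0 + _; rewrite [s + _]addrC addrK.
exists (Completion coh); apply: completion_eq => k.
rewrite completionM completion_of_pow.
transitivity (pquot_of (p%:R ^+ k) (e k)); first by rewrite completion_repr_le ?leq_addl.
by rewrite xP rmorphM.
Qed.

(** The p-adic topology of the completion is its inverse limit topology. The nontrivial direction is
    that an element with zero n-th truncation is a multiple of p^n. *)
Lemma completion_closeP n z w : padic_close p n z w <-> trunc z n = trunc w n.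
Proof.
split=> [/padic_closeP[t ->]|e].
  rewrite completionD completionM completion_of_pow.
  have -> : pquot_of (p%:R ^+ n) (p%:R ^+ n) = 0 :> pow_quot p A n.
    by apply/eqP; rewrite -(rmorph0 (pquot_of _)) pquot_eq subr0; apply/multiplesP; exists 1; rewrite mulr1.
  by rewrite mul0r addr0.
have [|t tE] := @completion_div (z - w) n; first by rewrite completionB e subrr.
by apply/padic_closeP; exists t; rewrite -tE addrC subrK.
Qed.

Lemma completion_of_close n a b :
  padic_close p n (completion_of p a) (completion_of p b) <-> padic_close p n a b.
Proof.
split=> [/completion_closeP|]; last exact: padic_close_map.
by rewrite !completion_ofE => /eqP; rewrite pquot_eq.
Qed.

Lemma completion_approx z n : exists a, padic_close p n z (completion_of p a).
Proof.
exists (completion_repr z n); apply/completion_closeP.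
by rewrite completion_ofE completion_reprK.
Qed.

Lemma completion_complete : padic_complete p hatA.
Proof.
split=> [z zP|u uP].
  by apply: completion_eq => n; apply/completion_closeP.
have coh : (fun n => trunc (u n) n) \in @coherent p A.
  apply/asboolP => n; have /completion_closeP <- := uP n.
  exact: trunc_red.
by exists (Completion coh) => n; apply/completion_closeP.
Qed.

End CompletionTheory.

(** * The valuation ring of the algebraic closure *)

Section AbsoluteValue.
Variables (p : nat) (p_pr : prime p) (R : realType) (X : padic_fields p R).
Local Notation Qp := (Qp X).
Local Notation Qpbar := (Qpbar X).
Local Notation Cp := (Cp X).
Local Notation absp := (@absp p R X).
Local Notation CpOf := (CpOf X).
Local Notation QpbarOf := (@QpbarOf p R X).

Definition QpCp (u : Qp) : Cp := CpOf (QpbarOf u).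
HB.instance Definition _ := GRing.RMorphism.copy QpCp (CpOf \o QpbarOf).

Lemma absp_gt0 c : (0 < absp c) = (c != 0).
Proof.
rewrite lt_neqAle absp_ge0 andbT; congr negb; apply/eqP/eqP => [/esym/absp_eq0 //|->].
by rewrite absp0.
Qed.

Lemma abspB c d : absp (c - d) <= Num.max (absp c) (absp d).
Proof. by rewrite -(abspN d); apply: abspD. Qed.

Lemma abspV c : absp c^-1 = (absp c)^-1.
Proof.
have [->|c0] := eqVneq c 0; first by rewrite invr0 absp0 invr0.
have ac0 : absp c != 0 by rewrite lt0r_neq0 // absp_gt0.
by apply: (mulfI ac0); rewrite -abspM !mulfV ?absp1.
Qed.

Lemma absp_distC c d : absp (c - d) = absp (d - c).
Proof. by rewrite -abspN opprB. Qed.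

Lemma abspD_le c d (e : R) : absp c <= e -> absp d <= e -> absp (c + d) <= e.
Proof. by move=> h1 h2; apply: le_trans (abspD _ _) _; rewrite ge_max h1. Qed.

Lemma abspB_le c d (e : R) : absp c <= e -> absp d <= e -> absp (c - d) <= e.
Proof. by rewrite -(abspN d); apply: abspD_le. Qed.

Lemma abspD_lt c d (e : R) : absp c < e -> absp d < e -> absp (c + d) < e.
Proof. by move=> h1 h2; apply: le_lt_trans (abspD _ _) _; rewrite gt_max h1. Qed.

Lemma abspB_lt c d (e : R) : absp c < e -> absp d < e -> absp (c - d) < e.
Proof. by rewrite -(abspN d); apply: abspD_lt. Qed.

Lemma absp_eq c d : absp (c - d) < absp d -> absp c = absp d.
Proof.
move=> h; apply/eqP; rewrite eq_le -{1}(subrK d c) abspD_le ?(ltW h) //=.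
rewrite leNgt; apply/negP => h2; have := abspB_lt h2 h.
by rewrite opprB addrC subrK ltxx.
Qed.

Lemma absp_sum_le (I : Type) (r : seq I) (P : pred I) (F : I -> Cp) (e : R) : 0 <= e ->
  (forall i, P i -> absp (F i) <= e) -> absp (\sum_(i <- r | P i) F i) <= e.
Proof.
move=> e0 h; elim/big_rec: _ => [|i c Pi hc]; first by rewrite absp0.
by rewrite abspD_le ?h.
Qed.

Lemma absp_small c : (forall e : R, 0 < e -> absp c < e) -> c = 0.
Proof.
move=> h; apply/absp_eq0/eqP; rewrite eq_le absp_ge0 andbT leNgt; apply/negP => /h.
by rewrite ltxx.
Qed.

Lemma pR_gt1 : 1 < p%:R :> R.
Proof. by rewrite ltr1n prime_gt1. Qed.

Lemma pR_gt0 : 0 < p%:R :> R.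
Proof. exact: lt_trans ltr01 pR_gt1. Qed.

Lemma absp_pX n : absp (p%:R ^+ n) = p%:R ^- n.
Proof. by rewrite abspX absp_p exprVn. Qed.

Lemma pXV_gt0 n : 0 < p%:R ^- n :> R.
Proof. by rewrite invr_gt0 exprn_gt0 // pR_gt0. Qed.

Lemma bernoulli (x : R) n : 0 <= x -> 1 + x *+ n <= (1 + x) ^+ n.
Proof.
move=> x0; elim: n => [|n IH]; first by rewrite mulr0n addr0.
rewrite exprS mulrSr; apply: (@le_trans _ _ ((1 + x) * (1 + x *+ n))).
  rewrite mulrDl mul1r mulrDr mulr1 !addrA lerDl.
  by rewrite mulr_ge0 ?mulrn_wge0.
by rewrite ler_wpM2l // addr_ge0.
Qed.

Lemma expr_unbounded (x C : R) : 1 < x -> exists n, C < x ^+ n.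
Proof.
move=> x1; have y0 : 0 < x - 1 by rewrite subr_gt0.
set k := Num.bound (`|C| / (x - 1)); exists k.
have kP : `|C| / (x - 1) < k%:R by apply: archi_boundP; rewrite divr_ge0 // ltW.
have {1}-> : x = 1 + (x - 1) by rewrite addrC subrK.
apply: lt_le_trans (bernoulli _ (ltW y0)).
apply: (le_lt_trans (ler_norm C)); rewrite -mulr_natl.
by apply: (@lt_trans _ _ (k%:R * (x - 1))); rewrite ?ltrDr // -ltr_pdivrMr.
Qed.

Lemma pXV_small (e : R) : 0 < e -> exists n, p%:R ^- n < e.
Proof.
move=> e0; have [n nP] := expr_unbounded e^-1 pR_gt1; exists n.
by rewrite -[e]invrK ltf_pV2 ?posrE ?invr_gt0 ?exprn_gt0 ?pR_gt0.
Qed.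

(** Bezout: if |m| < 1, then 1 is a combination of m and p with integer coefficients, which would
    give |1| < 1. *)
Lemma absp_natr_coprime m : ~~ (p %| m)%N -> absp m%:R = 1.
Proof.
move=> pm; apply/eqP; rewrite eq_le absp_nat /= leNgt; apply/negP => m1.
have p1 : absp p%:R < 1 by rewrite absp_p invf_lt1 ?pR_gt0 // pR_gt1.
have m0 : (0 < m)%N by case: m pm {m1} => //; rewrite dvdn0.
case: (egcdnP p m0) => km kn e _.
have cop : gcdn m p = 1%N by apply/eqP; rewrite gcdnC -/(coprime p m) prime_coprime.
have := congr1 (fun n => n%:R : Cp) e; rewrite cop addn1 -addn1 natrD !natrM => e'.
have : absp (km%:R * m%:R - kn%:R * p%:R) < 1.
  by apply: abspB_lt; rewrite abspM; [apply: le_lt_trans m1|apply: le_lt_trans p1];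
    rewrite ler_piMl ?absp_ge0 ?absp_nat.
by rewrite e' addrC addKr absp1 ltxx.
Qed.

Lemma Cp_char0 : has_char0 Cp.
Proof.
move=> q; rewrite !inE; apply/negP => /andP[q_pr /eqP q0].
have [/absp_natr_coprime|] := boolP (~~ (p %| q)%N).
  by rewrite q0 absp0 => /eqP; rewrite eq_sym oner_eq0.
rewrite negbK dvdn_prime2 // => /eqP pq; move: q0; rewrite -pq => q0.
have := absp_p X; rewrite q0 absp0 => /esym/eqP.
by rewrite invr_eq0 (negPf (lt0r_neq0 pR_gt0)).
Qed.

Lemma Qpbar_char0 : has_char0 Qpbar.
Proof. by move=> q; rewrite -(fmorph_pchar CpOf); apply: Cp_char0. Qed.

Lemma Qp_char0 : has_char0 Qp.
Proof. by move=> q; rewrite -(fmorph_pchar QpbarOf); apply: Qpbar_char0. Qed.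

Lemma pCp_neq0 n : p%:R ^+ n != 0 :> Cp.
Proof. by rewrite -absp_gt0 absp_pX pXV_gt0. Qed.

End AbsoluteValue.
Arguments QpCp {p R} X u : simpl never.

(** * Coordinate bounds, conjugates and integrality *)

Section ValuationRing.
Variables (p : nat) (p_pr : prime p) (R : realType) (X : padic_fields p R).
Local Notation Qp := (Qp X).
Local Notation Qpbar := (Qpbar X).
Local Notation Cp := (Cp X).
Local Notation absp := (@absp p R X).
Local Notation CpOf := (CpOf X).
Local Notation QpbarOf := (@QpbarOf p R X).
Local Notation QpCp := (QpCp X).

(* If [e n] could be approximated by the span of the previous vectors, the       *)
(* coordinates of the approximations would be Cauchy, and their limit a relation. *)
Lemma coord_bound (n : nat) (e : nat -> Cp) :
  (forall x : nat -> Qp, \sum_(i < n) QpCp (x i) * e i = 0 ->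
     forall i, (i < n)%N -> x i = 0) ->
  exists C : R, 0 < C /\ forall (x : nat -> Qp) i, (i < n)%N ->
     absp (QpCp (x i)) <= C * absp (\sum_(i < n) QpCp (x i) * e i).
Proof.
elim: n => [|n IH] ind; first by exists 1.
have [x /= x0 i ilt|C [C0 CP]] := IH.
  pose x' i := if (i < n)%N then x i else 0.
  have x'n : x' n = 0 by rewrite /x' ltnn.
  have := ind x'; rewrite big_ord_recr /= x'n rmorph0 mul0r addr0 /x'.
  have -> : \sum_(i < n) QpCp (if (i < n)%N then x i else 0) * e i =
      \sum_(i < n) QpCp (x i) * e i by apply: eq_bigr => j _; rewrite ltn_ord.
  by move=> /(_ x0 i); rewrite ilt ltnS ltnW // => ->.
pose S (x : nat -> Qp) := \sum_(i < n) QpCp (x i) * e i.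
have SB x y : S (fun i => x i - y i) = S x - S y.
  by rewrite /S -sumrB; apply: eq_bigr => i _; rewrite rmorphB mulrBl.
have [d [d0 dP]] : exists d : R, 0 < d /\ forall x, d <= absp (S x + e n).
  apply: contrapT => nd.
  have near k : exists x, absp (S x + e n) < p%:R ^- k.
    apply: contrapT => nx; apply: nd; exists (p%:R ^- k); split=> [|x].
      exact: pXV_gt0.
    by rewrite leNgt; apply/negP => h; apply: nx; exists x.
  have [x xP] := choice near.
  have dist k l : absp (S (x k) - S (x l)) <= Num.max (p%:R ^- k) (p%:R ^- l).
    have -> : S (x k) - S (x l) = S (x k) + e n - (S (x l) + e n).
      by rewrite opprD addrACA subrr addr0.
    apply: le_trans (abspB _ _) _.
    by rewrite ge_max !le_max (ltW (xP k)) (ltW (xP l)) orbT.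
  have pmono k N : (N <= k)%N -> p%:R ^- k <= p%:R ^- N :> R.
    by move=> Nk; rewrite lef_pV2 ?posrE ?exprn_gt0 ?pR_gt0 // ler_weXn2l // ltW // pR_gt1.
  have lim i : exists l : Qp, (i < n)%N -> forall eps : R, 0 < eps ->
      exists N, forall k, (N <= k)%N -> absp (QpCp (x k i - l)) < eps.
    have [ilt|] := ltnP i n; last by exists 0.
    have [|l lP] := @Qp_complete p R X (fun k => x k i); last by exists l.
    move=> eps eps0; have [N NP] := pXV_small p_pr (divr_gt0 eps0 C0).
    exists N => k l Nk Nl.
    have := CP (fun i => x k i - x l i) i ilt.
    rewrite -/(S (fun i => x k i - x l i)) SB => h; apply: le_lt_trans h _.
    rewrite mulrC -ltr_pdivlMr //; apply: le_lt_trans NP.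
    by apply: le_trans (dist _ _) _; rewrite ge_max !pmono.
  have [l lP] := choice lim.
  suff /(ind (fun i => if (i < n)%N then l i else 1))/(_ n (ltnSn n))/eqP :
      \sum_(i < n.+1) QpCp (if (i < n)%N then l i else 1) * e i = 0.
    by rewrite ltnn oner_eq0.
  rewrite big_ord_recr /= ltnn rmorph1 mul1r.
  have -> : \sum_(i < n) QpCp (if (i < n)%N then l i else 1) * e i = S l.
    by apply: eq_bigr => i _; rewrite ltn_ord.
  apply: absp_small => eps eps0.
  pose M := 1 + \sum_(i < n) absp (e i).
  have Mi i : (i < n)%N -> absp (e i) < M.
    move=> ilt; rewrite /M (bigD1 (Ordinal ilt)) //= addrCA ltrDl.
    by rewrite (lt_le_trans ltr01) // lerDl sumr_ge0 // => j _; apply: absp_ge0.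
  have M0 : 0 < M by rewrite (lt_le_trans ltr01) // lerDl sumr_ge0 // => j _; apply: absp_ge0.
  have unif m : (m <= n)%N -> exists N, forall k, (N <= k)%N ->
      forall i, (i < m)%N -> absp (QpCp (x k i - l i)) < eps / M.
    elim: m => [_|m IHm mn]; first by exists 0%N.
    have [N1 N1P] := IHm (ltnW mn).
    have [N2 N2P] := lP m mn _ (divr_gt0 eps0 M0).
    exists (maxn N1 N2) => k; rewrite geq_max => /andP[k1 k2] i.
    by rewrite ltnS leq_eqVlt => /orP[/eqP ->|]; [apply: N2P|apply: N1P].
  have [N1 N1P] := unif n (leqnn n); have [N2 N2P] := pXV_small p_pr eps0.
  have N1k := N1P (maxn N1 N2) (leq_maxl _ _).
  have N2k : absp (S (x (maxn N1 N2)) + e n) < eps.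
    by apply: lt_trans (xP _) _; apply: le_lt_trans N2P; rewrite pmono ?leq_maxr.
  set k := maxn N1 N2 in N1k N2k.
  have -> : S l + e n = (S (x k) + e n) - S (fun i => x k i - l i).
    by rewrite SB opprB [RHS]addrC addrA subrK.
  apply: abspB_lt => //; rewrite /S.
  elim/big_ind: _ => [|c d|i _]; rewrite ?absp0 //; first exact: abspD_lt.
  rewrite abspM; have [->|e0] := eqVneq (e i) 0; first by rewrite absp0 mulr0.
  rewrite -ltr_pdivlMr ?absp_gt0 //; apply: lt_trans (N1k i (ltn_ord i)) _.
  by rewrite ltr_pM2l // ltf_pV2 ?posrE ?absp_gt0 // Mi.
(* With [d] the distance from [e n] to the span, [d^-1] bounds the last coordinate. The other
   coordinates obey the inductive bound for T - x_n e_n, whose size is at most (1 + |e_n| / d)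
   |T|. *)
exists (d^-1 + C * (1 + absp (e n) / d)); split.
  by rewrite addr_gt0 ?invr_gt0 // mulr_gt0 // (lt_le_trans ltr01) // lerDl mulr_ge0 ?absp_ge0 // invr_ge0 ltW.
move=> x i; rewrite big_ord_recr /= -/(S x) => ilt; set T := S x + _.
have xn : absp (QpCp (x n)) <= d^-1 * absp T.
  have [xn0|xn0] := eqVneq (x n) 0.
    by rewrite xn0 rmorph0 absp0 mulr_ge0 ?invr_ge0 ?(ltW d0) ?absp_ge0.
  have h0 : QpCp (x n) != 0 by rewrite fmorph_eq0.
  have -> : T = QpCp (x n) * (S (fun i => x i / x n) + e n).
    rewrite mulrDr /T; congr (_ + _); rewrite /S mulr_sumr; apply: eq_bigr => j _.
    by rewrite fmorph_div mulrA mulrCA divff ?mulr1.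
  rewrite abspM mulrCA ler_pMr ?absp_gt0 // mulrC ler_pdivlMr // mul1r.
  exact: dP.
have dT : 0 <= d^-1 * absp T by rewrite mulr_ge0 ?invr_ge0 ?(ltW d0) ?absp_ge0.
have CT : 0 <= C * (1 + absp (e n) / d) * absp T.
  by rewrite !mulr_ge0 ?absp_ge0 ?(ltW C0) // addr_ge0 // mulr_ge0 ?absp_ge0 // invr_ge0 ltW.
move: ilt; rewrite ltnS leq_eqVlt mulrDl => /orP[/eqP ->|ilt].
  by apply: le_trans xn _; rewrite lerDl.
apply: le_trans (CP x i ilt) _; rewrite -/(S x).
apply: (@le_trans _ _ (C * (1 + absp (e n) / d) * absp T)); last by rewrite lerDr.
rewrite -mulrA ler_pM2l //; have -> : S x = T - QpCp (x n) * e n by rewrite /T addrK.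
rewrite mulrDl mul1r; apply: abspB_le; first by rewrite lerDl mulr_ge0 ?absp_ge0 // mulr_ge0 ?absp_ge0 // invr_ge0 ltW.
apply: (@le_trans _ _ (absp (e n) / d * absp T)); last by rewrite lerDr absp_ge0.
by rewrite abspM mulrC -mulrA ler_wpM2l ?absp_ge0.
Qed.

Definition absb (a : Qpbar) : R := absp (CpOf a).

Lemma min_annihilator (a : Qpbar) : exists f : {poly Qp},
  [/\ f \is monic, root (map_poly QpbarOf f) a &
   forall q : {poly Qp}, root (map_poly QpbarOf q) a -> f %| q].
Proof.
pose P n := `[< exists q : {poly Qp}, [/\ q != 0, size q = n & root (map_poly QpbarOf q) a] >].
have exP : exists n, P n.
  by have [q q0 qa] := Qpbar_algebraic a; exists (size q); apply/asboolP; exists q.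
case: (ex_minnP exP) => n /asboolP[f [f0 fn fa]] fmin.
have lf0 : lead_coef f != 0 by rewrite lead_coef_eq0.
exists ((lead_coef f)^-1 *: f); split.
- by rewrite monicE lead_coefZ mulVf.
- by rewrite map_polyZ /= /root hornerZ (eqP fa) mulr0.
move=> q qa; rewrite dvdpZl ?invr_eq0 //; apply/modp_eq0P/eqP/contraT => r0.
have : (n <= size (q %% f)%R)%N.
  apply: fmin; apply/asboolP; exists (q %% f); split=> //; rewrite /root.
  have := qa; rewrite {1}(divp_eq q f) rmorphD rmorphM /= /root hornerD hornerM.
  by rewrite (eqP fa) mulr0 add0r.
by rewrite leqNgt -fn ltn_modp f0.
Qed.

(** If |a| <= 1, all powers of a are bounded, hence so are the coefficients of the remainders of X^m
    modulo f, by [coord_bound] on the basis of powers of a. The same remainders evaluated at b give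
    b^m, so the powers of b are bounded as well and |b| <= 1. *)
Lemma conjugate_le1 (f : {poly Qp}) (a b : Qpbar) :
  (forall q : {poly Qp}, root (map_poly QpbarOf q) a -> f %| q) ->
  f \is monic ->
  root (map_poly QpbarOf f) a -> root (map_poly QpbarOf f) b ->
  absb a <= 1 -> absb b <= 1.
Proof.
move=> fmin fmon fa fb a1; have f0 := monic_neq0 fmon.
have eva (q : {poly Qp}) c n : (size q <= n)%N ->
    CpOf (map_poly QpbarOf q).[c] = \sum_(i < n) QpCp q`_i * CpOf c ^+ i.
  move=> sq; rewrite -horner_map -map_poly_comp (@horner_coef_wide _ n) ?size_map_poly //.
  by apply: eq_bigr => i _; rewrite coef_map.
set n := (size f).-1.
have sf : size f = n.+1 by rewrite /n prednK // size_poly_gt0.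
have [x x0 i ilt|C [C0 CP]] := @coord_bound n (fun i => CpOf a ^+ i).
  pose q := \poly_(j < n) x j.
  have sq : (size q <= n)%N := size_poly _ _.
  have qa : root (map_poly QpbarOf q) a.
    apply/rootP/(fmorph_inj CpOf); rewrite rmorph0 (eva _ _ n) // -[RHS]x0.
    by apply: eq_bigr => j _; rewrite coef_poly ltn_ord.
  have q0 : q = 0.
    apply: contraTeq (fmin _ qa) => q0; apply/negP => /(dvdp_leq q0).
    by rewrite sf ltnNge sq.
  by have := coef_poly n x i; rewrite -/q q0 coef0 ilt.
pose r m : {poly Qp} := 'X^m %% f.
have rE m c : root (map_poly QpbarOf f) c -> (map_poly QpbarOf (r m)).[c] = c ^+ m.
  move=> /rootP fc; have := congr1 (fun q => (map_poly QpbarOf q).[c]) (divp_eq 'X^m f).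
  by rewrite rmorphD rmorphM /= map_polyXn hornerXn hornerD hornerM fc mulr0 add0r.
have sr m : (size (r m) <= n)%N by rewrite -ltnS -sf ltn_modp.
have cr m i : (i < n)%N -> absp (QpCp (r m)`_i) <= C.
  move=> ilt; apply: le_trans (CP (fun i => (r m)`_i) i ilt) _.
  rewrite -(eva _ _ _ (sr m)) rE // rmorphXn abspX ler_piMr ?(ltW C0) //.
  by rewrite exprn_ile1 // absp_ge0.
pose D := \sum_(i < n) absb b ^+ i.
have bound m : absb b ^+ m <= C * D.
  rewrite /absb -abspX -rmorphXn -(rE m b fb) (eva _ _ _ (sr m)).
  apply: absp_sum_le => [|i _].
    by rewrite mulr_ge0 ?(ltW C0) // sumr_ge0 // => i _; rewrite exprn_ge0 ?absp_ge0.
  rewrite abspM abspX ler_pM ?absp_ge0 ?exprn_ge0 ?absp_ge0 //; first exact: cr.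
  rewrite /D (bigD1 i) //= lerDl sumr_ge0 // => j _; rewrite exprn_ge0 ?absp_ge0 //.
rewrite leNgt; apply/negP => b1; have [m mP] := expr_unbounded (C * D) b1.
by have := lt_le_trans mP (bound m); rewrite ltxx.
Qed.

Lemma prod_XsubC_le1 (s : seq Qpbar) : (forall b, b \in s -> absb b <= 1) ->
  forall i, absb (\prod_(b <- s) ('X - b%:P))`_i <= 1.
Proof.
elim: s => [|b s IH] h i.
  by rewrite big_nil coef1 /absb; case: (i == _); rewrite ?rmorph1 ?rmorph0 ?absp1 ?absp0.
have hs c : c \in s -> absb c <= 1 by move=> cs; apply: h; rewrite inE cs orbT.
have hb : absb b <= 1 by apply: h; rewrite inE eqxx.
rewrite big_cons mulrBl coefB mul_polyC coefXM coefZ /absb rmorphB rmorphM.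
apply: abspB_le; last by rewrite abspM mulr_ile1 ?absp_ge0 // IH.
by case: (i == _); [rewrite rmorph0 absp0|apply: IH].
Qed.

(** For the converse, the minimal polynomial is the product of X - b over conjugates b with |b| <=
    1, so that its coefficients lie in the unit ball of Q_p. *)
Lemma oK_intP (a : Qpbar) : (a \in @oK_pred p R X) = (absb a <= 1).
Proof.
apply/idP/idP => [aK|a1]; first exact: (oK_op_subproof (MkoK aK)).
have [f [fmon fa fmin]] := min_annihilator a.
have [s sE] := closed_field_poly_normal (map_poly QpbarOf f).
rewrite (monicP (monic_map _ fmon)) scale1r in sE.
have fc i : Zp_pred f`_i.
  have -> : Zp_pred f`_i = (absb (map_poly QpbarOf f)`_i <= 1) by rewrite coef_map.
  rewrite sE; apply: prod_XsubC_le1 => b bs; apply: (conjugate_le1 fmin) a1 => //.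
  by rewrite sE root_prod_XsubC.
pose q : {poly Defs.Zp X} := \poly_(i < size f) MkZp (fc i).
have qE : map_poly (@ZpQpbar p R X) q = map_poly QpbarOf f.
  apply/polyP => i; rewrite coef_map coef_poly coef_map; case: ltnP => // h.
  have -> : f`_i = 0 by rewrite nth_default.
  exact: etrans (rmorph0 _) (esym (rmorph0 _)).
apply/asboolP; exists q; last by rewrite qE.
have sq : size q = size f.
  by rewrite size_poly_eq // -(inj_eq val_inj) /= -lead_coefE (monicP fmon) oner_neq0.
rewrite monicE lead_coefE sq coef_poly prednK ?size_poly_gt0 ?monic_neq0 // leqnn.
by rewrite -(inj_eq val_inj) /= -lead_coefE (monicP fmon).
Qed.

End ValuationRing.

(** * The tilt of the valuation ring *)

Section TiltOfO.
Variables (p : nat) (p_pr : prime p) (R : realType) (X : padic_fields p R).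
Local Notation Qp := (Qp X).
Local Notation Qpbar := (Qpbar X).
Local Notation Cp := (Cp X).
Local Notation absp := (@absp p R X).
Local Notation CpOf := (CpOf X).
Local Notation QpbarOf := (@QpbarOf p R X).
Local Notation op := (op X).
Local Notation oK := (oK X).
Local Notation opb := (tilt p_pr op).
Local Notation close := (padic_close p).
Implicit Types (c d : op) (a b : oK) (x y z : opb).

Lemma op_valM c d : op_val (c * d) = op_val c * op_val d. Proof. by []. Qed.
Lemma op_valB c d : op_val (c - d) = op_val c - op_val d. Proof. by []. Qed.
Lemma op_valX c n : op_val (c ^+ n) = op_val c ^+ n.
Proof. exact: (rmorphXn (val : op -> Cp)). Qed.

Lemma op_closeP n c d : close n c d <-> absp (val c - val d) <= p%:R ^- n.
Proof.
have valp : val (p%:R ^+ n : op) = p%:R ^+ n by rewrite rmorphXn rmorph_nat.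
split=> [/padic_closeP[e ->]|h].
  rewrite rmorphD rmorphM /= -/(val _) valp addrC addKr abspM absp_pX.
  by apply: ler_piMr; [apply/ltW/pXV_gt0|apply: opP].
have eP : (val c - val d) / p%:R ^+ n \in @op_pred p R X.
  by rewrite unfold_in /op_pred abspM abspV absp_pX invrK -ler_pdivlMr ?div1r // exprn_gt0 // pR_gt0.
apply/padic_closeP; exists (Op eP); apply: val_inj; rewrite rmorphD rmorphM /= -/(val _) valp.
by rewrite mulrC divfK ?pCp_neq0 // addrC subrK.
Qed.

Lemma oK_closeP n a b : close n a b <-> absb (val a - val b) <= p%:R ^- n.
Proof.
have valp : val (p%:R ^+ n : oK) = p%:R ^+ n by rewrite rmorphXn rmorph_nat.
have p0 : p%:R ^+ n != 0 :> Qpbar.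
  by rewrite -(fmorph_eq0 CpOf) rmorphXn rmorph_nat pCp_neq0.
split=> [/padic_closeP[e ->]|h].
  rewrite rmorphD rmorphM /= -/(val _) valp addrC addKr /absb rmorphM abspM rmorphXn rmorph_nat absp_pX.
  by apply: ler_piMr; [apply/ltW/pXV_gt0|rewrite -/(absb _) -oK_intP ?(valP e)].
have eP : (val a - val b) / p%:R ^+ n \in @oK_pred p R X.
  rewrite oK_intP // /absb fmorph_div rmorphXn rmorph_nat abspM abspV absp_pX invrK.
  by rewrite -ler_pdivlMr ?div1r // exprn_gt0 // pR_gt0.
apply/padic_closeP; exists (MkoK eP); apply: val_inj; rewrite rmorphD rmorphM /= -/(val _) valp.
by rewrite mulrC divfK // addrC subrK.
Qed.

Lemma oK_op_close n a b : close n (oK_op a) (oK_op b) <-> close n a b.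
Proof.
by rewrite oK_closeP op_closeP /= /absb rmorphB.
Qed.

Lemma op_separated : padic_separated p op.
Proof.
move=> c cP; apply/val_inj/absp_small => e e0.
have [n nP] := pXV_small p_pr e0; apply: le_lt_trans nP.
by have /op_closeP := cP n; rewrite rmorph0 subr0.
Qed.

Lemma op_complete : padic_complete p op.
Proof.
split=> [|u uP]; first exact: op_separated.
have up k n : (n <= k)%N -> close n (u k) (u n).
  move=> /subnKC <-; elim: (k - n)%N => [|m IH]; first by rewrite addn0; apply: padic_close_refl.
  by rewrite addnS; apply: padic_close_trans IH; apply: padic_closeW (uP _); rewrite leq_addr.
have [|l lP] := @Cp_complete p R X (fun n => val (u n)).
  move=> e e0; have [n nP] := pXV_small p_pr e0; exists n => i j ni nj.
  apply: le_lt_trans nP; apply/op_closeP.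
  exact: padic_close_trans (up _ _ ni) (padic_close_sym (up _ _ nj)).
have lc n : absp (l - val (u n)) <= p%:R ^- n.
  have [N NP] := lP _ (pXV_gt0 p_pr R n).
  rewrite -(subrK (val (u (maxn N n))) l) -addrA; apply: abspD_le.
    by rewrite absp_distC ltW // NP ?leq_maxl.
  by apply/op_closeP; apply: up; rewrite leq_maxr.
have l1 : l \in @op_pred p R X.
  rewrite unfold_in /op_pred -(subrK (val (u 0%N)) l); apply: abspD_le; last exact: opP.
  by have := lc 0%N; rewrite expr0 invr1.
by exists (Op l1) => n; apply/op_closeP/lc.
Qed.

Lemma oK_separated : padic_separated p oK.
Proof.
move=> a aP; apply: val_inj; apply: (fmorph_inj CpOf); rewrite !rmorph0.
apply: (congr1 val (_ : oK_op a = 0)); apply: op_separated => n.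
by rewrite -(rmorph0 (@oK_op p R X)); apply/oK_op_close.
Qed.

Lemma oK_op_inj : injective (@oK_op p R X).
Proof.
by move=> a b e; apply/val_inj/(fmorph_inj CpOf); have := congr1 val e.
Qed.

Lemma oK_dense c n : exists a, close n c (oK_op a).
Proof.
have [a aP] := Qpbar_dense (val c) (pXV_gt0 p_pr R n).
have pn1 : p%:R ^- n <= 1 :> R.
  by rewrite invf_le1 ?exprn_gt0 ?pR_gt0 // exprn_ege1 // ltW // pR_gt1.
have aK : a \in @oK_pred p R X.
  rewrite oK_intP // /absb -(subrK (val c) (CpOf a)); apply: abspD_le; last exact: opP.
  by rewrite absp_distC (le_trans (ltW aP)).
by exists (MkoK aK); apply/op_closeP/ltW.
Qed.

Lemma oK_root k a : (0 < k)%N -> exists b, b ^+ k = a.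
Proof.
move=> k0; have [r rP] := @solve_monicpoly Qpbar k (fun i => if i == 0%N then val a else 0) k0.
have {}rP : r ^+ k = val a.
  rewrite rP; case: k k0 {rP} => // k _; rewrite big_ord_recl expr0 mulr1.
  by rewrite big1 ?addr0 // => i _; rewrite mul0r.
have rK : r \in @oK_pred p R X.
  have := valP a; rewrite !oK_intP // -rP /absb rmorphXn abspX => h.
  rewrite leNgt; apply/negP => r1; move: h; rewrite leNgt => /negP; apply.
  by rewrite exprn_egt1 // -lt0n.
by exists (MkoK rK); apply: val_inj; rewrite rmorphXn.
Qed.

Lemma oK_unit a : absb (val a) = 1 -> exists b, a * b = 1.
Proof.
move=> a1; have a0 : val a != 0.
  by apply: contra_eq_neq a1 => ->; rewrite /absb rmorph0 absp0 eq_sym oner_eq0.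
have bK : (val a)^-1 \in @oK_pred p R X.
  by rewrite oK_intP // /absb fmorphV abspV -/(absb _) a1 invr1.
by exists (MkoK bK); apply: val_inj; rewrite rmorphM /= mulfV.
Qed.

Lemma oK_div a b : absb (val b) <= absb (val a) -> exists d : oK, b = a * d.
Proof.
have [->|a0] := eqVneq a 0 => h.
  exists 0; rewrite mulr0; apply/val_inj/(fmorph_inj CpOf).
  rewrite !rmorph0; apply/absp_eq0/eqP.
  rewrite eq_le absp_ge0 andbT; apply: le_trans h _.
  by rewrite /absb !rmorph0 absp0.
have va0 : val a != 0 by rewrite (inj_eq val_inj a 0).
have bK : val b / val a \in @oK_pred p R X.
  rewrite oK_intP // /absb fmorph_div abspM abspV ler_pdivrMr ?mul1r //.
  by rewrite absp_gt0 fmorph_eq0.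
by exists (MkoK bK); apply: val_inj; rewrite rmorphM /= mulrC divfK.
Qed.

Local Notation modp_oK := (modp_of p (A := oK)).
Local Notation modp_op := (modp_of p (A := op)).

Lemma modp_oK_op_surj (u : Defs.modp p op) : exists a, u = modp_op (oK_op a).
Proof.
have [c <-] := modp_of_surj u; have [a aP] := oK_dense c 1.
by exists a; apply/modp_ofP.
Qed.

Lemma modp_oK_op_inj a b : modp_op (oK_op a) = modp_op (oK_op b) -> modp_oK a = modp_oK b.
Proof. by move=> /modp_ofP/oK_op_close/modp_ofP. Qed.

Lemma tilt_oK_opE (u : tilt p_pr oK) n a : u n = modp_oK a ->
  tilt_oK_op u n = modp_op (oK_op a).
Proof. by rewrite /tilt_oK_op /= => ->; apply: modp_map_of. Qed.

Lemma tilt_oK_op_surj x : exists u, tilt_oK_op u = x.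
Proof.
have /choice[f fP] := fun n => modp_oK_op_surj (x n).
have fT : (fun n => modp_oK (f n)) \in @tilt_pred p p_pr oK.
  apply/asboolP => n; rewrite -rmorphXn; apply: modp_oK_op_inj.
  by rewrite !rmorphXn -!fP tiltP.
exists (Tilt fT); apply: tilt_eq => n; rewrite fP.
exact: (@tilt_oK_opE (Tilt fT) n (f n)).
Qed.

Lemma tilt_op_oKK : cancel (@tilt_op_oK p R X p_pr) (@tilt_oK_op p R X p_pr).
Proof.
move=> x; rewrite /tilt_op_oK; case: xgetP => [u _ //|nex].
by have [u /nex] := tilt_oK_op_surj x.
Qed.

Lemma tilt_op_oKE x n a : x n = modp_op (oK_op a) -> tilt_op_oK x n = modp_oK a.
Proof.
move=> xa; have [b ub] := modp_of_surj (tilt_op_oK x n).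
rewrite -ub; apply: modp_oK_op_inj.
by rewrite -(tilt_oK_opE (esym ub)) tilt_op_oKK.
Qed.

Definition oK_tilt (u : plim p oK) : opb := tilt_red p_pr (plim_map (@oK_op p R X) u).

Lemma oK_tiltE u n : oK_tilt u n = modp_op (oK_op (u n)).
Proof. by []. Qed.

Lemma untilt_oK u n : untilt (oK_tilt u) n = oK_op (u n).
Proof. by rewrite tilt_redK //; exact: op_complete. Qed.

Lemma sharp_oK u : sharp (oK_tilt u) = oK_op (u 0%N).
Proof. exact: untilt_oK. Qed.

Lemma oK_tiltM u v : oK_tilt (plim_mul u v) = oK_tilt u * oK_tilt v.
Proof. by apply: tilt_eq => n; rewrite tiltM !oK_tiltE plim_mulE !rmorphM. Qed.

Lemma oK_pth_root a : exists b, b ^+ p = a.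
Proof. exact/oK_root/prime_gt0. Qed.

Lemma oK_tilt_dense x k : exists u, forall i, (i <= k)%N -> oK_tilt u i = x i.
Proof.
have [a xa] := modp_oK_op_surj (x k).
have [u uk] := @plim_lift p oK a k oK_pth_root.
exists u => i ik; apply: (tilt_eq_le ik).
by rewrite xa oK_tiltE uk.
Qed.

Definition nrm x : R := absp (sharp x).

Lemma sharp_neq0 x : x != 0 -> sharp x != 0.
Proof.
apply: contraNneq => x0; rewrite -(untiltK op_complete x); apply/eqP/tilt_zero_seq => n.
have := plimPn (untilt x) 0 n; rewrite add0n -/(sharp x) x0 => /eqP h.
apply/val_inj/eqP; move: h; rewrite -(inj_eq val_inj) rmorphXn expf_eq0 => /andP[_].
by rewrite rmorph0.
Qed.

Lemma nrm0 : nrm 0 = 0.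
Proof. by rewrite /nrm sharp0 ?absp0 //; exact: op_complete. Qed.

Lemma nrm_gt0 x : (0 < nrm x) = (x != 0).
Proof.
rewrite /nrm absp_gt0; have [->|x0] := eqVneq x 0.
  by rewrite sharp0 ?eqxx //; exact: op_complete.
by apply: contraNneq (sharp_neq0 x0) => e; apply/eqP/val_inj.
Qed.

Lemma nrm_ge0 x : 0 <= nrm x. Proof. exact: absp_ge0. Qed.
Lemma nrm_le1 x : nrm x <= 1. Proof. exact: opP. Qed.

Lemma nrmM x y : nrm (x * y) = nrm x * nrm y.
Proof. by rewrite /nrm (sharpM op_complete) op_valM abspM. Qed.

Lemma nrm1 : nrm 1 = 1.
Proof. by rewrite /nrm (sharp1 p_pr op_complete) absp1. Qed.

Lemma nrmX x n : nrm (x ^+ n) = nrm x ^+ n.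
Proof. by rewrite /nrm (sharpX op_complete) op_valX abspX. Qed.

Lemma nrm_untilt x k : absp (untilt x k) ^+ (p ^ k) = nrm x.
Proof. by rewrite -abspX -op_valX -{1}[k]add0n plimPn. Qed.

Lemma opb_mulf_eq0 x y : x * y = 0 -> x = 0 \/ y = 0.
Proof.
have [->|x0] := eqVneq x 0; first by left.
have [->|y0] := eqVneq y 0; first by right.
by move=> /(congr1 nrm); rewrite nrmM nrm0 => /eqP; rewrite mulf_eq0 !gt_eqF ?nrm_gt0.
Qed.

Lemma opb_expf_eq0 x n : x ^+ n = 0 -> x = 0.
Proof.
elim: n => [|n IH]; last by rewrite exprS => /opb_mulf_eq0[].
by rewrite expr0 => /(congr1 nrm); rewrite nrm1 nrm0 => /eqP; rewrite oner_eq0.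
Qed.

(** The quotient is formed componentwise in [Cp] on the untilted sequences. The comparison of norms
    bounds every component, because its [p ^ n]-th power has the norm of the whole element. *)
Lemma opb_div x y : x != 0 -> nrm y <= nrm x -> exists z, y = x * z.
Proof.
move=> x0 yx.
have ux n : val (untilt x n) != 0.
  apply: contraTneq x0 => e; rewrite -nrm_gt0 -(nrm_untilt x n) e absp0.
  by rewrite expr0n expn_eq0 eqn0Ngt prime_gt0 //= ltxx.
have q1 n : val (untilt y n) / val (untilt x n) \in @op_pred p R X.
  rewrite unfold_in /op_pred abspM abspV ler_pdivrMr ?mul1r ?absp_gt0 //.
  by rewrite -(@ler_pXn2r _ (p ^ n)) ?nnegrE ?absp_ge0 ?expn_gt0 ?prime_gt0 // !nrm_untilt.
have qp : is_power_seq p (fun n => Op (q1 n)).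
  apply: is_power_seqP => n; apply: val_inj; rewrite rmorphXn /= expr_div_n.
  by rewrite -!op_valX !plimP.
exists (tilt_red p_pr (Plim qp)); rewrite -{1}(untiltK op_complete y) -{1}(untiltK op_complete x).
rewrite -tilt_redM; congr tilt_red; apply: plim_eq => n; rewrite plim_mulE.
apply/val_inj/(etrans _ (esym (op_valM _ _))).
by rewrite [RHS]mulrC [RHS]divfK.
Qed.

Lemma op_residueP c d : (op_residue X c == op_residue X d) = (absp (val c - val d) < 1).
Proof. by rewrite /op_residue dquot_eq. Qed.

Lemma op_residue_eq0 c : (op_residue X c == 0) = (absp c < 1).
Proof. by rewrite /op_residue dquot_eq0. Qed.

Lemma op_residue_close n c d : close n.+1 c d -> op_residue X c = op_residue X d.
Proof.
move=> /op_closeP h; apply/eqP; rewrite op_residueP; apply: le_lt_trans h _.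
by rewrite invf_lt1 ?exprn_gt0 ?pR_gt0 // exprn_egt1 // pR_gt1.
Qed.

Lemma opb_residueE x : opb_residue x = op_residue X (sharp x).
Proof.
apply: (@op_residue_close 0); apply/modp_ofP.
by rewrite (sharp_modp op_complete) -/(modp_repr _) modp_reprK.
Qed.

Lemma opb_residue_modp x c : x 0%N = modp_op c -> opb_residue x = op_residue X c.
Proof.
move=> xc; rewrite opb_residueE; apply: (@op_residue_close 0); apply/modp_ofP.
by rewrite (sharp_modp op_complete).
Qed.

Lemma opb_residue_zmod : zmod_morphism (@opb_residue p R X p_pr).
Proof.
move=> x y; have [[c xc] [d yd]] := (modp_of_surj (x 0%N), modp_of_surj (y 0%N)).
rewrite (opb_residue_modp (esym xc)) (opb_residue_modp (esym yd)) -rmorphB.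
by apply: opb_residue_modp; rewrite tiltB -xc -yd rmorphB.
Qed.
Lemma opb_residue_monoid : monoid_morphism (@opb_residue p R X p_pr).
Proof.
split=> [|x y]; first by rewrite (@opb_residue_modp _ 1) ?rmorph1.
have [[c xc] [d yd]] := (modp_of_surj (x 0%N), modp_of_surj (y 0%N)).
rewrite (opb_residue_modp (esym xc)) (opb_residue_modp (esym yd)) -rmorphM.
by apply: opb_residue_modp; rewrite tiltM -xc -yd rmorphM.
Qed.
HB.instance Definition _ := GRing.isZmodMorphism.Build opb (Fpbar X) (@opb_residue p R X p_pr)
  opb_residue_zmod.
HB.instance Definition _ := GRing.isMonoidMorphism.Build opb (Fpbar X) (@opb_residue p R X p_pr)
  opb_residue_monoid.

Lemma opb_residueB x y : opb_residue (x - y) = opb_residue x - opb_residue y.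
Proof. exact: opb_residue_zmod. Qed.

Lemma opb_residue_eq0 x : (opb_residue x == 0) = (nrm x < 1).
Proof. by rewrite opb_residueE op_residue_eq0. Qed.

Lemma gal_tiltE (s : gal X) x n a : x n = modp_op (oK_op a) ->
  gal_tilt s x n = modp_op (oK_op (gal_oK s a)).
Proof.
move=> xa; apply: tilt_oK_opE; rewrite /= (tilt_op_oKE xa).
exact: modp_map_of.
Qed.

Lemma gal_tilt_oK (s : gal X) u : gal_tilt s (oK_tilt u) = oK_tilt (plim_map (gal_oK s) u).
Proof. by apply: tilt_eq => n; apply: gal_tiltE. Qed.

Lemma gal_tilt_zmod (s : gal X) : zmod_morphism (@gal_tilt p R X p_pr s).
Proof.
move=> x y; apply: tilt_eq => n; rewrite tiltB.
have [[a xa] [b yb]] := (modp_oK_op_surj (x n), modp_oK_op_surj (y n)).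
rewrite (gal_tiltE s xa) (gal_tiltE s yb) -!rmorphB; apply: gal_tiltE.
by rewrite tiltB xa yb -!rmorphB.
Qed.
Lemma gal_tilt_monoid (s : gal X) : monoid_morphism (@gal_tilt p R X p_pr s).
Proof.
split=> [|x y]; apply: tilt_eq => n.
  by rewrite tilt1 -(rmorph1 modp_op) -(rmorph1 (@oK_op p R X)) -(rmorph1 (gal_oK s));
    apply: gal_tiltE; rewrite !rmorph1.
have [[a xa] [b yb]] := (modp_oK_op_surj (x n), modp_oK_op_surj (y n)).
rewrite tiltM (gal_tiltE s xa) (gal_tiltE s yb) -!rmorphM; apply: gal_tiltE.
by rewrite tiltM xa yb -!rmorphM.
Qed.
HB.instance Definition _ s := GRing.isZmodMorphism.Build opb opb (@gal_tilt p R X p_pr s)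
  (gal_tilt_zmod s).
HB.instance Definition _ s := GRing.isMonoidMorphism.Build opb opb (@gal_tilt p R X p_pr s)
  (gal_tilt_monoid s).

Lemma gal_tilt_continuous s : tilt_continuous (@gal_tilt p R X p_pr s).
Proof.
move=> x n; exists n => y yx i /yx e.
by have [a xa] := modp_oK_op_surj (x i); rewrite (gal_tiltE s xa) (@gal_tiltE s y i a) ?e.
Qed.

Definition gal_comp (s t : gal X) : gal X.
Proof.
exists (s \o t : {rmorphism Qpbar -> Qpbar}).
  exact: bij_comp (gal_bij s) (gal_bij t).
by move=> u /=; rewrite !gal_fix.
Defined.

Definition gal_id : gal X.
Proof. by exists (idfun : {rmorphism Qpbar -> Qpbar}); [exists idfun|]. Defined.

Lemma gal_inv_exists (s : gal X) : exists t : gal X, cancel s t /\ cancel t s.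
Proof.
have [g sg gs] := gal_bij s.
have gz : zmod_morphism g by move=> u v; apply: (can_inj sg); rewrite rmorphB !gs.
have gm : monoid_morphism g.
  by split=> [|u v]; apply: (can_inj sg); rewrite ?rmorph1 ?rmorphM !gs.
pose g1 := GRing.isZmodMorphism.Build _ _ g gz.
pose g2 := GRing.isMonoidMorphism.Build _ _ g gm.
pose gr : {rmorphism Qpbar -> Qpbar} := HB.pack g g1 g2.
have gb : bijective gr by exists s.
have gf u : gr (QpbarOf u) = QpbarOf u by rewrite -{1}(gal_fix s u) /= sg.
by exists (Gal gb gf).
Qed.

Lemma gal_tilt_comp s t x : gal_tilt (gal_comp s t) x = gal_tilt s (gal_tilt t x).
Proof.
apply: tilt_eq => n; have [a xa] := modp_oK_op_surj (x n).
rewrite (gal_tiltE s (gal_tiltE t xa)) (gal_tiltE _ xa); congr (modp_op (oK_op _)).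
exact: val_inj.
Qed.

Lemma gal_tilt_id x : gal_tilt gal_id x = x.
Proof.
apply: tilt_eq => n; have [a xa] := modp_oK_op_surj (x n).
by rewrite (gal_tiltE _ xa) xa; congr (modp_op (oK_op _)); apply: val_inj.
Qed.

Lemma gal_tilt_inv s : exists t, (forall x, gal_tilt s (gal_tilt t x) = x) /\
  (forall x, gal_tilt t (gal_tilt s x) = x).
Proof.
have [t [st ts]] := gal_inv_exists s; exists t; split=> x;
 rewrite -gal_tilt_comp; apply: tilt_eq => n; have [a xa] := modp_oK_op_surj (x n);
 rewrite (gal_tiltE _ xa) xa; congr (modp_op (oK_op _)); apply: val_inj => /=;
 by rewrite ?ts ?st.
Qed.

(** Membership in the maximal ideal means being a non-unit of o_K, a condition that every ring
    automorphism preserves; this bypasses the invariance of the absolute value. *)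
Lemma gal_max (s : gal X) a : (absb (val (gal_oK s a)) < 1) = (absb (val a) < 1).
Proof.
have le1 b : absb (val b) <= 1 by rewrite -oK_intP // (valP b).
have [t [st ts]] := gal_inv_exists s.
have unitP b : (absb (val b) < 1) <-> ~ exists d : oK, b * d = 1.
  split=> [b1 [d bd]|nex]; last first.
    rewrite lt_neqAle le1 andbT; apply/eqP => b1; apply: nex; exact: oK_unit.
  have := congr1 (fun e => absb (val e)) bd; rewrite rmorphM rmorph1 /absb rmorphM rmorph1 absp1 abspM.
  move=> e; have : absb (val b) * absb (val d) < 1.
    by apply: le_lt_trans b1; rewrite ler_piMr ?absp_ge0 ?le1.
  by rewrite /absb e ltxx.
apply/idP/idP => /unitP h; apply/unitP => -[d bd]; apply: h.
  by exists (gal_oK s d); rewrite -rmorphM bd rmorph1.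
exists (gal_oK t d); apply: val_inj; have := congr1 (fun e => t (val e)) bd.
by rewrite !rmorphM /= st !rmorph1.
Qed.

End TiltOfO.

(** * Points of Spec o_K and their local rings *)

Section Spectrum.
Variables (p : nat) (p_pr : prime p) (R : realType) (X : padic_fields p R).
Local Notation absp := (@absp p R X).
Local Notation oK := (oK X).
Local Notation op := (op X).
Implicit Types (a b : oK).

Definition vK a : R := absb (val a).

Lemma vK_le1 a : vK a <= 1. Proof. by rewrite /vK -oK_intP // (valP a). Qed.
Lemma vK_ge0 a : 0 <= vK a. Proof. exact: absp_ge0. Qed.
Lemma vKM a b : vK (a * b) = vK a * vK b.
Proof. by rewrite /vK /absb !rmorphM abspM. Qed.
Lemma vK1 : vK 1 = 1. Proof. by rewrite /vK /absb !rmorph1 absp1. Qed.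
Lemma vK0 : vK 0 = 0. Proof. by rewrite /vK /absb !rmorph0 absp0. Qed.
Lemma vKX a n : vK (a ^+ n) = vK a ^+ n.
Proof. by elim: n => [|n IH]; rewrite ?expr0 ?vK1 // !exprS vKM IH. Qed.
Lemma vK_gt0 a : (0 < vK a) = (a != 0).
Proof. by rewrite /vK /absb absp_gt0 fmorph_eq0 (inj_eq val_inj a 0). Qed.
Lemma vK_pX n : vK (p%:R ^+ n) = p%:R ^- n.
Proof. by rewrite /vK /absb !rmorphXn !rmorph_nat absp_pX. Qed.

Lemma vK_div a b : vK b <= vK a -> exists d, b = a * d.
Proof. exact: oK_div. Qed.

Lemma prime_idealr_expr (I : prime_idealr oK) a n : a ^+ n \in I -> a \in I.
Proof.
elim: n => [|n IH]; first by rewrite expr0 idealr1.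
by rewrite exprS prime_idealrM => /orP[|/IH].
Qed.

(** Divisibility in o_K is decided by the absolute value: if |a| < 1, some power of a is a multiple
    of p, and conversely some power of p is a multiple of any nonzero a. Hence the only primes are 0
    and the maximal ideal. *)
Lemma prime_ideal_max (I : prime_idealr oK) : p%:R \in I ->
  forall a, (a \in I) = (vK a < 1).
Proof.
move=> pI a; apply/idP/idP => [aI|a1].
  rewrite lt_neqAle vK_le1 andbT; apply/eqP => /oK_unit-/(_ p_pr)[b ab].
  by have := idealMr b aI; rewrite mulrC ab idealr1.
have [n nP] : exists n, vK a ^+ n <= vK p%:R.
  have [->|a0] := eqVneq a 0; first by exists 1%N; rewrite vK0 expr1 vK_ge0.
  have [n nP] : exists n, (vK p%:R)^-1 < (vK a)^-1 ^+ n.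
    by apply: expr_unbounded; rewrite invf_gt1 ?vK_gt0.
  exists n; apply: ltW; move: nP; rewrite exprVn ltf_pV2 ?posrE ?exprn_gt0 ?vK_gt0 //.
  by rewrite -vK_gt0 -(expr1 p%:R) vK_pX pXV_gt0.
have [d dE] : exists d, a ^+ n = p%:R * d by apply: vK_div; rewrite vKX.
by apply: (@prime_idealr_expr I a n); rewrite dE mulrC idealMr.
Qed.

Lemma prime_ideal_zero (I : prime_idealr oK) : p%:R \notin I ->
  forall a, a \in I -> a = 0.
Proof.
move=> pI a aI; apply/eqP; apply: contraNT pI => a0.
have [n nP] : exists n, p%:R ^- n < vK a by apply: pXV_small; rewrite ?vK_gt0.
have [d dE] : exists d, p%:R ^+ n = a * d.
  by apply: vK_div; rewrite vK_pX ltW.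
by apply: (@prime_idealr_expr I _ n); rewrite dE mulrC idealMr.
Qed.

Lemma prime_idealr_ext (A : nzRingType) (I J : prime_idealr A) :
  (forall a : A, (a \in I) = (a \in J)) -> I = J.
Proof.
case: I => I cI; case: J => J cJ IJ.
have e : I = J by apply/funext => a; have := IJ a; rewrite !unfold_in.
move: cI cJ {IJ}; rewrite e => -[[cI1] [cI2] [cI3] [cI4]] [[cJ1] [cJ2] [cJ3] [cJ4]].
by rewrite (Prop_irrelevance cI1 cJ1) (Prop_irrelevance cI2 cJ2)
  (Prop_irrelevance cI3 cJ3) (Prop_irrelevance cI4 cJ4).
Qed.

Lemma specialization_ext (A : comNzRingType) (t u : specialization A) :
  (forall a : A, (a \in generic_pt t) = (a \in generic_pt u)) ->
  (forall a : A, (a \in special_pt t) = (a \in special_pt u)) -> t = u.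
Proof.
case: t => x y xy; case: u => x' y' xy' /= /prime_idealr_ext ex /prime_idealr_ext ey.
by move: xy xy'; rewrite ex ey => xy xy'; rewrite (Prop_irrelevance xy xy').
Qed.

End Spectrum.

Lemma expr0n_gt0 (A : pzSemiRingType) n : (0 < n)%N -> 0 ^+ n = 0 :> A.
Proof. by case: n => // n _; rewrite exprS mul0r. Qed.

Section ToResfield.
Variables (A : comNzRingType) (I : prime_idealr A).
Implicit Types a b : A.

Lemma to_resfieldM a b : to_resfield I (a * b) = to_resfield I a * to_resfield I b.
Proof. exact: rmorphM. Qed.
Lemma to_resfieldX a n : to_resfield I (a ^+ n) = to_resfield I a ^+ n.
Proof. exact: rmorphXn. Qed.
Lemma to_resfieldB a b : to_resfield I (a - b) = to_resfield I a - to_resfield I b.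
Proof. exact: rmorphB. Qed.

End ToResfield.

Section LocalRingsOfClosures.
Variables (p : nat) (p_pr : prime p) (R : realType) (X : padic_fields p R).
Variable t : specialization (oK X).
Local Notation oK := (oK X).
Local Notation x := (generic_pt t).
Local Notation y := (special_pt t).
Local Notation O := (local_ring t).
Local Notation kappa := (resfield x).
Hypothesis ym : forall a : oK, (a \in y) = (vK a < 1).
Implicit Types (a b : oK).

Lemma generic_cases :
  (forall a, a \in x -> a = 0) \/ (forall a, (a \in x) = (vK a < 1)).
Proof.
have [px|px] := boolP (p%:R \in x); [right|left].
  exact: prime_ideal_max.
exact: prime_ideal_zero.
Qed.

(** Denominators outside the maximal ideal are already units of o_K, so the local ring is the
    quotient o_K / x. *)
Lemma local_of_surj (z : O) : exists a, local_of t a = z.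
Proof.
case: z => z zP; have /asboolP[a [s [sy zE]]] := zP.
have [b sb] : exists b, s * b = 1.
  apply: oK_unit => //; apply/eqP; rewrite -/(vK s) eq_le vK_le1 //= leNgt -ym //.
exists (a * b); apply: val_inj; rewrite /= zE rmorphM; congr (_ * _).
have s0 := local_den_neq0 sy.
by apply: (mulfI s0); rewrite -rmorphM sb rmorph1 mulfV.
Qed.

Lemma local_of_valE a : val (local_of t a) = to_resfield x a. Proof. by []. Qed.

Lemma resfield_val (z : kappa) : (exists a, z = to_resfield x a) \/
  (z != 0 /\ exists a, z^-1 = to_resfield x a).
Proof.
have [a [s [s0 ->]]] := resfield_frac z.
have [sa|/ltW as_] := leP (vK a) (vK s).
  have [d ->] := oK_div p_pr sa; left; exists d.
  by rewrite rmorphM mulrC mulKf.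
have [d dE] := oK_div p_pr as_.
have [ra|ra] := eqVneq (to_resfield x a) 0.
  by left; exists 0; rewrite ra mul0r rmorph0.
right; split; first exact: mulf_neq0 ra (invr_neq0 s0).
by exists d; rewrite invf_div dE rmorphM mulrC mulKf.
Qed.

Lemma pchar_generic : (forall a, (a \in x) = (vK a < 1)) -> p%:R = 0 :> kappa.
Proof.
move=> xm; rewrite -(rmorph_nat (to_resfield x)); apply/eqP.
by rewrite to_resfield_eq0 xm -(expr1 p%:R) vK_pX // expr1 invf_lt1 ?pR_gt0 ?pR_gt1.
Qed.

(** This lets a compatible system in the residue field be lifted step by step once its first term
    lifts. For x = 0 integral closedness is at work; for x maximal any p-th root in o_K will do, as
    Frobenius is injective in characteristic p. *)
Lemma resfield_root (w : kappa) a : w ^+ p = to_resfield x a ->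
  exists b, b ^+ p = a /\ w = to_resfield x b.
Proof.
have [b0 b0P] := oK_pth_root p_pr a.
have main c : w = to_resfield x c -> w ^+ p = to_resfield x a ->
    exists b, b ^+ p = a /\ w = to_resfield x b.
  move=> wc wa; have [x0|xm] := generic_cases.
    exists c; split=> //; apply/eqP; rewrite -subr_eq0; apply/eqP/x0.
    by rewrite -to_resfield_eq0 to_resfieldB to_resfieldX -wc wa subrr.
  exists b0; split=> //; apply/eqP; rewrite -subr_eq0.
  have : (w - to_resfield x b0) ^+ p == 0.
    apply/eqP; apply: (addIr (to_resfield x b0 ^+ p)).
    rewrite -(frobenius_add p_pr (pchar_generic xm)) subrK wa -rmorphXn b0P.
    by rewrite add0r.
  by rewrite expf_eq0 prime_gt0.
move=> wa; have [[c wc]|[w0 [c wc]]] := resfield_val w; first exact: main wc wa.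
(* When only the inverse of [w] comes from o_K, write w = (w^-1)^(p-1) w^p. *)
apply: (main (c ^+ p.-1 * a)) => //.
have wp : w ^+ p = w ^+ p.-1 * w by rewrite -exprSr prednK ?prime_gt0.
by rewrite to_resfieldM to_resfieldX -wc -wa wp mulrA -exprMn mulVf // expr1n mul1r.
Qed.

Lemma plim_resfield_lift (w : plim p kappa) a : w 0%N = to_resfield x a ->
  exists u : plim p oK, forall n, w n = to_resfield x (u n).
Proof.
move=> wa.
pose r n b := xget b [set c | c ^+ p = b /\ w n.+1 = to_resfield x c]%classic.
have rP n b : w n = to_resfield x b -> r n b ^+ p = b /\ w n.+1 = to_resfield x (r n b).
  move=> wb; have [|c cP] := @resfield_root (w n.+1) b; first by rewrite plimP.
  by rewrite /r; case: xgetP => [_ -> //|/(_ c)/(_ cP)].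
pose f := fix f n := if n is m.+1 then r m (f m) else a.
have fP n : w n = to_resfield x (f n).
  by elim: n => [//|n IH]; have [] := rP n (f n) IH.
have fp : is_power_seq p f by apply: is_power_seqP => n; have [] := rP n (f n) (fP n).
by exists (Plim fp).
Qed.

Lemma plim_resfield_cases (w : plim p kappa) :
  (exists u : plim p oK, forall n, w n = to_resfield x (u n)) \/
  (exists u : plim p oK, forall n, w n * to_resfield x (u n) = 1).
Proof.
have [[a wa]|[w0 [a wa]]] := resfield_val (w 0%N); [left|right].
  exact: plim_resfield_lift wa.
have vP : is_power_seq p (fun n => (w n)^-1).
  by apply: is_power_seqP => n; rewrite exprVn plimP.
have [u uP] := @plim_resfield_lift (Plim vP) a wa.
exists u => n.
have wn0 : w n != 0.
  apply: contra_neq w0 => wn0; rewrite -(plimPn w 0 n) add0n wn0.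
  by apply: expr0n_gt0; rewrite expn_gt0 prime_gt0.
exact: etrans (congr1 (fun z => w n * z) (esym (uP n))) (mulfV wn0).
Qed.

Lemma plim_local_lift (w : plim p O) :
  exists u : plim p oK, forall n, w n = local_of t (u n).
Proof.
have [a wa] := local_of_surj (w 0%N).
have [|u uP] := @plim_resfield_lift (plim_map (@local_incl _ t) w) a.
  by rewrite plim_mapE -wa.
by exists u => n; apply/val_inj/uP.
Qed.

Lemma local_p0 : (forall a, (a \in x) = (vK a < 1)) -> p%:R = 0 :> O.
Proof. by move=> xm; apply: val_inj; rewrite rmorph_nat; apply: pchar_generic. Qed.

Lemma local_of_eq0 a : (local_of t a == 0) = (a \in x).
Proof. by rewrite -to_resfield_eq0 -(inj_eq val_inj). Qed.

Lemma local_of_close n a b : (forall a, a \in x -> a = 0) ->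
  padic_close p n (local_of t a) (local_of t b) <-> padic_close p n a b.
Proof.
move=> x0; split=> [/padic_closeP[z]|]; last exact: padic_close_map.
have [c <-] := local_of_surj z; rewrite -(rmorph_nat (@local_of _ t)) -rmorphXn -rmorphM -rmorphD.
move/eqP; rewrite -subr_eq0 -rmorphB local_of_eq0 => /x0/eqP.
by rewrite subr_eq0 => /eqP e; apply/padic_closeP; exists c.
Qed.

Lemma local_separated : padic_separated p O.
Proof.
move=> z zP; have [a az] := local_of_surj z; have [x0|xm] := generic_cases.
  suff a0 : a = 0 by rewrite -az a0 rmorph0.
  apply: (oK_separated p_pr) => n; apply/local_of_close => //.
  by rewrite az rmorph0.
have /padic_closeP[c ->] := zP 1%N.
by rewrite add0r expr1 local_p0 // mul0r.
Qed.

End LocalRingsOfClosures.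

Section TripleExt.
Variables (p : nat) (p_pr : prime p) (R : realType) (X : padic_fields p R).
Implicit Types t : triple X.

Definition resfield_lift (t : triple X) (u : plim p (oK X)) :=
  plim_map (to_resfield (generic_pt (triple_pts t))) u.

(** A compatible system that does not lift to o_K has an inverse that does. Multiplicativity then
    forces its value, so testing on lim o_K is enough. *)
Lemma triple_ext t1 t2 :
  plim_multiplicative (@triple_map _ _ _ t1) -> plim_multiplicative (@triple_map _ _ _ t2) ->
  (forall a, (a \in special_pt (triple_pts t1)) = (vK a < 1)) ->
  (forall a, (a \in special_pt (triple_pts t2)) = (vK a < 1)) ->
  (forall a, (a \in generic_pt (triple_pts t1)) = (a \in generic_pt (triple_pts t2))) ->
  (forall u, triple_map (resfield_lift t1 u) = triple_map (resfield_lift t2 u)) ->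
  t1 = t2.
Proof.
case: t1 => s1 m1; case: t2 => s2 m2 /= mul1 mul2 y1 y2 x12.
have e : s1 = s2 by apply: specialization_ext => // a; rewrite y1 y2.
move: m1 mul1; rewrite {s1}e in y1 x12 * => m1 mul1; rewrite /resfield_lift /= => m12.
congr Triple; apply/funext => w.
have [[u uP]|[u uP]] := plim_resfield_cases p_pr w.
  have -> : w = plim_map (to_resfield (generic_pt s2)) u by apply: plim_eq.
  exact: m12.
have wu : plim_mul w (plim_map (to_resfield (generic_pt s2)) u) = plim1 p _.
  by apply: plim_eq => n; rewrite plim_mulE plim_mapE uP.
have [[h1 _ M1] [h2 _ M2]] := (mul1, mul2).
have := M1 w (plim_map (to_resfield (generic_pt s2)) u).
have := M2 w (plim_map (to_resfield (generic_pt s2)) u).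
rewrite wu h1 h2 m12 => e2 e1.
have n0 : m2 (plim_map (to_resfield (generic_pt s2)) u) != 0.
  by apply: contra_eq_neq e2 => ->; rewrite mulr0 oner_neq0.
by apply: (mulIf n0); rewrite -e1 -e2.
Qed.

End TripleExt.

Section ResidueLevels.
Variables (p : nat) (p_pr : prime p) (R : realType) (X : padic_fields p R).
Implicit Types (x : tilt p_pr (op X)).

Lemma nrm_lt1_modp x (a : oK X) n : x n = modp_of p (oK_op a) -> (nrm x < 1) = (vK a < 1).
Proof.
move=> xa; rewrite -(nrm_untilt x n) expr_lt1 ?expn_gt0 ?prime_gt0 ?absp_ge0 //.
rewrite -(op_residue_eq0 (untilt x n)) -(op_residue_eq0 (oK_op a)); congr (_ == _).
by apply: (@op_residue_close _ p_pr _ _ 0); apply/modp_ofP; rewrite -xa untilt_red //; apply: op_complete.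
Qed.

End ResidueLevels.

(** * From the tilt of o_p to the tilt of the completed local ring *)

Section TiltToLocal.
Variables (p : nat) (p_pr : prime p) (R : realType) (X : padic_fields p R).
Variable s : specialization (oK X).
Local Notation oK := (oK X).
Local Notation op := (op X).
Local Notation opb := (tilt p_pr op).
Local Notation O := (local_ring s).
Local Notation hatO := (completion p O).
Local Notation close := (padic_close p).
Implicit Types (a : oK) (x y : opb).

Definition hat_of : {rmorphism oK -> hatO} := @completion_of p O \o @local_of _ s.

Lemma hat_ofE a : hat_of a = completion_of p (local_of s a). Proof. by []. Qed.

Definition hat_lift (u : plim p oK) : plim p hatO := plim_map hat_of u.

Lemma hat_liftE u n : hat_lift u n = hat_of (u n). Proof. by []. Qed.

(** For the points of a triple this is [tilt_to_local], restated for a bare specialization so that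
    it can carry a ring morphism structure. *)
Definition local_tilt x : tilt p_pr hatO := tilt_map hat_of (tilt_op_oK x).

Lemma local_tiltE x n a : x n = modp_of p (oK_op a) -> local_tilt x n = modp_of p (hat_of a).
Proof. by move=> xa; rewrite /local_tilt /= (tilt_op_oKE xa); apply: modp_map_of. Qed.

Lemma local_tilt_oK u : local_tilt (oK_tilt p_pr u) = tilt_red p_pr (hat_lift u).
Proof. by apply: tilt_eq => n; apply: local_tiltE. Qed.

Lemma local_tilt_zmod : zmod_morphism local_tilt.
Proof.
move=> x y; apply: tilt_eq => n; rewrite tiltB.
have [[a xa] [b yb]] := (modp_oK_op_surj p_pr (x n), modp_oK_op_surj p_pr (y n)).
rewrite (local_tiltE xa) (local_tiltE yb) -!rmorphB; apply: local_tiltE.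
by rewrite tiltB xa yb -!rmorphB.
Qed.
Lemma local_tilt_monoid : monoid_morphism local_tilt.
Proof.
split=> [|x y]; apply: tilt_eq => n.
  rewrite tilt1 -[RHS](rmorph1 (modp_of p)) -(rmorph1 hat_of).
  by apply: local_tiltE; rewrite !rmorph1.
have [[a xa] [b yb]] := (modp_oK_op_surj p_pr (x n), modp_oK_op_surj p_pr (y n)).
rewrite tiltM (local_tiltE xa) (local_tiltE yb) -!rmorphM; apply: local_tiltE.
by rewrite tiltM xa yb -!rmorphM.
Qed.
HB.instance Definition _ := GRing.isZmodMorphism.Build opb (tilt p_pr hatO) local_tilt
  local_tilt_zmod.
HB.instance Definition _ := GRing.isMonoidMorphism.Build opb (tilt p_pr hatO) local_tilt
  local_tilt_monoid.

Lemma local_tiltB x y : local_tilt (x - y) = local_tilt x - local_tilt y.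
Proof. exact: local_tilt_zmod. Qed.
Lemma local_tiltM x y : local_tilt (x * y) = local_tilt x * local_tilt y.
Proof. exact: (rmorphM local_tilt). Qed.
Lemma local_tilt0 : local_tilt 0 = 0.
Proof. exact: (rmorph0 local_tilt). Qed.
Lemma local_tilt1 : local_tilt 1 = 1.
Proof. exact: (rmorph1 local_tilt). Qed.

Lemma local_tilt_level x y n : x n = y n -> local_tilt x n = local_tilt y n.
Proof.
have [a xa] := modp_oK_op_surj p_pr (x n).
by move=> xy; rewrite (local_tiltE xa) (@local_tiltE y n a) // -xy.
Qed.

Hypothesis ym : forall a, (a \in special_pt s) = (vK a < 1).

Lemma hat_of_approx (z : hatO) n : exists a, close n z (hat_of a).
Proof.
have [b zb] := completion_approx z n; have [a ab] := local_of_surj p_pr ym b.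
by exists a; rewrite hat_ofE ab.
Qed.

Lemma hat_of_close n a b : close n (hat_of a) (hat_of b) <-> close n (local_of s a) (local_of s b).
Proof. exact: completion_of_close. Qed.

Lemma hat_lift_dense (v : plim p hatO) k m :
  exists u, forall i, (i <= k)%N -> close m (v i) (hat_lift u i).
Proof.
have [a va] := hat_of_approx (v k) m.
have [u uk] := @plim_lift p oK a k (fun c => oK_pth_root p_pr c).
exists u => i ik; rewrite -(subnKC ik) in va uk.
by rewrite -(plimPn v i (k - i)) -(plimPn (hat_lift u) i (k - i)) hat_liftE uk; apply: padic_closeX.
Qed.

Lemma hat_unique (B : comPzRingType) (P Q : plim p hatO -> B) : padic_separated p B ->
  plim_continuous P -> plim_continuous Q ->
  (forall u, P (hat_lift u) = Q (hat_lift u)) -> P = Q.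
Proof.
move=> Bs Pc Qc PQ; apply/funext => v; apply: (padic_separatedP Bs) => n.
have [[k1 [m1 h1]] [k2 [m2 h2]]] := (Pc v n, Qc v n).
have [u uP] := hat_lift_dense v (maxn k1 k2) (maxn m1 m2).
apply: (@padic_close_trans _ _ _ (P (hat_lift u))).
  apply/padic_close_sym/h1 => i ik; apply/padic_close_sym/(padic_closeW (leq_maxl m1 m2))/uP.
  by rewrite leq_max ik.
rewrite PQ; apply: h2 => i ik; apply/padic_close_sym/(padic_closeW (leq_maxr m1 m2))/uP.
by rewrite leq_max ik orbT.
Qed.

Lemma local_max_frob (z w : O) : (forall a, (a \in generic_pt s) = (vK a < 1)) ->
  z ^+ p = w ^+ p -> z = w.
Proof.
move=> xm zw; have : (val z - val w) ^+ p = 0.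
  apply: (addIr (val w ^+ p)).
  rewrite -(frobenius_add p_pr (pchar_generic p_pr xm)) subrK add0r.
  have := congr1 val zw; rewrite !rmorphXn; exact.
by move/eqP; rewrite expf_eq0 subr_eq0 => /andP[_ /eqP/val_inj].
Qed.

Lemma max_close_eq a b n : (forall a, (a \in generic_pt s) = (vK a < 1)) ->
  close n.+1 (local_of s a) (local_of s b) -> local_of s a = local_of s b.
Proof.
move=> xm /padic_closeP[c ->]; rewrite exprS local_p0 //.
by rewrite mul0r mul0r addr0.
Qed.

(** The lifts have to be compatible modulo p in o_K, not just in the local ring. At the generic
    point the two conditions coincide. At the closed point any p-th root in o_K works, since
    Frobenius is injective on the local ring. *)
Lemma local_tilt_surj (b : tilt p_pr hatO) : exists x, local_tilt x = b.
Proof.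
have lift n : exists a, b n = modp_of p (hat_of a).
  have [z zb] := modp_of_surj (b n); have [a az] := hat_of_approx z 1.
  by exists a; rewrite -zb; apply/modp_ofP.
have step n a : b n = modp_of p (hat_of a) ->
    exists a', close 1 (a' ^+ p) a /\ b n.+1 = modp_of p (hat_of a').
  move=> ba; have [c bc] := lift n.+1.
  have cp : close 1 (local_of s (c ^+ p)) (local_of s a).
    apply/hat_of_close/modp_ofP; rewrite -ba -(tiltP b) bc.
    by rewrite rmorphXn; apply: rmorphXn.
  have [x0|xm] := generic_cases p_pr s.
    by exists c; split=> //; exact: (iffLR (local_of_close p_pr ym _ _ _ x0) cp).
  have [a' a'P] := oK_pth_root p_pr a; exists a'; split.
    by rewrite a'P; apply: padic_close_refl.
  rewrite bc !hat_ofE; suff -> : local_of s c = local_of s a' by [].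

  apply: local_max_frob => //; rewrite -!rmorphXn a'P; exact: max_close_eq cp.
pose r n a := xget a [set c | close 1 (c ^+ p) a /\ b n.+1 = modp_of p (hat_of c)]%classic.
have rP n a : b n = modp_of p (hat_of a) ->
    close 1 (r n a ^+ p) a /\ b n.+1 = modp_of p (hat_of (r n a)).
  by move=> /step[c cP]; rewrite /r; case: xgetP => [_ -> //|/(_ c)/(_ cP)].
have [a0 a0P] := lift 0%N.
pose f := fix f n := if n is m.+1 then r m (f m) else a0.
have fP n : b n = modp_of p (hat_of (f n)).
  by elim: n => [//|n IH]; have [] := rP n (f n) IH.
have fT : (fun n => modp_of p (oK_op (f n))) \in @tilt_pred p p_pr op.
  apply/asboolP => n; rewrite -!rmorphXn; apply/modp_ofP/oK_op_close => //.
  by have [] := rP n (f n) (fP n).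
exists (Tilt fT); apply: tilt_eq => n; rewrite fP.
exact: (@local_tiltE (Tilt fT) n (f n)).
Qed.

Lemma local_tilt_ker0 x : (forall a, a \in generic_pt s -> a = 0) ->
  local_tilt x = 0 -> x = 0.
Proof.
move=> x0 tx; apply: tilt_eq => n; have [a xa] := modp_oK_op_surj p_pr (x n).
rewrite xa tilt0 -[RHS](rmorph0 (modp_of p)) -(rmorph0 (@oK_op p R X)).
apply/modp_ofP/oK_op_close => //; apply/(local_of_close p_pr ym _ _ _ x0).
apply/hat_of_close/modp_ofP; rewrite -(local_tiltE xa) tx tilt0.
by rewrite -[LHS](rmorph0 (modp_of p)) -(rmorph0 hat_of).
Qed.

Lemma local_tilt_max x : (forall a, (a \in generic_pt s) = (vK a < 1)) ->
  nrm x < 1 -> local_tilt x = 0.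
Proof.
move=> xm x1; apply: tilt_eq => n; have [a xa] := modp_oK_op_surj p_pr (x n).
rewrite (local_tiltE xa) tilt0 hat_ofE.
have /eqP -> : local_of s a == 0 by rewrite local_of_eq0 xm -(nrm_lt1_modp xa).
by rewrite -[RHS](rmorph0 (modp_of p)) -(rmorph0 (@completion_of p O)).
Qed.

End TiltToLocal.

(** * Triples and continuous endomorphisms *)

Section YDiamond.
Variables (p : nat) (p_pr : prime p) (R : realType) (X : padic_fields p R).
Local Notation oK := (oK X).
Local Notation op := (op X).
Local Notation opb := (tilt p_pr op).
Local Notation Cp := (Cp X).
Local Notation endo := (@endo_of_triple p R X p_pr).
Local Notation opc := (op_complete p_pr X).

Section Hat.
Variable t : triple X.
Local Notation O := (local_ring (triple_pts t)).
Local Notation hatO := (completion p O).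
Local Notation hat := (@hat p R X t).
Local Notation y := (special_pt (triple_pts t)).
Local Notation hat_lift := (hat_lift (triple_pts t)).
Local Notation local_tilt := (@local_tilt p p_pr R X (triple_pts t)).

Lemma is_hat_lift (P : plim p hatO -> op) u : is_hat P ->
  op_val (P (hat_lift u)) = triple_map (resfield_lift t u).
Proof.
case=> _ _ [Q _ PQ]; have [e _] := PQ (plim_map (@local_of _ (triple_pts t)) u).
have -> : hat_lift u = plim_map (@completion_of p O) (plim_map (@local_of _ (triple_pts t)) u).
  exact: plim_eq.
rewrite [LHS]e; congr triple_map; exact: plim_eq.
Qed.

(* If [p] were a unit in the local ring, its completion would be zero, and no    *)
(* map from it to o_p sends 1 to 1 and 0 to 0.                                    *)
Lemma is_hat_special (P : plim p hatO -> op) : plim_multiplicative P ->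
  forall a : oK, (a \in y) = (vK a < 1).
Proof.
move=> [P1 P0 _]; apply: prime_ideal_max => //; apply/contraT => py.
have [q pq] : exists q : O, 1 = p%:R * q.
  have qP : (to_resfield (generic_pt (triple_pts t)) 1 / to_resfield _ p%:R)
      \in @local_pred _ (triple_pts t) by apply/asboolP; exists 1, p%:R.
  exists (LocalRing qP); apply: val_inj.
  have e : to_resfield (generic_pt (triple_pts t)) p%:R = p%:R by apply: rmorph_nat.
  have n0 := local_den_neq0 py; rewrite e in n0.
  transitivity (p%:R * (1 / p%:R) : resfield (generic_pt (triple_pts t))).
    by rewrite div1r mulfV.
  rewrite rmorphM rmorph_nat; congr (_ * _); rewrite /= e; congr (_ / _).
  by rewrite rmorph1.
have z n : plim1 p hatO n = 0.
  apply: (completion_complete p O).1 => k; apply/padic_closeP.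
  exists (completion_of p (q ^+ k)); rewrite add0r.
  rewrite -(rmorph_nat (@completion_of p O)) -rmorphXn -rmorphM -exprMn -pq.
  by rewrite expr1n rmorph1.
by have := P0 _ z; rewrite P1 => /eqP; rewrite oner_eq0.
Qed.

Hypothesis tY : Ydiamond p_pr t.

Lemma hatP : is_hat (hat).
Proof.
have [[_ [P PP]] _] := tY; rewrite /Defs.hat; case: xgetP => [Q _ //|/(_ P)]; exact.
Qed.

Lemma special_max a : (a \in y) = (vK a < 1).
Proof. by have [h _ _] := hatP; apply: is_hat_special h _. Qed.

Lemma map_mul : plim_multiplicative (@triple_map _ _ _ t).
Proof. by have [[]] := tY. Qed.

Fact endo_seq_subproof x : is_power_seq p (fun n => hat (plim_shift n (untilt (local_tilt x)))).
Proof.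
have [[h1 _ hM] _ _] := hatP; apply: is_power_seqP => n.
set v := untilt _.
have pw (w : plim p hatO) k : is_power_seq p (fun n => w n ^+ k).
  by apply: is_power_seqP => j; rewrite exprAC plimP.
have hX (w : plim p hatO) k : hat w ^+ k = hat (Plim (pw w k)).
  elim: k => [|k IH]; first by rewrite expr0 -h1; congr hat; apply: plim_eq.
  by rewrite exprS IH -hM; congr hat; apply: plim_eq => j; rewrite plim_mulE /= exprS.
rewrite hX; congr hat; apply: plim_eq => j /=.
by rewrite addnS plimP.
Qed.
Definition endo_seq x : plim p op := Plim (endo_seq_subproof x).

Lemma endo_of_tripleE x : endo t x = tilt_red p_pr (endo_seq x).
Proof.
rewrite -(valKd 0 (tilt_red p_pr (endo_seq x))); congr (insubd 0 _); exact/funext.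
Qed.

Lemma endo_ofE x n :
  endo t x n = modp_of p (hat (plim_shift n (untilt (local_tilt x)))).
Proof. by rewrite endo_of_tripleE. Qed.

(** The endomorphism thus remembers the map on the completed local ring through sharp values;
    comparisons between triples and endomorphisms pass through this formula. *)
Lemma sharp_endo x : sharp (endo t x) = hat (untilt (local_tilt x)).
Proof.
rewrite endo_of_tripleE (sharp_red p_pr opc) /=; congr hat; apply: plim_eq => n /=.
by rewrite addn0.
Qed.

Lemma endo_of_modp x n : endo t x n = modp_of p (hat_tilt (tilt_root n (local_tilt x))).
Proof. by rewrite endo_ofE /hat_tilt (untilt_root (completion_complete p O)). Qed.

Lemma endo_of_zmod : zmod_morphism (endo t).
Proof.
have hD x y : endo t (x + y) = endo t x + endo t y :> opb.
  apply: tilt_eq => n; rewrite tiltD !endo_of_modp -rmorphD; apply/modp_ofP.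
  by rewrite rmorphD tilt_rootD; have [_ ] := tY; apply.
by move=> x y; apply: (addIr (endo t y)); rewrite -hD !subrK.
Qed.

Lemma endo_of_monoid : monoid_morphism (endo t).
Proof.
have [[h1 _ hM] _ _] := hatP; split=> [|x y]; apply: tilt_eq => n.
  rewrite endo_ofE tilt1 rmorph1 (untilt1 p_pr (completion_complete p O)).
  have -> : plim_shift n (plim1 p hatO) = plim1 p hatO by apply: plim_eq.
  by rewrite h1 rmorph1.
rewrite tiltM !endo_ofE -rmorphM -hM rmorphM (untiltM (completion_complete p O)).
by congr (modp_of p (hat _)); apply: plim_eq.
Qed.
HB.instance Definition _ := GRing.isZmodMorphism.Build opb opb
  (endo t) endo_of_zmod.
HB.instance Definition _ := GRing.isMonoidMorphism.Build opb opb
  (endo t) endo_of_monoid.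

Lemma endo_of_continuous : tilt_continuous (endo t).
Proof.
have [_ hc _] := hatP; move=> x n.
have [k [m km]] := hc (plim_shift n (untilt (local_tilt x))) 1.
exists (k + n + m)%N => y yx i ni; apply: (tilt_eq_le ni).
rewrite !endo_ofE; apply/modp_ofP/km => j jk.
apply: (@padic_closeW _ _ m.+1) => //; apply: (untilt_close (completion_complete p O)).
by apply: local_tilt_level; apply: yx; rewrite leq_add2r leq_add2r.
Qed.

Lemma endo_of_End : End_cont (endo t).
Proof. by split; [exists (endo t)|exact: endo_of_continuous]. Qed.

Lemma triple_mapE u :
  triple_map (resfield_lift t u) = op_val (sharp (endo t (oK_tilt p_pr u))).
Proof.
rewrite sharp_endo local_tilt_oK (tilt_redK p_pr (completion_complete p O)).
by rewrite (is_hat_lift u hatP).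
Qed.

(** Outside [x] the system is invertible in lim of the residue field, so its value is a unit of
    [Cp]. With [endo_max] this recovers the generic point as a kernel. *)
Lemma endo_neq0 (u : plim p oK) : u 0%N \notin generic_pt (triple_pts t) ->
  endo t (oK_tilt p_pr u) != 0.
Proof.
move=> u0; set w := resfield_lift t u.
have w0 n : w n != 0.
  apply: contra u0 => /eqP wn; rewrite -to_resfield_eq0; apply/eqP.
  rewrite -[LHS]/(w 0%N) -(plimPn w 0 n) add0n wn.
  by apply: expr0n_gt0; rewrite expn_gt0 prime_gt0.
have vP : is_power_seq p (fun n => (w n)^-1).
  by apply: is_power_seqP => n; rewrite exprVn plimP.
have [m1 _ mM] := map_mul.
have := mM w (Plim vP); have -> : plim_mul w (Plim vP) = plim1 p _.
  by apply: plim_eq => n; apply: mulfV.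
rewrite m1 triple_mapE => e; apply/negP => /eqP z; move: e.
by rewrite z (sharp0 p_pr opc) mul0r => /eqP; rewrite oner_eq0.
Qed.

Lemma endo_max (x : opb) : (forall a, (a \in generic_pt (triple_pts t)) = (vK a < 1)) ->
  nrm x < 1 -> endo t x = 0.
Proof.
move=> xm x1; apply/eqP/contraT => /sharp_neq0; rewrite sharp_endo.
have -> : local_tilt x = 0 by apply: local_tilt_max => //; apply: special_max.
have z0 : is_power_seq p (fun=> 0 : hatO).
  by apply: is_power_seqP => n; apply: expr0n_gt0; apply: prime_gt0.
have -> : untilt (0 : tilt p_pr hatO) = Plim z0.
  rewrite -(tilt_redK p_pr (completion_complete p O) (Plim z0)); congr untilt.
  by rewrite tilt_zero_seq.
by have [[_ -> // _] _ _] := hatP; rewrite eqxx.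
Qed.

Lemma generic_endo (u : plim p oK) :
  (u 0%N \in generic_pt (triple_pts t)) = (endo t (oK_tilt p_pr u) == 0).
Proof.
apply/idP/eqP => [u0|]; last by apply: contra_eqT => /endo_neq0.
have [x0|xm] := generic_cases p_pr (triple_pts t); last first.
  by apply: endo_max => //; rewrite /nrm sharp_oK; rewrite xm in u0.
suff -> : oK_tilt p_pr u = 0 by exact: (rmorph0 (endo t)).
apply/eqP/contraT; rewrite -nrm_gt0 /nrm sharp_oK (x0 _ u0) /= rmorph0 absp0.
by rewrite ltxx.
Qed.

End Hat.

Lemma endo_of_inj t1 t2 : Ydiamond p_pr t1 -> Ydiamond p_pr t2 ->
  endo t1 = endo t2 -> t1 = t2.
Proof.
move=> Y1 Y2 e; apply: triple_ext => //.
- exact: map_mul Y1.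
- exact: map_mul Y2.
- exact: special_max Y1.
- exact: special_max Y2.
- move=> a; have [u <-] := @plim_lift p oK a 0 (fun c => oK_pth_root p_pr c).
  by rewrite (generic_endo Y1) (generic_endo Y2) e.
by move=> u; rewrite (triple_mapE Y1) (triple_mapE Y2) e.
Qed.

End YDiamond.

(** * Kernel and locality of continuous endomorphisms *)

Section ContinuousEndomorphisms.
Variables (p : nat) (p_pr : prime p) (R : realType) (X : padic_fields p R).
Local Notation opb := (tilt p_pr (op X)).
Variable phi : {rmorphism opb -> opb}.
Implicit Types x y : opb.

Lemma endo_unit x : nrm x = 1 -> nrm (phi x) = 1.
Proof.
move=> x1; have x0 : x != 0 by rewrite -nrm_gt0 x1 ltr01.
have [|y xy] := @opb_div _ _ _ _ x 1 x0; first by rewrite nrm1 x1.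
have := congr1 (fun z => nrm (phi z)) xy; rewrite rmorph1 rmorphM nrm1 nrmM => e.
apply/eqP; rewrite eq_le nrm_le1 [X in X <= _]e.
by rewrite ler_piMr ?nrm_ge0 ?nrm_le1.
Qed.

Lemma endo_ker_max x : phi x = 0 -> nrm x < 1.
Proof.
move=> fx; rewrite lt_neqAle nrm_le1 andbT; apply/eqP => /endo_unit.
by rewrite fx nrm0 => /eqP; rewrite eq_sym oner_eq0.
Qed.

Lemma nrm_pow_small x (e : R) : nrm x < 1 -> 0 < e -> exists n, nrm x ^+ n < e.
Proof.
move=> x1 e0; have [->|x0] := eqVneq x 0; first by exists 1%N; rewrite nrm0 expr1.
have [|n nP] := @expr_unbounded _ (nrm x)^-1 e^-1; first by rewrite invf_gt1 ?nrm_gt0.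
exists n; move: nP; rewrite exprVn ltf_pV2 ?posrE ?exprn_gt0 ?nrm_gt0 //.
Qed.

(** Some power of [y] is divisible by [x], and the tilt is reduced. *)
Lemma endo_ker x y : x != 0 -> phi x = 0 -> nrm y < 1 -> phi y = 0.
Proof.
move=> x0 fx y1; have [|n nP] := nrm_pow_small y1 (e := nrm x); first by rewrite nrm_gt0.
have [|z yz] := @opb_div _ _ _ _ x (y ^+ n) x0; first by rewrite nrmX ltW.
by apply: (@opb_expf_eq0 _ _ _ _ _ n); rewrite -rmorphXn yz rmorphM fx mul0r.
Qed.

Lemma endo_cases : (forall x : opb, phi x = 0 -> x = 0) \/
  (forall x, (phi x == 0) = (nrm x < 1)).
Proof.
have [[x [x0 fx]]|nex] := pselect (exists x : opb, x != 0 /\ phi x = 0); [right|left].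
  by move=> y; apply/eqP/idP => [/endo_ker_max|/(endo_ker x0 fx)].
by move=> x fx; apply/eqP/contraT => x0; case: nex; exists x.
Qed.

Lemma nrm_close0 x k : nrm x < 1 -> exists n, forall i, (i <= k)%N -> (x ^+ (p ^ n)) i = (0 : opb) i.
Proof.
(* The component at level k is divisible by p once the norm is at most p^(-p^k), because the norm is
   the [p ^ k]-th power of the size of that component. *)
move=> x1; have [|n nP] := nrm_pow_small x1 (e := p%:R ^- (p ^ k).+1); first exact: pXV_gt0.
exists n => i ik; apply: (tilt_eq_le ik); rewrite tilt0.
rewrite -(untilt_red (op_complete p_pr X)) -[RHS](rmorph0 (modp_of p)); apply/modp_ofP/op_closeP => //.
rewrite rmorph0 subr0 expr1 leNgt; apply/negP => h.
have : (p%:R^-1) ^+ (p ^ k) < nrm (x ^+ (p ^ n)).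
  by rewrite -(nrm_untilt _ k) ltr_pXn2r ?nnegrE ?absp_ge0 ?invr_ge0 ?ltW ?pR_gt0 ?expn_gt0 ?prime_gt0.
apply/negP; rewrite -leNgt nrmX; apply: (@le_trans _ _ (nrm x ^+ n)).
  by rewrite ler_wiXn2l ?nrm_ge0 ?nrm_le1 // ltnW // ltn_expl // prime_gt1.
apply: (le_trans (ltW nP)); rewrite exprVn lef_pV2 ?posrE ?exprn_gt0 ?pR_gt0 //.
by rewrite ler_eXn2l ?pR_gt1.
Qed.

(** The p-power iterates of [x] tend to 0, hence so do their images; an image of norm 1 would keep
    norm 1 under all powers. *)
Lemma endo_local x : tilt_continuous phi -> nrm x < 1 -> nrm (phi x) < 1.
Proof.
move=> fc x1; have [k kP] := fc 0 0%N; have [n nP] := nrm_close0 k x1.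
have h := kP (x ^+ (p ^ n)) nP 0%N (leqnn _).
rewrite lt_neqAle nrm_le1 andbT; apply/eqP => f1.
have : phi (x ^+ (p ^ n)) 0%N = 0 by rewrite h ?rmorph0 //; exact: nP.
rewrite -(sharp_modp (op_complete p_pr X)) -[RHS](rmorph0 (modp_of p)).
move=> /modp_ofP/(op_residue_close p_pr (n := 0))/eqP.
by rewrite rmorph0 op_residue_eq0 -/(nrm _) rmorphXn nrmX f1 expr1n ltxx.
Qed.

End ContinuousEndomorphisms.

Section RootsUnderEndomorphisms.
Variables (p : nat) (p_pr : prime p) (A B : comPzRingType).

(** Tilts are perfect: p-power roots are unique, so every ring morphism commutes with them. *)
Lemma rmorph_tilt_root (phi : {rmorphism tilt p_pr A -> tilt p_pr B}) n x :
  phi (tilt_root n x) = tilt_root n (phi x).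
Proof. by apply: (@tilt_expI _ _ _ n); rewrite -rmorphXn !tilt_rootXK. Qed.

Lemma rmorph_tilt_frob (phi : {rmorphism tilt p_pr A -> tilt p_pr B}) m x :
  phi (tilt_frob m x) = tilt_frob m (phi x).
Proof. by case: m => k /=; [rewrite rmorphXn|rewrite rmorph_tilt_root]. Qed.

End RootsUnderEndomorphisms.

(** * The triple attached to an endomorphism *)

Section TripleOfEndomorphism.
Variables (p : nat) (p_pr : prime p) (R : realType) (X : padic_fields p R).
Local Notation oK := (oK X).
Local Notation op := (op X).
Local Notation opb := (tilt p_pr op).
Local Notation Cp := (Cp X).
Local Notation close := (padic_close p).
Local Notation opc := (op_complete p_pr X).
Local Notation endo := (@endo_of_triple p R X p_pr).
Variables (s : specialization oK) (phi : {rmorphism opb -> opb}).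
Local Notation x := (generic_pt s).
Local Notation y := (special_pt s).
Local Notation O := (local_ring s).
Local Notation hatO := (completion p O).
Local Notation local_tilt := (@local_tilt p p_pr R X s).
Local Notation hat_lift := (hat_lift s).
Hypothesis ym : forall a, (a \in y) = (vK a < 1).
Hypothesis phi_cont : tilt_continuous phi.
Hypothesis phi_ker : forall z, phi z = 0 <-> local_tilt z = 0.

(** [phi] is factored through the surjection onto the tilt of the completed local ring and then
    untilted; [phi_ker] makes the choice of the preimage irrelevant. *)
Definition endo_hat (v : plim p hatO) : op :=
  sharp (phi (xget 0 [set z | local_tilt z = tilt_red p_pr v]%classic)).

Lemma endo_hatE v z : local_tilt z = tilt_red p_pr v -> endo_hat v = sharp (phi z).
Proof.
move=> zv; rewrite /endo_hat; case: xgetP => [z' _ /= z'v|/(_ z)/(_ zv)//].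
congr sharp; apply/eqP; rewrite -subr_eq0 -rmorphB; apply/eqP/phi_ker.
by rewrite local_tiltB z'v zv subrr.
Qed.

Lemma endo_hat_lift u : endo_hat (hat_lift u) = sharp (phi (oK_tilt p_pr u)).
Proof. by apply: endo_hatE; rewrite local_tilt_oK. Qed.

Lemma local_tilt_preimage v : exists z, local_tilt z = tilt_red p_pr v.
Proof. exact: local_tilt_surj. Qed.

Lemma endo_hat_mul : plim_multiplicative endo_hat.
Proof.
split=> [|v v0|v w].
- by rewrite (@endo_hatE _ 1) ?tilt_red1 ?local_tilt1 ?rmorph1 ?(sharp1 p_pr opc).
- by rewrite (@endo_hatE _ 0) ?rmorph0 ?(sharp0 p_pr opc) // tilt_zero_seq.
have [[z zv] [z' z'w]] := (local_tilt_preimage v, local_tilt_preimage w).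
rewrite (endo_hatE zv) (endo_hatE z'w) -(sharpM opc) -rmorphM.
by apply: endo_hatE; rewrite local_tiltM zv z'w tilt_redM.
Qed.

(** A form of openness of [local_tilt], which turns continuity of [phi] into continuity of
    [endo_hat]. At the closed point, agreement at a single level already forces
    [local_tilt z = b]. *)
Lemma local_tilt_nearby z (b : tilt p_pr hatO) k : local_tilt z k = b k ->
  exists z', local_tilt z' = b /\ z' k = z k.
Proof.
move=> zb; have [z0 z0b] := local_tilt_surj ym b.
pose d := z0 - z; have [a da] := modp_oK_op_surj p_pr (d k).
have a0 : close 1 (local_of s a) (local_of s 0).
  apply/completion_of_close/modp_ofP.
  rewrite -!hat_ofE -(local_tiltE s da) local_tiltB tiltB z0b zb subrr.
  exact: etrans (esym (rmorph0 (modp_of p))) (congr1 (modp_of p) (esym (rmorph0 (hat_of s)))).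
have [x0|xm] := generic_cases p_pr s.
  exists z0; split=> //; apply/eqP; rewrite -subr_eq0 -tiltB da -[0](rmorph0 (modp_of p)).
  rewrite -(rmorph0 (@oK_op p R X)); apply/eqP/modp_ofP/oK_op_close => //.
  exact: (iffLR (local_of_close p_pr ym _ _ _ x0) a0).
exists z; split=> //; rewrite -z0b; apply/eqP; rewrite eq_sym -subr_eq0 -local_tiltB -/d.
apply/eqP/local_tilt_max => //; rewrite (nrm_lt1_modp da) -xm -local_of_eq0.
by rewrite (max_close_eq p_pr xm a0) rmorph0.
Qed.

Lemma endo_hat_continuous : plim_continuous endo_hat.
Proof.
move=> v n; have [z zv] := local_tilt_preimage v.
have [k kP] := phi_cont z n; exists k, 1%N => w wv.
have [|z' [z'w z'z]] := @local_tilt_nearby z (tilt_red p_pr w) k.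
  by rewrite zv !tilt_redE; apply/modp_ofP/padic_close_sym/wv.
rewrite (endo_hatE zv) (endo_hatE z'w).
apply: (padic_closeW (leqnSn n)); apply: (untilt_close opc).
rewrite add0n; apply: (kP z') => // i ik; exact: tilt_eq_le ik z'z.
Qed.

Lemma oK_tilt_residue (u u' : plim p oK) : vK (u 0%N - u' 0%N) < 1 ->
  op_residue X (sharp (phi (oK_tilt p_pr u))) = op_residue X (sharp (phi (oK_tilt p_pr u'))).
Proof.
move=> uu'; rewrite -!opb_residueE; apply/eqP.
rewrite -subr_eq0 -opb_residueB -rmorphB opb_residue_eq0.
apply: endo_local => //; rewrite -opb_residue_eq0 opb_residueB subr_eq0 !opb_residueE !sharp_oK.
by rewrite op_residueP /= -rmorphB.
Qed.

Lemma max_resfield_lift (w : plim p (resfield y)) :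
  exists u : plim p oK, forall n, w n = to_resfield y (u n).
Proof.
(* Regarding the special point as its own generic point makes the lifting results for the residue
   field of [x] available for that of [y]. *)
pose s' := @Specialization oK y y (fun a ay => ay).
suff [a wa] : exists a, w 0%N = to_resfield y a.
  exact: (@plim_resfield_lift p p_pr R X s' w a wa).
have [//|[w0 [a wa]]] := @resfield_val p p_pr R X s' (w 0%N).
have a1 : vK a = 1.
  apply/eqP; rewrite eq_le vK_le1 //= leNgt -ym -to_resfield_eq0; apply/negP => /eqP a0.
  by have := invr_neq0 w0; rewrite wa a0 eqxx.
have [b ab] := oK_unit p_pr a1; exists b.
have n0 := invr_neq0 w0; apply: (mulfI n0); rewrite mulVf // wa.
exact: etrans (esym (rmorph1 (to_resfield y))) (etrans (congr1 _ (esym ab)) (rmorphM _ _ _)).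
Qed.

Definition endo_special (w : plim p (resfield y)) : Fpbar X :=
  op_residue X (sharp (phi (oK_tilt p_pr
    (xget (plim1 p oK) [set u : plim p oK | forall n, w n = to_resfield y (u n)]%classic)))).

Lemma endo_specialE (w : plim p (resfield y)) (u : plim p oK) : (forall n, w n = to_resfield y (u n)) ->
  endo_special w = op_residue X (sharp (phi (oK_tilt p_pr u))).
Proof.
move=> wu; rewrite /endo_special; case: xgetP => [u' _ wu'|/(_ u)/(_ wu)//].
apply: oK_tilt_residue; rewrite -ym -to_resfield_eq0.
by rewrite to_resfieldB -wu' -wu subrr.
Qed.

Lemma endo_special_mul : plim_multiplicative endo_special.
Proof.
split=> [|w w0|w w'].
- rewrite (@endo_specialE _ (plim1 p oK)).
    have -> : oK_tilt p_pr (plim1 p oK) = 1 by apply: tilt_eq => n; rewrite oK_tiltE !rmorph1.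
    by rewrite rmorph1 (sharp1 p_pr opc) rmorph1.
  by move=> n; exact: esym (rmorph1 (to_resfield y)).
- have z0 : is_power_seq p (fun=> 0 : oK).
    by apply: is_power_seqP => n; apply: expr0n_gt0; apply: prime_gt0.
  rewrite (@endo_specialE _ (Plim z0)).
    have -> : oK_tilt p_pr (Plim z0) = 0 by apply: tilt_eq => n; rewrite oK_tiltE !rmorph0.
    by rewrite rmorph0 (sharp0 p_pr opc) rmorph0.
  by move=> n; rewrite w0; exact: esym (rmorph0 (to_resfield y)).
have [[u uw] [u' u'w]] := (max_resfield_lift w, max_resfield_lift w').
rewrite (endo_specialE uw) (endo_specialE u'w) -rmorphM -(sharpM opc) -rmorphM -oK_tiltM.
by apply: endo_specialE => n; rewrite plim_mulE uw u'w; exact: esym (rmorphM (to_resfield y) _ _).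
Qed.

Lemma local_residue_of a : local_residue (local_of s a) = to_resfield y a.
Proof.
rewrite /local_residue /=.
have e : to_resfield x a = to_resfield x a / to_resfield x 1.
  by rewrite (rmorph1 (to_resfield x)) divr1.
rewrite e (fraction_liftE (@local_residue_eq0 _ s)); last by rewrite (rmorph1 (to_resfield y)) oner_neq0.
by rewrite (rmorph1 (to_resfield y)) divr1.
Qed.

Definition endo_val (u : plim p oK) : Cp := op_val (sharp (phi (oK_tilt p_pr u))).

Lemma endo_valM u v : endo_val (plim_mul u v) = endo_val u * endo_val v.
Proof. by rewrite /endo_val oK_tiltM rmorphM (sharpM opc). Qed.

Lemma endo_val1 : endo_val (plim1 p oK) = 1.
Proof.
rewrite /endo_val; have -> : oK_tilt p_pr (plim1 p oK) = 1.
  by apply: tilt_eq => n; rewrite oK_tiltE !rmorph1.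
by rewrite rmorph1 (sharp1 p_pr opc).
Qed.

Lemma endo_val_local (u v : plim p oK) : (forall n, local_of s (u n) = local_of s (v n)) -> endo_val u = endo_val v.
Proof.
move=> uv; rewrite /endo_val -!endo_hat_lift; congr (op_val (endo_hat _)).
by apply: plim_eq => n; rewrite !hat_liftE !hat_ofE uv.
Qed.

Lemma endo_val_neq0 (u : plim p oK) : u 0%N \notin x -> endo_val u != 0.
Proof.
apply: contraNneq => u0.
have /phi_ker : phi (oK_tilt p_pr u) = 0.
  apply/eqP/contraT => /sharp_neq0/eqP; case; apply/val_inj; exact: u0.
rewrite local_tilt_oK => h; rewrite -local_of_eq0; apply/eqP.
apply: (local_separated p_pr ym) => n; rewrite -(rmorph0 (@local_of _ s)).
apply/hat_of_close; rewrite -hat_liftE rmorph0.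
have z0 : is_power_seq p (fun=> 0 : hatO).
  by apply: is_power_seqP => j; apply: expr0n_gt0; apply: prime_gt0.
have -> : hat_lift u = Plim z0.
  apply: (@tilt_red_inj _ p_pr _ (completion_complete p O)).
  by rewrite h tilt_zero_seq.
exact: padic_close_refl.
Qed.

(** Values on lim of the residue field are prescribed by fractions of compatible systems from o_K. A
    denominator outside [x] has nonzero value by [endo_val_neq0], so the quotient does not depend on
    the fraction. *)
Definition endo_frac (z : plim p (resfield x)) (c : Cp) := exists u v : plim p oK,
  [/\ v 0%N \notin x, forall n, z n * to_resfield x (v n) = to_resfield x (u n) &
      c = endo_val u / endo_val v].

Lemma endo_frac_ex z : exists c, endo_frac z c.
Proof.
have e1 : to_resfield x 1 = 1 := rmorph1 (to_resfield x).
have [[u uz]|[v vz]] := plim_resfield_cases p_pr z.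
  exists (endo_val u / endo_val (plim1 p oK)), u, (plim1 p oK); split=> // [|n].
    by rewrite idealr1.
  by rewrite uz e1 mulr1.
exists (endo_val (plim1 p oK) / endo_val v), (plim1 p oK), v; split=> // [|n].
  rewrite -to_resfield_eq0; apply/eqP => v0; have := vz 0%N; rewrite v0 mulr0.
  by move/esym/eqP; rewrite oner_eq0.
exact: etrans (vz n) (esym e1).
Qed.

Lemma endo_frac_uniq z c c' : endo_frac z c -> endo_frac z c' -> c = c'.
Proof.
move=> [u [v [v0 uv ->]]] [u' [v' [v'0 uv' ->]]].
apply/eqP; rewrite eqr_div ?endo_val_neq0 //; apply/eqP; rewrite -!endo_valM.
apply: endo_val_local => n; apply: val_inj; rewrite !local_of_valE !plim_mulE.
by rewrite !to_resfieldM -uv -uv' mulrAC.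
Qed.

Definition endo_triple_map z : Cp := xget 0 [set c | endo_frac z c]%classic.

Lemma endo_triple_mapE z c : endo_frac z c -> endo_triple_map z = c.
Proof.
move=> zc; rewrite /endo_triple_map; case: xgetP => [c' _ zc'|/(_ c)/(_ zc)//].
exact: endo_frac_uniq zc' zc.
Qed.

Lemma endo_triple_map_mul : plim_multiplicative endo_triple_map.
Proof.
have e1 : to_resfield x 1 = 1 := rmorph1 (to_resfield x).
split=> [|z z0|z z'].
- apply: endo_triple_mapE; exists (plim1 p oK), (plim1 p oK); split=> [||].
  + by rewrite idealr1.
  + by move=> n; rewrite mul1r.
  + by rewrite endo_val1 divr1.
- apply: endo_triple_mapE.
  have s0 : is_power_seq p (fun=> 0 : oK).
    by apply: is_power_seqP => n; apply: expr0n_gt0; apply: prime_gt0.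
  exists (Plim s0), (plim1 p oK); split=> [||].
  + by rewrite idealr1.
  + by move=> n; rewrite z0 mul0r; exact: esym (rmorph0 (to_resfield x)).
  + rewrite /endo_val; have -> : oK_tilt p_pr (Plim s0) = 0.
      by apply: tilt_eq => n; rewrite oK_tiltE !rmorph0.
    by rewrite rmorph0 (sharp0 p_pr opc) mul0r.
have [[c zc] [c' zc']] := (endo_frac_ex z, endo_frac_ex z').
rewrite (endo_triple_mapE zc) (endo_triple_mapE zc'); apply: endo_triple_mapE.
have [[u [v [v0 uv ->]]] [u' [v' [v'0 uv' ->]]]] := (zc, zc').
exists (plim_mul u u'), (plim_mul v v'); split=> [|n|].
- by rewrite plim_mulE prime_idealrM negb_or v0.
- by rewrite !plim_mulE !to_resfieldM mulrACA uv uv'.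
- by rewrite !endo_valM mulf_div.
Qed.

Definition endo_triple : triple X := @Triple p R X s endo_triple_map.

Lemma endo_triple_lift u : triple_map (resfield_lift endo_triple u) = endo_val u.
Proof.
apply: endo_triple_mapE; exists u, (plim1 p oK); split=> [|n|].
- by rewrite idealr1.
- by rewrite (rmorph1 (to_resfield x)) mulr1.
- by rewrite endo_val1 divr1.
Qed.

Lemma endo_hat_is_hat : @is_hat p R X endo_triple endo_hat.
Proof.
split; [exact: endo_hat_mul|exact: endo_hat_continuous|].
exists endo_special; first exact: endo_special_mul.
move=> a; have [u uP] := plim_local_lift p_pr ym a.
have -> : plim_map (@completion_of p O) a = hat_lift u.
  by apply: plim_eq => n; rewrite plim_mapE uP.
rewrite endo_hat_lift; split.
  rewrite -[LHS]/(endo_val u) -endo_triple_lift; congr triple_map.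
  by apply: plim_eq => n; rewrite !plim_mapE uP.
apply/esym/endo_specialE => n; rewrite plim_mapE (uP n); exact: local_residue_of.
Qed.

Lemma endo_triple_Xhat : Xhat endo_triple.
Proof. by split; [exact: endo_triple_map_mul|exists endo_hat; exact: endo_hat_is_hat]. Qed.

(** [hat] is picked by choice among the maps satisfying [is_hat]; continuity and the density of lim
    o_K leave only [endo_hat]. *)
Lemma hat_endo_triple : hat (t := endo_triple) = endo_hat.
Proof.
have hP : @is_hat p R X endo_triple (hat (t := endo_triple)).
  by rewrite /hat; case: xgetP => [Q _ //|/(_ endo_hat)/(_ endo_hat_is_hat)].
have [_ hc _] := hP; apply: (@hat_unique p p_pr R X s ym op (hat (t := endo_triple)) endo_hat
  (op_separated p_pr (X := X)) hc endo_hat_continuous) => u.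
apply: val_inj; rewrite [LHS](is_hat_lift u hP) endo_hat_lift.
exact: endo_triple_lift.
Qed.

Lemma endo_triple_Y : Ydiamond p_pr endo_triple.
Proof.
split; first exact: endo_triple_Xhat.
move=> a b; rewrite /hat_tilt hat_endo_triple.
have [[z za] [z' z'b]] := (local_tilt_surj ym a, local_tilt_surj ym b).
have untO := untiltK (completion_complete p O).
rewrite (@endo_hatE (untilt a) z) ?untO // (@endo_hatE (untilt b) z') ?untO //.
rewrite (@endo_hatE (untilt (a + b)) (z + z')).
  by rewrite rmorphD; apply: (padic_close_trans (sharp_add opc _ _ 0)); apply: padic_close_refl.
by rewrite untO -za -z'b; apply: (rmorphD local_tilt).
Qed.

Lemma endo_of_endo_triple : endo endo_triple = phi.
Proof.
apply/funext => z; apply: tilt_eq => n; rewrite (endo_ofE endo_triple_Y) hat_endo_triple.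
rewrite (@endo_hatE _ (tilt_root n z)).
  rewrite rmorph_tilt_root (sharp_root opc); exact: (untilt_red opc).
rewrite tilt_red_shift (untiltK (completion_complete p O)).
exact: (rmorph_tilt_root local_tilt).
Qed.

End TripleOfEndomorphism.

Section Points.
Variables (p : nat) (p_pr : prime p) (R : realType) (X : padic_fields p R).
Local Notation oK := (oK X).

Definition oK_max : prime_idealr oK := preimage_ideal (@oK_op p R X) (op_max_ideal X).

Lemma oK_maxE a : (a \in oK_max) = (vK a < 1). Proof. by []. Qed.

Definition oK_zero_pred : oK -> bool := fun a => a == 0.

Lemma oK_zeroE a : (a \in oK_zero_pred) = (a == 0). Proof. by []. Qed.

Lemma oK_zero_idealr : idealr_closed oK_zero_pred.
Proof.
split=> [||a b c]; rewrite !oK_zeroE ?eqxx ?oner_eq0 //.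
by move=> /eqP -> /eqP ->; rewrite mulr0 addr0.
Qed.
HB.instance Definition _ := isIdealr.Build oK oK_zero_pred oK_zero_idealr.

Lemma oK_zero_prime : prime_idealr_closed oK_zero_pred.
Proof.
move=> a b; rewrite !oK_zeroE -![_ == 0](inj_eq val_inj) rmorphM /= -/(val a) -/(val b).
by rewrite mulf_eq0.
Qed.
HB.instance Definition _ := isPrimeIdealrClosed.Build oK oK_zero_pred oK_zero_prime.

Definition oK_zero : prime_idealr oK := oK_zero_pred.

Fact generic_spec_subproof : {subset oK_zero <= oK_max}.
Proof. by move=> a; rewrite oK_zeroE => /eqP ->; rewrite idealr0. Qed.
Definition generic_spec := Specialization generic_spec_subproof.
Definition closed_spec := @Specialization oK oK_max oK_max (fun a am => am).

End Points.

(** * Galois action and bijectivity on orbits *)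

Section Identification.
Variables (p : nat) (p_pr : prime p) (R : realType) (X : padic_fields p R).
Local Notation oK := (oK X).
Local Notation op := (op X).
Local Notation opb := (tilt p_pr op).
Local Notation endo := (@endo_of_triple p R X p_pr).
Local Open Scope classical_set_scope.

Lemma endo_of_surj (phi : {rmorphism opb -> opb}) : tilt_continuous phi ->
  exists2 t, Ydiamond p_pr t & endo t = phi.
Proof.
move=> fc; have [k0|km] := endo_cases phi.
  have ker z : phi z = 0 <-> local_tilt (generic_spec X) z = 0.
    split=> [/k0 ->|/local_tilt_ker0 h]; first exact: local_tilt0.
    by rewrite h ?rmorph0 // => a /eqP.
  exists (endo_triple (generic_spec X) phi).
    exact: (@endo_triple_Y _ _ _ _ (generic_spec X) _ (oK_maxE (X := X)) fc ker).
  exact: (@endo_of_endo_triple _ _ _ _ (generic_spec X) _ (oK_maxE (X := X)) fc ker).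
have ker z : phi z = 0 <-> local_tilt (closed_spec X) z = 0.
  split=> [/eqP|zt].
    by rewrite km => /(local_tilt_max (s := closed_spec X)); apply; apply: oK_maxE.
  apply/eqP; rewrite km; have [a za] := modp_oK_op_surj p_pr (z 0%N).
  rewrite (nrm_lt1_modp za) -oK_maxE -(local_of_eq0 (closed_spec X)).
  rewrite (@max_close_eq p p_pr R X (closed_spec X) a 0 0) ?rmorph0 //.
  apply/completion_of_close/modp_ofP; rewrite -[in LHS]hat_ofE -(local_tiltE _ za) zt tilt0.
  exact: etrans (esym (rmorph0 (modp_of p))) (congr1 (modp_of p) (esym (rmorph0 (@completion_of p _)))).
exists (endo_triple (closed_spec X) phi).
  exact: (@endo_triple_Y _ _ _ _ (closed_spec X) _ (oK_maxE (X := X)) fc ker).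
exact: (@endo_of_endo_triple _ _ _ _ (closed_spec X) _ (oK_maxE (X := X)) fc ker).
Qed.

Lemma resfield_map_of (A B : comNzRingType) (f : {rmorphism A -> B}) (I : prime_idealr B) a :
  resfield_map (f := f) (to_resfield (preimage_ideal f I) a) = to_resfield I (f a).
Proof.
rewrite /resfield_map.
have e : to_resfield (preimage_ideal f I) a =
    to_resfield (preimage_ideal f I) a / to_resfield (preimage_ideal f I) 1.
  by rewrite (rmorph1 (to_resfield (preimage_ideal f I))) divr1.
have n1 : (to_resfield I \o f) 1 != 0.
  by rewrite /= rmorph1 (rmorph1 (to_resfield I)) oner_neq0.
rewrite e (fraction_liftE (@resfield_map_eq0 _ _ f I)) //=.
by rewrite rmorph1 (rmorph1 (to_resfield I)) divr1.
Qed.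

Lemma tilt_continuous_comp (f g : opb -> opb) :
  tilt_continuous f -> tilt_continuous g -> tilt_continuous (f \o g).
Proof.
move=> fc gc z n; have [k kP] := fc (g z) n; have [m mP] := gc z k.
by exists m => w /mP/kP.
Qed.

(** The defining conditions are not transported along [s]. Instead the twisted endomorphism yields
    some triple t' in Y, and [triple_ext] identifies t' with [triple_act s t]. *)
Lemma act_endo (s : gal X) (t : triple X) : Ydiamond p_pr t ->
  Ydiamond p_pr (triple_act s t) /\ endo (triple_act s t) = endo t \o gal_tilt s.
Proof.
move=> Y; have [[g ge] gc] := endo_of_End Y.
have [t' Y' e'] : exists2 t', Ydiamond p_pr t' & endo t' = endo t \o gal_tilt s.
  have [|t' Y' e'] := @endo_of_surj (g \o gal_tilt s).
    apply: tilt_continuous_comp; last exact: gal_tilt_continuous.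
    by rewrite -ge.
  by exists t'; rewrite // e' ge.
suff -> : triple_act s t = t' by [].
have e (u : plim p oK) : endo t' (oK_tilt p_pr u) = endo t (oK_tilt p_pr (plim_map (gal_oK s) u)).
  by rewrite e' /= gal_tilt_oK.
apply: triple_ext => //.
- have [m1 m0 mM] := map_mul Y; split=> [|a a0|a b] /=.
  + rewrite -m1; congr triple_map; apply: plim_eq => n; exact: rmorph1.
  + by apply: m0 => n; rewrite plim_mapE a0 rmorph0.
  + rewrite -mM; congr triple_map; apply: plim_eq => n; exact: rmorphM.
- exact: map_mul Y'.
- by move=> a; rewrite mem_preimage (special_max Y); apply: gal_max.
- exact: special_max Y'.
- move=> a; have [u <-] := @plim_lift p oK a 0 (fun c => oK_pth_root p_pr c).
  by rewrite (generic_endo Y') e -(generic_endo Y).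
move=> u; rewrite (triple_mapE Y') e -(triple_mapE Y) /=.
congr triple_map; apply: plim_eq => n; rewrite !plim_mapE; exact: resfield_map_of.
Qed.

Lemma identification_orbit (t : triple X) : Ydiamond p_pr t ->
  identification X p_pr (triple_orbit t) = endo_orbit (endo t).
Proof.
move=> Y; apply/seteqP; split=> [_ [_ [s _ <-] <-]|_ [s _ <-]].
  by exists s => //; have [_ ->] := act_endo s Y.
by exists (triple_act s t); [exists s|have [_ ->] := act_endo s Y].
Qed.

Lemma identification_bij :
  set_bij (Ydiamond0 X p_pr) (End_cont0 X p_pr) (identification X p_pr).
Proof.
split.
- move=> _ [t Y <-]; rewrite identification_orbit //.
  by exists (endo t); [exact: endo_of_End|].
- move=> O1 O2; rewrite !inE => -[t1 Y1 <-] [t2 Y2 <-] e.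
  have sub t t' : Ydiamond p_pr t -> Ydiamond p_pr t' ->
      identification X p_pr (triple_orbit t) = identification X p_pr (triple_orbit t') ->
      triple_orbit t `<=` triple_orbit t'.
    move=> Y Y' ee _ [s _ <-].
    have : identification X p_pr (triple_orbit t) (endo (triple_act s t)).
      by exists (triple_act s t) => //; exists s.
    rewrite ee => -[_ [s' _ <-] e']; exists s' => //.
    by apply: endo_of_inj e'; [have [] := act_endo s' Y'|have [] := act_endo s Y].
  by apply/seteqP; split; apply: sub.
- move=> _ [phi [[g ge] fc] <-]; have [|t Y e] := @endo_of_surj g; first by rewrite -ge.
  by exists (triple_orbit t); [exists t|rewrite identification_orbit // e ge].
Qed.

End Identification.

(** * Factorization at the closed point and of Frobenius powers *)

Section FactorizationAtClosedPoint.
Variables (p : nat) (p_pr : prime p) (R : realType) (X : padic_fields p R).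
Local Notation oK := (oK X).
Local Notation op := (op X).
Local Notation endo := (@endo_of_triple p R X p_pr).
Variable t : triple X.
Local Notation s := (triple_pts t).
Local Notation hatO := (completion p (local_ring s)).
Hypothesis tY : Ydiamond p_pr t.
Local Notation ym := (special_max tY).
Local Notation close := (padic_close p).
Local Notation opc := (op_complete p_pr X).
Local Notation hat := (@hat p R X t).

Lemma hat_local_tilt (v : plim p hatO) z : local_tilt s z = tilt_red p_pr v ->
  hat v = sharp (endo t z).
Proof.
by move=> zv; rewrite (sharp_endo tY) zv (tilt_redK p_pr (completion_complete p _)).
Qed.

Section ClosedPoint.
Hypothesis xm : forall a, (a \in generic_pt s) = (vK a < 1).

Lemma completion_p0 : p%:R = 0 :> hatO.
Proof.
rewrite -(rmorph_nat (@completion_of p (local_ring s))) local_p0 //.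
exact: (rmorph0 (@completion_of p (local_ring s))).
Qed.

Lemma hat_of_surj (z : hatO) : exists a, z = hat_of s a.
Proof.
have [a /padic_closeP[c ->]] := hat_of_approx p_pr ym z 1.
by exists a; rewrite expr1 completion_p0 mul0r addr0.
Qed.

Lemma hat_frob_inj (z w : hatO) : z ^+ p = w ^+ p -> z = w.
Proof.
have [[a ->] [b ->]] := (hat_of_surj z, hat_of_surj w) => e.
have ab : local_of s (a ^+ p) = local_of s (b ^+ p).
  apply: (@max_close_eq p p_pr R X s _ _ 0) => //; apply/hat_of_close/padic_close_eq.
  exact: etrans (rmorphXn (hat_of s) p a) (etrans e (esym (rmorphXn (hat_of s) p b))).
rewrite !hat_ofE; suff -> : local_of s a = local_of s b by [].
apply: (local_max_frob p_pr xm).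
exact: etrans (esym (rmorphXn (@local_of _ s) p a)) (etrans ab (rmorphXn (@local_of _ s) p b)).
Qed.

Lemma plim_hat_inj (v w : plim p hatO) : v 0%N = w 0%N -> v = w.
Proof.
move=> e; apply: plim_eq; elim=> [//|n IH].
by apply: hat_frob_inj; rewrite !plimP.
Qed.

(** In the completed local ring p = 0 and Frobenius is injective, so a compatible system is
    determined by its first term, which may be arbitrary. Thus the projection at 0 is bijective, and
    continuity of [chi] is automatic. *)
Lemma closed_point_factors : hat_factors t.
Proof.
have [[_ _ hM] _ _] := hatP tY.
pose chi (z : hatO) : op := xget 0 [set c | exists v : plim p hatO, v 0%N = z /\ c = hat v]%classic.
have chiE (v : plim p hatO) : chi (v 0%N) = hat v.
  rewrite /chi; case: xgetP => [_ _ [w [/plim_hat_inj -> ->]] //|/(_ (hat v)) []].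
  by exists v.
have lift z : exists v : plim p hatO, v 0%N = z.
  have [a ->] := hat_of_surj z.
  have [u <-] := @plim_lift p oK a 0 (fun c => oK_pth_root p_pr c).
  by exists (hat_lift s u).
exists 0%N, chi; split=> [z n|z w|v]; last by rewrite chiE.
  exists 1%N => w /padic_closeP[c ->]; apply: padic_close_eq; congr chi.
  by rewrite expr1 completion_p0 mul0r addr0.
have [[v <-] [v' <-]] := (lift z, lift w).
by rewrite !chiE -hM -chiE.
Qed.

End ClosedPoint.

Section GenericPoint.
Hypothesis x0 : forall a, a \in generic_pt s -> a = 0.

(** The canonical map from the completed local ring at the generic point to o_p, encoded by having
    common approximations in o_K. *)
Definition hat_theta_rel (z : hatO) (c : op) :=
  forall n, exists a, close n z (hat_of s a) /\ close n c (oK_op a).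

Lemma hat_of_op_close n (a b : oK) : close n (hat_of s a) (hat_of s b) -> close n (oK_op a) (oK_op b).
Proof.
by move=> /hat_of_close h; apply/oK_op_close => //; exact: (iffLR (local_of_close p_pr ym _ _ _ x0) h).
Qed.

Lemma hat_theta_close n z z' c c' : hat_theta_rel z c -> hat_theta_rel z' c' ->
  close n z z' -> close n c c'.
Proof.
move=> /(_ n)[a [za ca]] /(_ n)[b [zb cb]] zz'.
apply: (padic_close_trans ca); apply: padic_close_trans (padic_close_sym cb).
apply: hat_of_op_close; apply: (padic_close_trans (padic_close_sym za)).
exact: padic_close_trans zz' zb.
Qed.

Lemma hat_theta_ex z : exists c, hat_theta_rel z c.
Proof.
have /choice[a aP] := fun n => hat_of_approx p_pr ym z n.
have [n|c cP] := opc.2 (fun n => oK_op (a n)).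
  apply: hat_of_op_close; apply: padic_close_trans (aP n).
  exact/padic_close_sym/(padic_closeW (leqnSn n))/aP.
by exists c => n; exists (a n).
Qed.

Definition hat_theta (z : hatO) : op := xget 0 [set c | hat_theta_rel z c]%classic.

Lemma hat_thetaP z : hat_theta_rel z (hat_theta z).
Proof.
by rewrite /hat_theta; case: xgetP => [c _ //|nex]; have [c /nex] := hat_theta_ex z.
Qed.

Lemma hat_thetaE z c : hat_theta_rel z c -> hat_theta z = c.
Proof.
move=> zc; apply: (padic_separatedP opc.1) => n.
apply: (hat_theta_close (hat_thetaP z) zc); exact: padic_close_refl.
Qed.

Lemma hat_thetaM : {morph hat_theta : z w / z * w}.
Proof.
move=> z w; apply: hat_thetaE => n.
have [[a [za ca]] [b [wb cb]]] := (hat_thetaP z n, hat_thetaP w n).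
by exists (a * b); rewrite !rmorphM; split; apply: padic_closeM.
Qed.

Lemma hat_theta_continuous : padic_continuous p hat_theta.
Proof.
by move=> z n; exists n => w; apply: hat_theta_close; apply: hat_thetaP.
Qed.

Lemma hat_theta_untilt (v : plim p hatO) z i : local_tilt s z = tilt_red p_pr v ->
  hat_theta (v i) = untilt z i.
Proof.
move=> zv; apply: hat_thetaE => n.
have [a za] := modp_oK_op_surj p_pr (z (i + n)%N).
have vn : modp_of p (v (i + n)%N) = modp_of p (hat_of s a).
  by rewrite -tilt_redE -zv; apply: local_tiltE.
have zn : modp_of p (untilt z (i + n)%N) = modp_of p (oK_op a).
  by rewrite (untilt_red opc) za.
exists (a ^+ (p ^ n)); rewrite !rmorphXn.
rewrite -(plimPn v i n) -(plimPn (untilt z) i n).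
by split; apply: (padic_closeW (leqnSn n)); apply: (@padic_closeXpn p _ 0 n); apply/modp_ofP.
Qed.

(** A nonnegative power of Frobenius is absorbed into [chi] after the projection at 0; the power
    -(k+1) is precisely the projection at k+1. *)
Lemma frobenius_factors (m : int) : (forall z, endo t z = tilt_frob m z) -> hat_factors t.
Proof.
case: m => k eE.
  exists 0%N, (fun z => hat_theta z ^+ (p ^ k)); split=> [z n|z w|v].
  - by exists n => w wz; apply/padic_closeX/(hat_theta_close _ _ wz); apply: hat_thetaP.
  - by rewrite hat_thetaM exprMn.
  have [z zv] := local_tilt_surj ym (tilt_red p_pr v).
  by rewrite (hat_local_tilt zv) eE /= (sharpX opc) (hat_theta_untilt _ zv).
exists k.+1, hat_theta; split=> [||v]; [exact: hat_theta_continuous|exact: hat_thetaM|].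
have [z zv] := local_tilt_surj ym (tilt_red p_pr v).
by rewrite (hat_local_tilt zv) eE /= (sharp_root opc) (hat_theta_untilt _ zv).
Qed.

End GenericPoint.
End FactorizationAtClosedPoint.

(** * Graph of an endomorphism on sharp values *)

(** As i C(p^n, i) is a multiple of p^n, a binomial prime to p would make p^n divide i. *)
Lemma prime_dvd_bin_pow p n i : prime p -> (0 < i < p ^ n)%N -> (p %| 'C(p ^ n, i))%N.
Proof.
move=> p_pr /andP[i0 iq]; apply/contraT => pC.
have : (p ^ n %| i * 'C(p ^ n, i))%N.
  by case: i i0 {iq pC} => // i _; rewrite -mul_bin_diag dvdn_mulr.
rewrite Gauss_dvdl; last by rewrite coprimeXl // prime_coprime.
by move/(dvdn_leq i0); rewrite leqNgt iq.
Qed.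

Lemma exprD_middle (A : comPzRingType) (x y : A) q : (0 < q)%N ->
  (x + y) ^+ q = x ^+ q + y ^+ q +
    \sum_(i < q.-1) x ^+ (q - i.+1) * y ^+ i.+1 *+ 'C(q, i.+1).
Proof.
case: q => // q _; rewrite exprDn big_ord_recl big_ord_recr /= /bump !add1n.
rewrite subnn subn0 !expr0 mulr1 mul1r bin0 binn !mulr1n -addrA; congr (_ + _).
by rewrite addrC; congr (_ + _); apply: eq_bigr => i _; rewrite /bump add1n.
Qed.

Section DeformationOfSharp.
Variables (p : nat) (p_pr : prime p) (R : realType) (X : padic_fields p R).
Local Notation oK := (oK X).
Local Notation op := (op X).
Local Notation opb := (tilt p_pr op).
Local Notation close := (padic_close p).
Local Notation opc := (op_complete p_pr X).
Variable phi : {rmorphism opb -> opb}.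

(** The group Gamma of the overview; closure under subtraction suffices since the generator at 0
    minus itself is the zero triple. The third entry is carried because it controls the first one
    modulo p. *)
Inductive sharp_graph : op -> op -> opb -> Prop :=
| sharp_graph_gen c : sharp_graph (sharp c) (sharp (phi c)) c
| sharp_graph_sub u v c u' v' c' : sharp_graph u v c -> sharp_graph u' v' c' ->
    sharp_graph (u - u') (v - v') (c - c').

Lemma sharp_graph0 : sharp_graph 0 0 0.
Proof.
have := sharp_graph_sub (sharp_graph_gen 0) (sharp_graph_gen 0).
by rewrite !subrr.
Qed.

Lemma sharp_graphD u v c u' v' c' : sharp_graph u v c -> sharp_graph u' v' c' ->
  sharp_graph (u + u') (v + v') (c + c').
Proof.
move=> h h'; have := sharp_graph_sub h (sharp_graph_sub sharp_graph0 h').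
by rewrite !sub0r !opprK.
Qed.

Lemma sharp_graph_mulrn u v c n : sharp_graph u v c -> sharp_graph (u *+ n) (v *+ n) (c *+ n).
Proof.
move=> h; elim: n => [|n IH]; first exact: sharp_graph0.
by rewrite !mulrS; apply: sharp_graphD.
Qed.

Lemma sharp_graph_sum n (k : 'I_n -> nat) (c : 'I_n -> opb) :
  sharp_graph (\sum_(i < n) sharp (c i) *+ k i) (\sum_(i < n) sharp (phi (c i)) *+ k i)
    (\sum_(i < n) c i *+ k i).
Proof.
elim/big_rec3: _ => [|i c' v u _ h]; first exact: sharp_graph0.
by apply: sharp_graphD => //; apply/sharp_graph_mulrn/sharp_graph_gen.
Qed.

(* The p-adic expansion of [(c + d)^#], whose coefficients are polynomials in    *)
(* p-power roots of [c] and [d] and so are compatible with [phi].                *)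
Lemma sharp_graph_add n c d : exists u v e, [/\ sharp_graph u v e,
  close n (sharp (c + d)) (sharp c + sharp d + p%:R * u) &
  close n (sharp (phi (c + d))) (sharp (phi c) + sharp (phi d) + p%:R * v)].
Proof.
set q := (p ^ n)%N; have q0 : (0 < q)%N by rewrite expn_gt0 prime_gt0.
pose k (i : 'I_q.-1) := ('C(q, i.+1) %/ p)%N.
have kE (i : 'I_q.-1) : 'C(q, i.+1) = (p * k i)%N.
  rewrite mulnC divnK // prime_dvd_bin_pow //= -/q -ltn_predRL; exact: ltn_ord.
pose f (i : 'I_q.-1) : opb := tilt_root n c ^+ (q - i.+1) * tilt_root n d ^+ i.+1.
(* Applied to the identity and to [phi]: the same roots and the same integer multiplicities serve
   both, which puts the two corrections into a single element of Gamma. *)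
have main (psi : {rmorphism opb -> opb}) : close n (sharp (psi (c + d)))
   (sharp (psi c) + sharp (psi d) + p%:R * \sum_(i < q.-1) sharp (psi (f i)) *+ k i).
  rewrite rmorphD; apply: (padic_closeW (leqnSn n)).
  apply: (padic_close_trans (sharp_add opc _ _ n)); apply: padic_close_eq.
  rewrite -/q exprD_middle // mulr_sumr; congr (_ + _ + _).
  - exact: (plimPn (untilt (psi c)) 0 n).
  - exact: (plimPn (untilt (psi d)) 0 n).
  apply: eq_bigr => i _; rewrite kE mulnC mulrnA mulr_natl; congr (_ *+ _ *+ _).
  by rewrite rmorphM !rmorphXn !rmorph_tilt_root (sharpM opc) !(sharpX opc) !(sharp_root opc).
exists (\sum_(i < q.-1) sharp (f i) *+ k i), (\sum_(i < q.-1) sharp (phi (f i)) *+ k i),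
  (\sum_(i < q.-1) f i *+ k i).
by split; [exact: sharp_graph_sum|exact: (main idfun)|exact: main].
Qed.

(** For a difference, c^# - c'^# is replaced by (c - c')^# through the expansion of c = (c - c') +
    c'; the correction is p times an element of Gamma. *)
Lemma sharp_graph_mod n u v c : sharp_graph u v c -> exists u' v' c',
  [/\ sharp_graph u' v' c', close n u (sharp c + p%:R * u') &
      close n v (sharp (phi c) + p%:R * v')].
Proof.
elim=> {u v c} [c|u v c u' v' c' _ [u1 [v1 [c1 [g1 uu1 vv1]]]] _ [u2 [v2 [c2 [g2 uu2 vv2]]]]].
  exists 0, 0, 0; rewrite !mulr0 !addr0.
  by split; [exact: sharp_graph0|exact: padic_close_refl|exact: padic_close_refl].
have [u3 [v3 [c3 [g3]]]] := sharp_graph_add n (c - c') c'; rewrite subrK => uu3 vv3.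
have e (a b z w1 w2 w3 : op) : close n a (z + b + p%:R * w3) ->
    close n (a + p%:R * w1 - (b + p%:R * w2)) (z + p%:R * (w3 + w1 - w2)).
  move=> h.
  have -> : z + p%:R * (w3 + w1 - w2) = (z + b + p%:R * w3) + p%:R * w1 - (b + p%:R * w2).
    rewrite mulrBr mulrDr opprD !addrA; congr (_ - _).
    by rewrite [z + b]addrC -!(addrA b) [b + _]addrC subrK.
  by apply: padic_closeB; [apply: padic_closeD h _|]; apply: padic_close_refl.
exists (u3 + u1 - u2), (v3 + v1 - v2), (c3 + c1 - c2); split.
- by apply: sharp_graph_sub => //; apply: sharp_graphD.
- by apply: (padic_close_trans (padic_closeB uu1 uu2)); apply: e.
- by apply: (padic_close_trans (padic_closeB vv1 vv2)); apply: e.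
Qed.

Lemma op_pmul_close n (c : op) : close n.+1 (p%:R * c) 0 -> close n c 0.
Proof.
move=> /op_closeP-/(_ p_pr); rewrite rmorphM rmorph_nat rmorph0 subr0 abspM absp_p => h.
apply/op_closeP => //; rewrite rmorph0 subr0.
rewrite -(@ler_pM2l _ p%:R^-1) ?invr_gt0 ?pR_gt0 //.
by apply: (le_trans h); rewrite exprS invfM.
Qed.

Lemma op_pmul_closeS n (c : op) : close n c 0 -> close n.+1 (p%:R * c) 0.
Proof. by move=> h; have := padic_close_pmul 1 h; rewrite expr1 mulr0. Qed.

Lemma geometric_sum0 (z : op) n : z ^+ n = 1 -> z != 1 -> \sum_(i < n) z ^+ i = 0.
Proof.
move=> zn z1; have := subrX1 z n; rewrite zn subrr => /esym e.
have z10 : val (z - 1) != 0.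
  by apply: contraNneq z1 => z10; rewrite -subr_eq0; apply/eqP/val_inj.
by apply/val_inj/(mulfI z10); rewrite -rmorphM e rmorph0 mulr0.
Qed.

Lemma close1_nrm (c : opb) : close 1 (sharp c) 0 -> nrm c <= p%:R^-1.
Proof. by move=> /op_closeP-/(_ p_pr); rewrite rmorph0 subr0 expr1. Qed.

(* [xi] plays the role of a generator of the kernel of the theta map of Fontaine: *)
(* modulo [xi] and [p] every relation between values [c^#] is trivial.            *)
Lemma sharp_graph_close (e : opb) : sharp (e ^+ p) = 1 -> sharp e != 1 ->
  sharp (phi (e ^+ p)) = 1 -> sharp (phi e) != 1 ->
  p%:R^-1 <= nrm (\sum_(i < p) e ^+ i) ->
  forall n u v c, sharp_graph u v c -> close n u 0 -> close n v 0.
Proof.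
set xi := \sum_(i < p) e ^+ i => ep e1 fp f1 xi_big.
elim=> [|n IH] u v c g u0; first exact: padic_close0n.
have [u1 [v1 [c1 [g1 uu1 vv1]]]] := sharp_graph_mod n.+1 g.
have c_small : close 1 (sharp c) 0.
  have h := padic_close_trans (padic_close_sym uu1) u0.
  apply: (padic_close_trans _ (padic_closeW (leq_addl n 1) _)); last by rewrite addn1; exact: h.
  by rewrite -[X in close 1 X _]addr0; apply: padic_closeD (padic_close_refl _ _ _) _;
    apply/padic_close_sym; rewrite -{1}(expr1 p%:R); apply: padic_close_p0.
have xi0 : xi != 0 by rewrite -nrm_gt0 (lt_le_trans _ xi_big) // invr_gt0 pR_gt0.
have [d cd] : exists d, c = xi * d.
  by apply: opb_div => //; apply: (le_trans (close1_nrm c_small)).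
(* Expand c as the sum of the e^i d. The sharp values sum to d^# times the sum of the powers of a
   nontrivial p-th root of unity, hence to 0, and likewise after [phi]. *)
have : sharp_graph 0 0 c.
  have := sharp_graph_sum (fun=> 1%N) (fun i : 'I_p => e ^+ i * d).
  have -> : \sum_(i < p) sharp (e ^+ i * d) *+ 1 = 0.
    transitivity ((\sum_(i < p) sharp e ^+ i) * sharp d).
      by rewrite mulr_suml; apply: eq_bigr => i _; rewrite mulr1n (sharpM opc) (sharpX opc).
    by rewrite geometric_sum0 ?mul0r // -(sharpX opc).
  have -> : \sum_(i < p) sharp (phi (e ^+ i * d)) *+ 1 = 0.
    transitivity ((\sum_(i < p) sharp (phi e) ^+ i) * sharp (phi d)).
      by rewrite mulr_suml; apply: eq_bigr => i _; rewrite mulr1n rmorphM rmorphXn (sharpM opc) (sharpX opc).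
    by rewrite geometric_sum0 ?mul0r // -(sharpX opc) -rmorphXn.
  by rewrite cd mulr_suml.
(* The third entry is now 0 while u and v are unchanged, so modulo p^(n+1) both are p times the
   entries of a new triple in Gamma, to which the induction applies with precision n. *)
move=> /(sharp_graph_sub g); rewrite !subr0 subrr => g0.
have [u2 [v2 [c2 [g2 uu2 vv2]]]] := sharp_graph_mod n.+1 g0.
move: uu2 vv2; rewrite rmorph0 (sharp0 p_pr opc) !add0r => uu2 vv2.
apply: (padic_close_trans vv2); apply: op_pmul_closeS; apply: IH g2 _.
exact/op_pmul_close/(padic_close_trans (padic_close_sym uu2) u0).
Qed.

End DeformationOfSharp.

(** * Size of the cyclotomic element xi *)

Section CyclotomicUnit.
Variables (p : nat) (p_pr : prime p) (R : realType) (X : padic_fields p R).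
Local Notation oK := (oK X).
Local Notation op := (op X).
Local Notation opc := (op_complete p_pr X).

Lemma vKD_le (a b : oK) (e : R) : vK a <= e -> vK b <= e -> vK (a + b) <= e.
Proof. by rewrite /vK /absb !rmorphD; apply: abspD_le. Qed.

Lemma vKN (a : oK) : vK (- a) = vK a.
Proof. by rewrite /vK /absb !rmorphN abspN. Qed.

Lemma vK_1D (a : oK) : vK a < 1 -> vK (1 + a) = 1.
Proof.
move=> a1; have := @absp_eq p R X (CpOf X (val (1 + a))) 1; rewrite absp1; apply.
by rewrite !rmorphD !rmorph1 addrC addKr.
Qed.

Lemma vKp : vK (p%:R : oK) = p%:R^-1.
Proof. by rewrite -(expr1 p%:R) vK_pX. Qed.

(** All middle terms share the factor p z, and the remaining factor [1 + z * r] has absolute value 1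
    as soon as |z| < 1. *)
Lemma expr1D_prime (A : comPzRingType) (z : A) :
  exists r, (1 + z) ^+ p - 1 = z ^+ p + p%:R * z * (1 + z * r).
Proof.
have p2 : p.-1 = p.-2.+1 by rewrite prednK // -subn1 subn_gt0 prime_gt1.
pose k i := ('C(p, i.+2) %/ p)%N.
exists (\sum_(i < p.-2) z ^+ i *+ k i).
rewrite exprD_middle ?prime_gt0 // p2 big_ord_recl /= !expr1n bin1 mul1r expr1.
rewrite addrC !addrA addNr add0r -addrA; congr (_ + _).
rewrite mulrDr mulr1 mulr_natl; congr (_ + _).
rewrite mulrA mulr_sumr; apply: eq_bigr => i _.
have kE : 'C(p, i.+2) = (p * k i)%N.
  rewrite mulnC divnK // prime_dvd_bin //=.
  by have := ltn_ord i; rewrite !ltn_predRL.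
rewrite /bump add1n kE expr1n mul1r mulrnA mulrnAr; congr (_ *+ _).
by rewrite 2!mulrnAl -expr2 -exprD.
Qed.

Variable u : plim p oK.
Hypotheses (u0 : u 0%N = 1) (u1 : u 1%N != 1).

(** [u 1] and [u 2] are roots of unity of exact orders p and p^2, and [s] is the quotient of u_1 - 1
    by u_2 - 1. *)
Let a := vK (u 1%N - 1).
Let b := vK (u 2%N - 1).
Let s := \sum_(i < p) (u 2%N) ^+ i.

(** With z = u_1 - 1, the relation 0 = z^p + p z (1 + z r) excludes |z| = 1; then the last factor is
    a unit and |z|^p = |z| / p. *)
Lemma root_of_unity_dist : 0 < a < 1 /\ a ^+ p.-1 = p%:R^-1.
Proof.
have a0 : 0 < a by rewrite vK_gt0 subr_eq0.
have [r] := expr1D_prime (u 1%N - 1); set z := u 1%N - 1 in a0 *.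
have -> : 1 + z = u 1%N by rewrite addrC subrK.
rewrite plimP u0 subrr => /esym/eqP; rewrite addrC addr_eq0 => /eqP e.
have ap : a ^+ p = p%:R^-1 * a * vK (1 + z * r).
  by rewrite -vKp -!vKM e vKN -vKX.
have a1 : a < 1.
  rewrite ltNge; apply/negP => a1; have : a ^+ p <= p%:R^-1 * a.
    by rewrite ap ler_piMr ?vK_le1 // mulr_ge0 ?vK_ge0 // invr_ge0 ltW // pR_gt0.
  apply/negP; rewrite -ltNge (@lt_le_trans _ _ a) //; last first.
    by rewrite -{1}(expr1 a) ler_weXn2l // prime_gt0.
  by rewrite gtr_pMl // invf_lt1 ?pR_gt0 // pR_gt1.
split; first by rewrite a0.
move: ap; rewrite vK_1D; last by rewrite vKM (le_lt_trans _ a1) // ler_piMr ?vK_ge0 ?vK_le1.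
by rewrite mulr1 -{1}(prednK (prime_gt0 p_pr)) exprSr => /(mulIf (lt0r_neq0 a0)).
Qed.

(** Expanding u_2^p shows that b^p is at most a or b / p. In the first case a^p = b^p |s|^p <= a
    |s|^p, so |s|^p >= a^(p-1) = 1/p. In the second b^(p-1) <= a^(p-1) = (b |s|)^(p-1), so |s| >=
    1. *)
Lemma cyclotomic_unit_val : p%:R^-1 <= vK s ^+ p.
Proof.
have [/andP[a0 a1] ap] := root_of_unity_dist.
have bs : b * vK s = a by rewrite -vKM -subrX1 plimP.
have b0 : 0 < b.
  by rewrite lt_neqAle vK_ge0 andbT; apply: contraTneq a0 => e; rewrite -bs -e mul0r ltxx.
have [r e] := expr1D_prime (u 2%N - 1); move: e; set z := u 2%N - 1.
have -> : 1 + z = u 2%N by rewrite addrC subrK.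
rewrite plimP => e.
have bmax : b ^+ p <= Num.max a (p%:R^-1 * b).
  have -> : b ^+ p = vK (z ^+ p) by rewrite vKX.
  have -> : z ^+ p = (u 1%N - 1) + - (p%:R * z * (1 + z * r)).
    by rewrite e addrK.
  apply: vKD_le; first by rewrite le_max lexx.
  rewrite vKN !vKM vKp le_max; apply/orP; right.
  by rewrite ler_piMr ?vK_le1 // mulr_ge0 ?vK_ge0 // invr_ge0 ltW // pR_gt0.
have s0 := vK_ge0 s.
move: bmax; rewrite le_max => /orP[bp|bp].
  rewrite -ap -(@ler_pM2r _ a) // -exprSr prednK ?prime_gt0 // -{1}bs exprMn mulrC.
  by rewrite ler_wpM2l // exprn_ge0.
have : b ^+ p.-1 <= b ^+ p.-1 * vK s ^+ p.-1.
  rewrite -exprMn bs ap -(@ler_pM2r _ b) //; first by rewrite -exprSr prednK ?prime_gt0.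
rewrite ler_pMr ?exprn_gt0 // => s1.
have {}s1 : 1 <= vK s.
  rewrite leNgt; apply/negP => h; move: s1; rewrite leNgt exprn_ilt1 //.
  by rewrite -lt0n -ltnS prednK ?prime_gt0 // prime_gt1.
apply: (@le_trans _ _ 1); last by rewrite exprn_ege1.
by rewrite invf_le1 ?pR_gt0 // ltW // pR_gt1.
Qed.

Local Notation eps := (oK_tilt p_pr u).

(** At level 0 the sum reduces to 0, so the norm is read off at level 1, where the component lifts
    to [s]. Since |s| > 1/p, knowing [s] modulo p determines its absolute value. *)
Lemma cyclotomic_unit_nrm : p%:R^-1 <= nrm (\sum_(i < p) (tilt_root 1 eps) ^+ i).
Proof.
set xi := \sum_(i < p) _.
have xi1 : xi 1%N = modp_of p (oK_op s).
  rewrite /xi /s; elim/big_rec2: _ => [|i y z _ IH]; first by rewrite tilt0 !rmorph0.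
  by rewrite tiltD IH !rmorphD !rmorphXn tiltX.
have s_big : p%:R^-1 < vK s.
  rewrite ltNge; apply/negP => sp; have := cyclotomic_unit_val; apply/negP; rewrite -ltNge.
  apply: (@le_lt_trans _ _ (p%:R^-1 ^+ p)); first by apply: lerXn2r => //; rewrite nnegrE ?vK_ge0 // invr_ge0 ltW // pR_gt0.
  rewrite -{2}(expr1 p%:R^-1) ltr_iXn2l ?invr_gt0 ?pR_gt0 ?invf_lt1 ?pR_gt0 ?pR_gt1 //.
  exact: prime_gt1.
have h : absp (val (untilt xi 1) - val (oK_op s)) <= p%:R^-1.
  rewrite -(expr1 p%:R); apply/op_closeP => //; apply/modp_ofP.
  by rewrite (untilt_red opc).
rewrite -(nrm_untilt xi 1) expn1 (absp_eq (d := val (oK_op s))); first exact: cyclotomic_unit_val.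
exact: le_lt_trans h s_big.
Qed.

End CyclotomicUnit.

(** * From bounded ring homomorphisms on o_K to Galois elements *)

Section GaloisFromHom.
Variables (p : nat) (p_pr : prime p) (R : realType) (X : padic_fields p R).
Local Notation Qp := (Qp X).
Local Notation Qpbar := (Qpbar X).
Local Notation Cp := (Cp X).
Local Notation absp := (@absp p R X).
Local Notation CpOf := (CpOf X).
Local Notation QpbarOf := (@QpbarOf p R X).
Local Notation oK := (oK X).

(* Injectivity on the finite set of roots of a minimal polynomial gives surjectivity. *)
Lemma gal_of_hom (s : {rmorphism Qpbar -> Qpbar}) :
  (forall u, s (QpbarOf u) = QpbarOf u) -> exists g : gal X, forall a, g a = s a.
Proof.
move=> sQ.
have surj b : exists a, s a = b.
  have [f [fmon fb _]] := min_annihilator b.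
  have f0 : map_poly QpbarOf f != 0 by rewrite map_poly_eq0 monic_neq0.
  have [r rE] := closed_field_poly_normal (map_poly QpbarOf f).
  have rP c : (c \in undup r) = root (map_poly QpbarOf f) c.
    by rewrite mem_undup rE rootZ ?lead_coef_eq0 // root_prod_XsubC.
  have sr : {subset map s (undup r) <= undup r}.
    move=> _ /mapP[c cr ->]; rewrite !rP in cr *.
    have -> : map_poly QpbarOf f = map_poly s (map_poly QpbarOf f).
      by rewrite -map_poly_comp; apply: eq_map_poly => u /=; rewrite sQ.
    exact: rmorph_root.
  have u1 : uniq (map s (undup r)) by rewrite map_inj_uniq ?undup_uniq //; apply: fmorph_inj.
  have [|_ e] := uniq_min_size u1 sr; first by rewrite size_map.
  have : b \in undup r by rewrite rP.
  by rewrite -e => /mapP[a _ ->]; exists a.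
have [g gP] := choice surj.
have sb : bijective s by exists g => a; [apply: (fmorph_inj s); rewrite gP|exact: gP].
by exists (Gal sb sQ).
Qed.

Variable f : {rmorphism oK -> Cp}.
Hypothesis f_le1 : forall a, absp (f a) <= 1.

Definition hom_frac (a : Qpbar) (c : Cp) := exists (b : oK) n,
  val b = p%:R ^+ n * a /\ f b = p%:R ^+ n * c.

Lemma hom_frac_ex a : exists c, hom_frac a c.
Proof.
have [n nP] := expr_unbounded (absb a) (pR_gt1 p_pr R).
have aK : p%:R ^+ n * a \in @oK_pred p R X.
  rewrite oK_intP // /absb rmorphM rmorphXn rmorph_nat abspM absp_pX mulrC.
  by rewrite ler_pdivrMr ?exprn_gt0 ?pR_gt0 // mul1r ltW.
exists (f (MkoK aK) / p%:R ^+ n), (MkoK aK), n; split=> //.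
by rewrite [RHS]mulrC divfK // pCp_neq0.
Qed.

Lemma val_pX (b : oK) n : val (p%:R ^+ n * b) = p%:R ^+ n * val b.
Proof. by rewrite rmorphM rmorphXn rmorph_nat. Qed.

Lemma hom_pX (b : oK) n : f (p%:R ^+ n * b) = p%:R ^+ n * f b.
Proof. by rewrite rmorphM rmorphXn rmorph_nat. Qed.

Lemma hom_frac_uniq a c c' : hom_frac a c -> hom_frac a c' -> c = c'.
Proof.
move=> [b [n [ba bc]]] [b' [n' [ba' bc']]].
have e : p%:R ^+ n' * b = p%:R ^+ n * b' by apply: val_inj; rewrite !val_pX ba ba' mulrCA.
have := congr1 f e; rewrite !hom_pX bc bc' mulrCA.
by move=> /(mulfI (pCp_neq0 p_pr X n))/(mulfI (pCp_neq0 p_pr X n')).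
Qed.

Definition hom_ext a : Cp := xget 0 [set c | hom_frac a c]%classic.

Lemma hom_extP a : hom_frac a (hom_ext a).
Proof.
by rewrite /hom_ext; case: xgetP => [c _ //|nex]; have [c /nex] := hom_frac_ex a.
Qed.

Lemma hom_extE a c : hom_frac a c -> hom_ext a = c.
Proof. exact/hom_frac_uniq/hom_extP. Qed.

Lemma hom_ext_val (b : oK) : hom_ext (val b) = f b.
Proof. by apply: hom_extE; exists b, 0%N; rewrite !expr0 !mul1r. Qed.

Lemma hom_ext_zmod : zmod_morphism hom_ext.
Proof.
move=> a a'; apply: hom_extE.
have [[b [n [ba bc]]] [b' [n' [ba' bc']]]] := (hom_extP a, hom_extP a').
exists (p%:R ^+ n' * b - p%:R ^+ n * b'), (n + n')%N.
have e (A : comPzRingType) (x y : A) : p%:R ^+ n' * (p%:R ^+ n * x) - p%:R ^+ n * (p%:R ^+ n' * y) =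
    p%:R ^+ (n + n') * (x - y) by rewrite exprD mulrBr -!mulrA; congr (_ - _); rewrite mulrCA.
split; last by rewrite rmorphB !hom_pX bc bc' e.
transitivity (val (p%:R ^+ n' * b) - val (p%:R ^+ n * b')); first exact: (rmorphB (val : oK -> Qpbar)).
by rewrite !val_pX ba ba' e.
Qed.

Lemma hom_ext_monoid : monoid_morphism hom_ext.
Proof.
split=> [|a a']; apply: hom_extE.
  by exists 1, 0%N; rewrite !rmorph1 !expr0 !mul1r.
have [[b [n [ba bc]]] [b' [n' [ba' bc']]]] := (hom_extP a, hom_extP a').
exists (b * b'), (n + n')%N.
split; last by rewrite rmorphM bc bc' exprD mulrACA.
transitivity (val b * val b'); first exact: (rmorphM (val : oK -> Qpbar)).
by rewrite ba ba' exprD mulrACA.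
Qed.
HB.instance Definition _ := GRing.isZmodMorphism.Build Qpbar Cp hom_ext hom_ext_zmod.
HB.instance Definition _ := GRing.isMonoidMorphism.Build Qpbar Cp hom_ext hom_ext_monoid.

(* Rationals are dense in Q_p and [hom_ext] contracts balls around 0. *)
Lemma hom_ext_Qp u : hom_ext (QpbarOf u) = QpCp X u.
Proof.
apply/eqP; rewrite -subr_eq0; apply/eqP/absp_small => e e0.
have [n nP] := pXV_small p_pr e0; apply: le_lt_trans nP.
have [r rP] := Qp_dense u (pXV_gt0 p_pr R n).
have wK : QpbarOf (u - ratr r) / p%:R ^+ n \in @oK_pred p R X.
  rewrite oK_intP // /absb fmorph_div rmorphXn rmorph_nat abspM abspV absp_pX invrK.
  by rewrite -ler_pdivlMr ?exprn_gt0 ?pR_gt0 // div1r ltW.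
have p0 : p%:R ^+ n != 0 :> Qpbar.
  by rewrite -(fmorph_eq0 CpOf) rmorphXn rmorph_nat pCp_neq0.
have h : hom_ext (QpbarOf (u - ratr r)) = p%:R ^+ n * f (MkoK wK).
  by apply: hom_extE; exists (p%:R ^+ n * MkoK wK), 0%N;
    rewrite val_pX hom_pX !expr0 !mul1r /= mulrC divfK.
have -> : hom_ext (QpbarOf u) - QpCp X u =
    hom_ext (QpbarOf (u - ratr r)) - QpCp X (u - ratr r).
  rewrite !rmorphB /= !fmorph_rat opprB addrA; congr (_ - _).
  by rewrite subrK.
apply: abspB_le; last exact: ltW.
by rewrite h abspM absp_pX ler_piMr // ltW // pXV_gt0.
Qed.

(** The extension to the algebraic closure fixes Q_p, hence sends each element to a root of its
    minimal polynomial; all these roots lie in [Qpbar], so the image does too. *)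
Lemma hom_gal : exists g : gal X, forall a : oK, f a = CpOf (g (val a)).
Proof.
have img a : exists b, CpOf b = hom_ext a.
  have [q [qmon qa _]] := min_annihilator a.
  have [r rE] := closed_field_poly_normal (map_poly QpbarOf q).
  have qc : root (map_poly (QpCp X) q) (hom_ext a).
    have -> : map_poly (QpCp X) q = map_poly hom_ext (map_poly QpbarOf q).
      by rewrite -map_poly_comp; apply: eq_map_poly => u; rewrite /= hom_ext_Qp.
    exact: rmorph_root.
  move: qc; have -> : map_poly (QpCp X) q = map_poly CpOf (map_poly QpbarOf q).
    by rewrite -map_poly_comp; apply: eq_map_poly.
  rewrite rE map_polyZ rootZ ?fmorph_eq0 ?lead_coef_eq0 ?map_poly_eq0 ?monic_neq0 //.
  rewrite rmorph_prod /=.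
  have -> : \prod_(i <- r) map_poly CpOf ('X - i%:P) = \prod_(c <- map CpOf r) ('X - c%:P).
    by rewrite big_map; apply: eq_bigr => i _; rewrite rmorphB /= map_polyX map_polyC.
  by rewrite root_prod_XsubC => /mapP[b _ ->]; exists b.
have [s sP] := choice img.
have sz : zmod_morphism s by move=> a b; apply: (fmorph_inj CpOf); rewrite rmorphB !sP rmorphB.
have sm : monoid_morphism s.
  by split=> [|a b]; apply: (fmorph_inj CpOf); rewrite ?rmorphM !sP ?rmorph1 ?rmorphM.
pose s1 := GRing.isZmodMorphism.Build _ _ s sz.
pose s2 := GRing.isMonoidMorphism.Build _ _ s sm.
pose sr : {rmorphism Qpbar -> Qpbar} := HB.pack s s1 s2.
have [|g gP] := @gal_of_hom sr.
  by move=> u; apply: (fmorph_inj CpOf); rewrite /= sP hom_ext_Qp.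
by exists g => a; rewrite gP /= sP hom_ext_val.
Qed.

End GaloisFromHom.

(** * Injective endomorphisms that factor through a projection *)

Section EndomorphismsCompatibleWithSharp.
Variables (p : nat) (p_pr : prime p) (R : realType) (X : padic_fields p R).
Local Notation Cp := (Cp X).
Local Notation Qpbar := (Qpbar X).
Local Notation oK := (oK X).
Local Notation op := (op X).
Local Notation opb := (tilt p_pr op).
Local Notation opc := (op_complete p_pr X).
Local Notation endo := (@endo_of_triple p R X p_pr).
Local Notation absp := (@absp p R X).

Lemma exists_root_of_unity : exists z : oK, z ^+ p = 1 /\ z != 1.
Proof.
pose q : {poly Qpbar} := \poly_(i < p) 1.
have sq : size q = p by rewrite size_poly_eq // oner_neq0.
have [|z /rootP qz] := closed_rootP q _.
  by rewrite sq -(prednK (prime_gt0 p_pr)) eqSS -lt0n -ltnS prednK ?prime_gt0 // prime_gt1.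
have zE : \sum_(i < p) z ^+ i = 0.
  apply: etrans qz; rewrite horner_poly.
  by apply: eq_bigr => i _; rewrite mul1r.
have zp : z ^+ p = 1 by apply/eqP; rewrite -subr_eq0 subrX1 zE mulr0.
have z1 : z != 1.
  apply: contra_eqN zE => /eqP ->.
  under eq_bigr do rewrite expr1n.
  by rewrite sumr_const card_ord -(fmorph_eq0 (CpOf X)) rmorph_nat -(expr1 p%:R) pCp_neq0.
have zK : z \in @oK_pred p R X.
  rewrite oK_intP // /absb leNgt; apply/negP => h.
  have : 1 < Defs.absp (CpOf X z) ^+ p by rewrite exprn_egt1 // -lt0n prime_gt0.
  by rewrite -abspX -rmorphXn zp rmorph1 absp1 ltxx.
exists (MkoK zK); split; last by apply: contra z1 => /eqP/(congr1 val)/= ->.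
by apply: val_inj; rewrite rmorphXn.
Qed.

Section Deformation.
Variables (phi : {rmorphism opb -> opb}) (u : plim p oK).
Hypothesis phi_cont : tilt_continuous phi.
Hypotheses (u0 : u 0%N = 1) (u1 : u 1%N != 1).
Local Notation eps := (oK_tilt p_pr u).
Hypotheses (f0 : sharp (phi eps) = 1) (f1 : sharp (phi (tilt_root 1 eps)) != 1).

Lemma sharp_graph_eq0 v c : sharp_graph phi 0 v c -> v = 0.
Proof.
move=> g; apply: opc.1 => n.
have ep : tilt_root 1 eps ^+ p = eps by have := tilt_rootXK 1 eps; rewrite expn1.
apply: (@sharp_graph_close p p_pr R X phi (tilt_root 1 eps) _ _ _ _ _ n 0 v c) => //.
- by rewrite ep sharp_oK u0 rmorph1.
- rewrite (sharp_root opc) untilt_oK; apply: contra u1 => /eqP e.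
  by apply/eqP/(@oK_op_inj p R X); rewrite e rmorph1.
- by rewrite ep.
- exact: cyclotomic_unit_nrm.
- exact: padic_close_refl.
Qed.

Lemma sharp_deform c d : sharp c = sharp d -> sharp (phi c) = sharp (phi d).
Proof.
move=> cd; apply/eqP; rewrite -subr_eq0; apply/eqP.
apply: (@sharp_graph_eq0 _ (c - d)).
by have := sharp_graph_sub (sharp_graph_gen phi c) (sharp_graph_gen phi d); rewrite cd subrr.
Qed.

Lemma deform_gal : exists g : gal X, forall x, phi x = gal_tilt g x.
Proof.
have /choice[l lP] : forall a : oK, exists v : plim p oK, v 0%N = a.
  by move=> a; have [v] := @plim_lift p oK a 0 (fun c => oK_pth_root p_pr c); exists v.
pose f a : Cp := op_val (sharp (phi (oK_tilt p_pr (l a)))).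
have fE (v : plim p oK) : f (v 0%N) = op_val (sharp (phi (oK_tilt p_pr v))).
  by congr op_val; apply: sharp_deform; rewrite !sharp_oK lP.
have fz : zmod_morphism f.
  move=> a b; rewrite /f -op_valB; congr op_val; apply/eqP; rewrite -subr_eq0; apply/eqP.
  (* The systems chosen above a - b, a and b are unrelated in the tilt, but they combine to an
     element of Gamma with first entry 0, whose second entry therefore vanishes. *)
  have := sharp_graph_sub (sharp_graph_gen phi (oK_tilt p_pr (l (a - b))))
    (sharp_graph_sub (sharp_graph_gen phi (oK_tilt p_pr (l a))) (sharp_graph_gen phi (oK_tilt p_pr (l b)))).
  by rewrite !sharp_oK !lP -!rmorphB subrr rmorph0 => /sharp_graph_eq0.
have fm : monoid_morphism f.
  split=> [|a b].
    rewrite /f -[RHS]/(op_val 1) -(sharp1 p_pr opc) -(rmorph1 phi); congr op_val.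
    by apply: sharp_deform; rewrite sharp_oK lP rmorph1 (sharp1 p_pr opc).
  rewrite /f -op_valM -(sharpM opc) -rmorphM; congr op_val; apply: sharp_deform.
  by rewrite (sharpM opc) !sharp_oK !lP rmorphM.
pose f_1 := GRing.isZmodMorphism.Build _ _ f fz.
pose f_2 := GRing.isMonoidMorphism.Build _ _ f fm.
pose fr : {rmorphism oK -> Cp} := HB.pack f f_1 f_2.
have [|g gP] := @hom_gal p p_pr R X fr; first by move=> a; apply: opP.
have gE (v : plim p oK) : phi (oK_tilt p_pr v) = gal_tilt g (oK_tilt p_pr v).
  apply: tilt_eq => n; rewrite (@gal_tiltE _ _ _ _ g _ n (v n)) //.
  rewrite -(untilt_red opc) -(sharp_root opc) -rmorph_tilt_root.
  congr (modp_of p _); apply: val_inj.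
  have -> : tilt_root n (oK_tilt p_pr v) = oK_tilt p_pr (plim_shift n v) by apply: tilt_eq.
  by rewrite -[LHS](fE (plim_shift n v)); apply: gP.
exists g => x; apply: tilt_eq => n; have [k kP] := phi_cont x n.
have [v vP] := oK_tilt_dense x (maxn k n).
rewrite -(kP (oK_tilt p_pr v) _ n (leqnn n)); last first.
  by move=> i ik; apply: vP; rewrite leq_max ik.
rewrite gE; have [a xa] := modp_oK_op_surj p_pr (x n).
by rewrite (gal_tiltE g xa); apply: gal_tiltE; rewrite vP ?leq_maxr.
Qed.

End Deformation.

Lemma tilt_root_frob i j : exists m : int, forall x : opb, tilt_root i (x ^+ (p ^ j)) = tilt_frob m x.
Proof.
case: (leqP i j) => ij.
  exists (Posz (j - i)) => x /=.
  by rewrite -{1}(subnK ij) expnD exprM tilt_rootK.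
exists (Negz (i - j).-1) => x; rewrite /tilt_frob prednK ?subn_gt0 //.
apply: (@tilt_expI _ p_pr _ i) => /=; rewrite tilt_rootXK.
by rewrite -{2}(subnK (ltnW ij)) expnD exprM tilt_rootXK.
Qed.

Lemma factors_gal_frob (t : triple X) : Ydiamond p_pr t ->
  (forall x, endo t x = 0 -> x = 0) -> hat_factors t ->
  exists (g : gal X) (m : int), forall x, endo t x = gal_tilt g (tilt_frob m x).
Proof.
move=> Y inj [i [chi [_ chiM chiE]]].
have [[phi phiE] phi_cont] := endo_of_End Y.
rewrite phiE in inj phi_cont *.
have chi_sharp (v : plim p oK) : sharp (phi (oK_tilt p_pr v)) = chi (hat_of (triple_pts t) (v i)).
  rewrite -phiE (sharp_endo Y) local_tilt_oK (tilt_redK p_pr (completion_complete p _)).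
  exact: chiE.
have chi1 : chi 1 = 1.
  have := chi_sharp (plim1 p oK); rewrite rmorph1 => <-.
  have -> : oK_tilt p_pr (plim1 p oK) = 1 by apply: tilt_eq => n; rewrite oK_tiltE !rmorph1.
  by rewrite rmorph1 (sharp1 p_pr opc).
have [z [zp z1]] := exists_root_of_unity.
have [u uz] := @plim_lift p oK z 1 (fun c => oK_pth_root p_pr c).
have u1 : u 1%N != 1 by rewrite uz.
have u0 : u 0%N = 1 by rewrite -(plimP u) uz zp.
set eps := oK_tilt p_pr u.
pose d j := phi (tilt_root j (eps ^+ (p ^ i))).
(* The factorisation is decisive here: the value equals [chi] at u_i^(p^i) = u_0 = 1. *)
have d0 : sharp (d 0%N) = 1.
  have vP : is_power_seq p (fun n => u n ^+ (p ^ i)).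
    by apply: is_power_seqP => n; rewrite exprAC plimP.
  have -> : d 0%N = phi (oK_tilt p_pr (Plim vP)).
    congr (phi _); apply: tilt_eq => n; rewrite tilt_rootE addn0 tiltX !oK_tiltE.
    by rewrite -!rmorphXn.
  rewrite chi_sharp /=.
  have -> : u i ^+ (p ^ i) = 1 by have := plimPn u 0 i; rewrite add0n u0.
  exact: etrans (congr1 chi (rmorph1 (hat_of (triple_pts t)))) chi1.
(* If every root had sharp value 1, then phi(eps^(p^i)) = 1, and injectivity would give eps^(p^i) =
   1, so eps = 1. *)
have [j [dj dj1]] : exists j, sharp (d j) = 1 /\ sharp (d j.+1) != 1.
  apply: contrapT => nj.
  have dall j : sharp (d j) = 1.
    elim: j => [//|j IH]; apply/eqP/contraT => h; case: nj; exists j; split=> //.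
  have : d 0%N = 1.
    rewrite -(untiltK opc (d 0%N)) -tilt_red1; congr tilt_red; apply: plim_eq => n.
    rewrite -(sharp_root opc) -rmorph_tilt_root -[RHS](dall n); congr (sharp (phi _)).
    by apply: tilt_eq => k; rewrite !tilt_rootE addn0.
  have -> : d 0%N = phi (eps ^+ (p ^ i)).
    by congr (phi _); apply: tilt_eq => n; rewrite tilt_rootE addn0.
  rewrite -(rmorph1 phi) => /eqP; rewrite -subr_eq0 -rmorphB => /eqP/inj/eqP.
  rewrite subr_eq0 => /eqP e.
  have /(@tilt_expI _ p_pr _ i) e1 : eps ^+ (p ^ i) = 1 ^+ (p ^ i) by rewrite expr1n.
  case/eqP: u1; apply: (@oK_op_inj p R X).
  by rewrite -untilt_oK -/eps e1 (untilt1 p_pr opc) rmorph1.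
have [m mE] := tilt_root_frob j i.
have [m' m'E] := tilt_root_frob i j.
(* Here [m] stands for i - j and [m'] for j - i. The choice of [j] says that psi(eps) has sharp
   value 1 and that of its p-th root differs from 1, as [deform_gal] requires. *)
pose psi x := phi (tilt_frob m x).
have psiz : zmod_morphism psi.
  move=> x y; rewrite /psi -!mE -!rmorphB; congr (phi _).
  have -> : (x - y) ^+ (p ^ i) = x ^+ (p ^ i) - y ^+ (p ^ i).
    by apply: (addIr (y ^+ (p ^ i))); rewrite -tilt_expD !subrK.
  exact: tilt_eq.
have psim : monoid_morphism psi.
  split=> [|x y]; rewrite /psi -!mE; last by rewrite exprMn tilt_rootM rmorphM.
  by rewrite expr1n -[RHS](rmorph1 phi); congr (phi _); apply: tilt_eq.
pose psi1 := GRing.isZmodMorphism.Build _ _ psi psiz.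
pose psi2 := GRing.isMonoidMorphism.Build _ _ psi psim.
pose psir : {rmorphism opb -> opb} := HB.pack psi psi1 psi2.
have psic : tilt_continuous psir.
  move=> x n; have [k kP] := phi_cont (tilt_frob m x) n; exists (k + j)%N => y yx.
  apply: kP => l lk; rewrite -!mE !tilt_rootE !tiltX yx //.
  by rewrite leq_add2r.
have [| |g gP] := @deform_gal psir u psic u0 u1.
- by rewrite /= /psi -mE.
- rewrite /= /psi -mE.
  have -> : tilt_root j (tilt_root 1 eps ^+ (p ^ i)) = tilt_root j.+1 (eps ^+ (p ^ i)).
    by apply: tilt_eq => n; rewrite !tilt_rootE !tiltX tilt_rootE addn1 addnS.
  exact: dj1.
exists g, m' => y; rewrite -gP /= /psi -mE -m'E.
rewrite -{1}(tilt_rootK j y); congr (phi (tilt_root j _)).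
by rewrite tilt_rootXK.
Qed.

End EndomorphismsCompatibleWithSharp.

(** * The residue field and its Galois lifts *)

Section ResidueField.
Variables (p : nat) (p_pr : prime p) (R : realType) (X : padic_fields p R).
Local Notation Qp := (Qp X).
Local Notation Qpbar := (Qpbar X).
Local Notation Cp := (Cp X).
Local Notation absp := (@absp p R X).
Local Notation QpbarOf := (@QpbarOf p R X).
Local Notation CpOf := (CpOf X).
Local Notation oK := (oK X).
Local Notation op := (op X).
Local Notation opb := (tilt p_pr op).
Local Notation Fpbar := (Fpbar X).

Lemma absp_intr_coprime (m : int) : ~~ (p %| `|m|)%N -> absp m%:~R = 1.
Proof.
case: m => n; first exact: absp_natr_coprime.
by rewrite NegzE mulrNz abspN; apply: absp_natr_coprime.
Qed.

Lemma absp_natr_dvd n : (p %| n)%N -> absp n%:R < 1.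
Proof.
move=> /dvdnP[k ->]; rewrite natrM abspM absp_p.
by rewrite (le_lt_trans (ler_piMl _ (absp_nat X k))) ?invr_ge0 ?ltW ?invf_lt1 ?pR_gt0 ?pR_gt1.
Qed.

Lemma absp_intr_dvd (m : int) : (p %| `|m|)%N -> absp m%:~R < 1.
Proof.
case: m => n; first exact: absp_natr_dvd.
by rewrite NegzE mulrNz abspN; apply: absp_natr_dvd.
Qed.

Lemma intr_residue (m : int) : exists n : nat, absp (m%:~R - n%:R) < 1.
Proof.
have p0 : (p%:Z != 0)%R by rewrite eqz_nat -lt0n prime_gt0.
exists `|(m %% p%:Z)%Z|%N; rewrite -[_%:R]/(_%:Z%:~R) gez0_abs ?modz_ge0 // -rmorphB.
apply: absp_intr_dvd; rewrite {1}(divz_eq m p%:Z) addrK abszM /= dvdn_mull //.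
Qed.

Lemma ratr_residue (r : rat) : absp (ratr r) <= 1 -> exists n : nat, absp (ratr r - n%:R) < 1.
Proof.
move=> r1; rewrite /ratr in r1 *; set a := numq r in r1 *; set d := denq r in r1 *.
have dE : d = `|d|%N :> int by rewrite gez0_abs // ltW // denq_gt0.
have dC0 : d%:~R != 0 :> Cp.
  by rewrite dE -pmulrn (pcharf0P _).1 ?absz_eq0 ?denq_neq0 //; exact: Cp_char0.
have pd : ~~ (p %| `|d|)%N.
  apply/negP => pd; have pa : ~~ (p %| `|a|)%N.
    apply/negP => pa; have := coprime_num_den r; rewrite /coprime -/a -/d => /eqP g1.
    have : (p %| 1)%N by rewrite -g1 dvdn_gcd pa.
    by rewrite dvdn1 => /eqP p1; have := prime_gt1 p_pr; rewrite p1.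
  move: r1; rewrite abspM abspV (absp_intr_coprime pa) mul1r.
  by apply/negP; rewrite -ltNge invf_gt1 ?absp_intr_dvd // absp_gt0.
have d1 : absp d%:~R = 1 := absp_intr_coprime pd.
have [n nP] := intr_residue a.
have [e eP] : exists e : nat, absp (d%:~R * e%:R - 1) < 1.
  have d0' : (0 < `|d|)%N by rewrite absz_gt0 denq_neq0.
  have cop : gcdn `|d| p = 1%N by apply/eqP; rewrite gcdnC -/(coprime p _) prime_coprime.
  case: (egcdnP p d0') => km kn; rewrite cop => /(congr1 (fun n => n%:R : Cp)) ee _.
  exists km; rewrite dE -pmulrn -natrM mulnC ee natrD addrK natrM.
  rewrite -natrM; apply: absp_natr_dvd; exact: dvdn_mull.
exists (n * e)%N.
have -> : a%:~R / d%:~R - (n * e)%:R = ((a%:~R - n%:R) - n%:R * (d%:~R * e%:R - 1)) / d%:~R :> Cp.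
  apply: (mulIf dC0); rewrite divfK // mulrBl divfK // natrM mulrBr mulr1 opprB.
  by rewrite addrA subrK -!mulrA [e%:R * _]mulrC.
rewrite abspM abspV d1 invr1 mulr1; apply: abspB_lt => //.
by rewrite abspM (le_lt_trans _ eP) // ler_piMl ?absp_ge0 ?absp_nat.
Qed.

(** The residue field of Z_p is the prime field: approximate by a rational, whose denominator is
    prime to p and is inverted modulo p by Bezout. *)
Lemma Zp_residue (u : Qp) : absp (QpCp X u) <= 1 -> exists n : nat, absp (QpCp X u - n%:R) < 1.
Proof.
move=> u1; have [r] := Qp_dense u (@ltr01 R); rewrite -/(QpCp X _) rmorphB fmorph_rat => ur.
have [|n nP] := @ratr_residue r.
  by rewrite -(subrK (QpCp X u) (ratr r)) abspD_le // absp_distC ltW.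
by exists n; rewrite -(subrK (ratr r) (QpCp X u)) -addrA abspD_lt.
Qed.

Definition resK : {rmorphism oK -> Fpbar} := op_residue X \o @oK_op p R X.

Lemma resK_eq0 a : (resK a == 0) = (vK a < 1).
Proof. exact: op_residue_eq0. Qed.

Lemma resK_surj (z : Fpbar) : exists a, resK a = z.
Proof.
pose c : op := repr z; have [a ca] := oK_dense p_pr c 1; exists a.
have -> : z = op_residue X c by exact/esym/reprK.
by apply/esym; apply: op_residue_close ca.
Qed.

Lemma Fpbar_p0 : p%:R = 0 :> Fpbar.
Proof. by rewrite -(rmorph_nat resK); apply/eqP; rewrite resK_eq0 vKp // invf_lt1 ?pR_gt0 ?pR_gt1. Qed.

Lemma Fpbar_frobB n (x y : Fpbar) : (x - y) ^+ (p ^ n) = x ^+ (p ^ n) - y ^+ (p ^ n).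
Proof.
elim: n => [|n IH]; first by rewrite !expr1.
rewrite expnSr !exprM IH; apply: (addIr ((y ^+ (p ^ n)) ^+ p)).
by rewrite -(frobenius_add p_pr Fpbar_p0) !subrK.
Qed.

Lemma Fpbar_frob_inj n (x y : Fpbar) : x ^+ (p ^ n) = y ^+ (p ^ n) -> x = y.
Proof.
move=> xy; apply/eqP; rewrite -subr_eq0.
have : (x - y) ^+ (p ^ n) == 0 by rewrite Fpbar_frobB xy subrr.
by rewrite expf_eq0 => /andP[].
Qed.

Lemma nat_mod_Fpbar (k : nat) : k%:R = (k %% p)%:R :> Fpbar.
Proof. by rewrite {1}(divn_eq k p) natrD natrM Fpbar_p0 mulr0 add0r. Qed.

Lemma rmorph_monic_nat (A B : pzRingType) (g : {rmorphism A -> B}) a n (k : nat -> nat) :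
  g (a ^+ n + \sum_(i < n) (k i)%:R * a ^+ i) = g a ^+ n + \sum_(i < n) (k i)%:R * g a ^+ i.
Proof.
rewrite rmorphD rmorphXn rmorph_sum; congr (_ + _).
by apply: eq_bigr => i _; rewrite rmorphM rmorph_nat rmorphXn.
Qed.

(* The powers of [x] lie in a finite set, namely the polynomials in [x] of       *)
(* bounded degree with coefficients in the prime field.                           *)
Lemma Fpbar_finite (x : Fpbar) : exists2 r, (0 < r)%N & x ^+ (p ^ r) = x.
Proof.
have [a ax] := resK_surj x.
have [q qmon qa] : integralOver (@ZpQpbar p R X) (val a) by apply/asboolP; exact: (valP a).
set n := (size q).-1; have sq : size q = n.+1 by rewrite /n prednK // size_poly_gt0 monic_neq0.
have /choice[k kP] : forall i, exists m : nat, absp (QpCp X (val q`_i) - m%:R) < 1.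
  by move=> i; apply: Zp_residue; exact: (valP q`_i).
(* Reduction of the integral equation of a lift. The factor p - 1 stands for -1, so that all
   coefficients are natural numbers. *)
have rel : x ^+ n = \sum_(i < n) (k i * p.-1)%:R * x ^+ i.
  pose b : oK := a ^+ n + \sum_(i < n) (k i)%:R * a ^+ i.
  have b1 : vK b < 1.
    have vb : CpOf (val b) = CpOf (val a) ^+ n + \sum_(i < n) (k i)%:R * CpOf (val a) ^+ i.
      exact: (rmorph_monic_nat (CpOf \o (val : oK -> Qpbar))).
    rewrite /vK /absb vb.
    have qE : CpOf (val a) ^+ n + \sum_(i < n) QpCp X (val q`_i) * CpOf (val a) ^+ i = 0.
      apply: etrans (etrans (congr1 CpOf (rootP qa)) (rmorph0 _)).
      rewrite -horner_map -map_poly_comp (@horner_coef_wide _ n.+1) ?(leq_trans (size_poly _ _)) ?sq //.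
      have cE i : (map_poly (CpOf \o @ZpQpbar p R X) q)`_i = QpCp X (val q`_i).
        exact: (coef_map (CpOf \o @ZpQpbar p R X)).
      rewrite big_ord_recr addrC; congr (_ + _).
        by apply: eq_bigr => i _; rewrite cE.
      have -> : (map_poly (CpOf \o @ZpQpbar p R X) q)`_n = 1.
        rewrite cE; have -> : q`_n = 1 by move/monicP: qmon; rewrite lead_coefE sq.
        exact: rmorph1.
      by rewrite mul1r.
    rewrite -[X in absp X]subr0 -[X in _ - X]qE opprD addrACA subrr add0r -sumrB.
    elim/big_ind: _ => [|c d|i _]; rewrite ?absp0 ?ltr01 //; first exact: abspD_lt.
    rewrite -mulrBl abspM absp_distC abspX (le_lt_trans _ (kP i)) // ler_piMr ?absp_ge0 //.
    by rewrite exprn_ile1 ?absp_ge0 // -/(absb _) -oK_intP ?(valP a).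
  have : resK b == 0 by rewrite resK_eq0.
  rewrite /b (rmorph_monic_nat resK) ax addr_eq0 => /eqP ->; rewrite -sumrN.
  apply: eq_bigr => i _; rewrite natrM -mulNr; congr (_ * _).
  apply/eqP; rewrite eq_sym -addr_eq0 -{2}[(k i)%:R]mulr1 -mulrDr natr1 prednK ?prime_gt0 //.
  by rewrite Fpbar_p0 mulr0.
pose comb (c : {ffun 'I_n -> 'I_p}) : Fpbar := \sum_(i < n) (c i)%:R * x ^+ i.
have norm (c : 'I_n -> nat) : exists c', \sum_(i < n) (c i)%:R * x ^+ i = comb c'.
  exists [ffun i => Ordinal (ltn_pmod (c i) (prime_gt0 p_pr))].
  by apply: eq_bigr => i _; rewrite ffunE /= -nat_mod_Fpbar.
have pw m : exists c, x ^+ m = comb c.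
  suff [c ->] : exists c : nat -> nat, x ^+ m = \sum_(i < n) (c i)%:R * x ^+ i.
    exact: (norm (fun i => c i)).
  elim: m => [|m [c IH]].
    case En: n rel => [|n'] rel.
      by move: rel; rewrite expr0 big_ord0 => /eqP; rewrite oner_eq0.
    exists (fun i => (i == 0%N)); rewrite expr0 big_ord_recl expr0 mulr1.
    by rewrite big1 ?addr0 // => i _; rewrite mul0r.
  case En: n rel IH => [|n'] rel IH.
    by move: rel; rewrite expr0 big_ord0 => /eqP; rewrite oner_eq0.
  exists (fun i => (if i is i'.+1 then c i' else 0) + c n' * (k i * p.-1))%N.
  rewrite exprS IH big_ord_recr /= mulrDr mulrCA -exprS rel mulr_sumr.
  under [RHS]eq_bigr do rewrite natrD mulrDl natrM -mulrA.
  rewrite big_split /= mulr_sumr; congr (_ + _).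
  rewrite big_ord_recl mul0r add0r; apply: eq_bigr => i _.
  by rewrite mulrCA -exprS.
have /choice[c cP] := pw.
(* Pigeonhole on the exponents p^i; injectivity of Frobenius then cancels the common power. *)
have [i [j [ij e]]] : exists i j, (i < j)%N /\ c (p ^ i)%N = c (p ^ j)%N.
  apply: contrapT => nex.
  have inj : injective (fun i : 'I_(#|{: {ffun 'I_n -> 'I_p}}|).+1 => c (p ^ i)%N).
    move=> i j /= cij; apply: val_inj; case: (ltngtP i j) => // h; case: nex.
      by exists i, j.
    by exists j, i.
  by have := leq_card _ inj; rewrite card_ord ltnn.
exists (j - i)%N; first by rewrite subn_gt0.
apply: (@Fpbar_frob_inj i); rewrite -exprM -expnD subnK ?(ltnW ij) //.
by rewrite !cP e.
Qed.

(** These are the elements of the algebraic closure of F_p inside the tilt, described without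
    reference to the section [Fpbar_opb]. *)
Definition frob_fixed (c : opb) := exists2 r, (0 < r)%N & c ^+ (p ^ r) = c.

(** The difference is fixed by a common positive power of Frobenius and has norm below 1, so it is
    0. *)
Lemma frob_fixed_uniq c d : frob_fixed c -> frob_fixed d -> opb_residue c = opb_residue d -> c = d.
Proof.
move=> [r r0 cr] [r' r'0 dr] cd; apply/eqP; rewrite -subr_eq0; set e := c - d.
have e1 : nrm e < 1 by rewrite -opb_residue_eq0 /e opb_residueB cd subrr.
have pow (z : opb) m k : z ^+ (p ^ m) = z -> z ^+ (p ^ (m * k)) = z.
  move=> zm; elim: k => [|k IH]; first by rewrite muln0 expr1.
  by rewrite mulnS expnD exprM zm.
have ee : e ^+ (p ^ (r * r')) = e.
  apply: (addIr (d ^+ (p ^ (r * r')))); rewrite -tilt_expD subrK pow //.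
  by rewrite mulnC pow // subrK.
apply/contraT; rewrite -nrm_gt0 => e0.
have := congr1 (@nrm _ _ _ _) ee; rewrite nrmX => h.
have : nrm e ^+ (p ^ (r * r')) < nrm e.
  rewrite -{2}(expr1 (nrm e)) ltr_iXn2l //.
  by rewrite -{1}(expn0 p) ltn_exp2l ?prime_gt1 // muln_gt0 r0.
by rewrite h ltxx.
Qed.

Lemma frob_fixedD c d : frob_fixed c -> frob_fixed d -> frob_fixed (c - d) /\ frob_fixed (c * d).
Proof.
have pow (z : opb) m k : z ^+ (p ^ m) = z -> z ^+ (p ^ (m * k)) = z.
  move=> zm; elim: k => [|k IH]; first by rewrite muln0 expr1.
  by rewrite mulnS expnD exprM zm.
move=> [r r0 cr] [r' r'0 dr].
have cq := pow _ _ r' cr; have dq := pow _ _ r dr; rewrite mulnC in dq.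
split; exists (r * r')%N; rewrite ?muln_gt0 ?r0 //.
  by apply: (addIr (d ^+ (p ^ (r * r')))); rewrite -tilt_expD subrK cq dq subrK.
by rewrite exprMn cq dq.
Qed.

(* Compatible p-power roots of a root of X^q - X, q = p^r, are its powers by q/p. *)
Lemma oK_frob_fixed_tilt (z : oK) r : (0 < r)%N -> z ^+ (p ^ r) = z ->
  exists2 u : plim p oK, u 0%N = z & oK_tilt p_pr u ^+ (p ^ r) = oK_tilt p_pr u.
Proof.
move=> r0 zr; pose f n := z ^+ (p ^ (r.-1 * n)).
have fP : is_power_seq p f.
  apply: is_power_seqP => n; rewrite /f -exprM -expnSr -[in RHS]zr -exprM -expnD.
  by rewrite mulnS -addSn prednK.
exists (Plim fP); first by rewrite /= /f muln0 expr1.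
apply: tilt_eq => n; rewrite tiltX !oK_tiltE -!rmorphXn /= /f.
by rewrite -exprM mulnC exprM zr.
Qed.

(** The product of a - z over the roots z of X^q - X is a^q - a, which is in the maximal ideal,
    hence so is some factor. This takes the place of Hensel's lemma. *)
Lemma oK_teichmuller (a : oK) r : (0 < r)%N -> resK a ^+ (p ^ r) = resK a ->
  exists2 z : oK, z ^+ (p ^ r) = z & resK z = resK a.
Proof.
move=> r0 ar; set q := (p ^ r)%N in ar *.
have q1 : (1 < q)%N by rewrite -{1}(expn0 p) ltn_exp2l // prime_gt1.
pose f : {poly Qpbar} := 'X^q - 'X.
have [s sE] := closed_field_poly_normal f.
have sf : size f = q.+1 by rewrite size_polyDl size_polyXn // size_polyN size_polyX.
have lf : lead_coef f = 1.
  by rewrite lead_coefDl ?lead_coefXn // size_polyN size_polyX size_polyXn.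
rewrite lf scale1r in sE.
have small : absp (CpOf f.[val a]) < 1.
  have : resK (a ^+ q - a) == 0 by rewrite rmorphB rmorphXn ar subrr.
  rewrite resK_eq0; congr (absp (CpOf _) < 1).
  rewrite /f hornerD hornerXn hornerN hornerX.
  exact: etrans (rmorphB (val : oK -> Qpbar) _ _) (congr1 (fun w => w - val a) (rmorphXn (val : oK -> Qpbar) _ _)).
have [z zs za] : exists2 z, z \in s & absp (CpOf (val a - z)) < 1.
  apply: contrapT => nex; move: small; rewrite sE horner_prod rmorph_prod.
  have : forall z, z \in s -> 1 <= absp (CpOf (val a - z)).
    by move=> z zs; rewrite leNgt; apply/negP => h; apply: nex; exists z.
  move=> h; apply/negP; rewrite -leNgt big_seq.
  elim/big_rec: _ => [|z c zs c1]; first by rewrite absp1.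
  by rewrite abspM hornerXsubC mulr_ege1 // h.
have zq : z ^+ q = z.
  have : root f z by rewrite sE root_prod_XsubC.
  by rewrite /root /f hornerD hornerXn hornerN hornerX subr_eq0 => /eqP.
have zK : z \in @oK_pred p R X.
  rewrite oK_intP // /absb -[CpOf z](subrK (CpOf (val a))); apply: abspD_le.
    by rewrite absp_distC -rmorphB ltW.
  exact: vK_le1.
exists (MkoK zK); first by apply: val_inj; rewrite rmorphXn.
apply/eqP; rewrite eq_sym -subr_eq0 -rmorphB resK_eq0.
by rewrite /vK /absb; move: za; congr (absp (CpOf _) < 1); rewrite rmorphB.
Qed.

Lemma frob_fixed_lift (x : Fpbar) : exists2 c, frob_fixed c & opb_residue c = x.
Proof.
have [[r r0 xr] [a ax]] := (Fpbar_finite x, resK_surj x).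
have [|z zq za] := @oK_teichmuller a r r0; first by rewrite ax.
have [u uz uq] := oK_frob_fixed_tilt r0 zq.
exists (oK_tilt p_pr u); first by exists r.
by rewrite opb_residueE sharp_oK uz -ax -za.
Qed.

(** Any ring section takes values fixed by a power of Frobenius, since residues are; by
    [frob_fixed_uniq] the one selected by [xget] is therefore the expected one. *)
Lemma Fpbar_opbP : [/\ (exists g : {rmorphism Fpbar -> opb}, Fpbar_opb p_pr = g :> (Fpbar -> opb)),
  cancel (Fpbar_opb (X := X) p_pr) (@opb_residue p R X p_pr) &
  forall c, frob_fixed c -> Fpbar_opb p_pr (opb_residue c) = c].
Proof.
have /choice[f fP] : forall x : Fpbar, exists c : opb, frob_fixed c /\ opb_residue c = x.
  by move=> x; have [c] := frob_fixed_lift x; exists c.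
have fE c : frob_fixed c -> f (opb_residue c) = c.
  by move=> cf; have [h1 h2] := fP (opb_residue c); apply: frob_fixed_uniq.
have fz : zmod_morphism f.
  move=> x y; have [[hx <-] [hy <-]] := (fP x, fP y).
  by rewrite -opb_residueB !fE //; have [] := frob_fixedD hx hy.
have fm : monoid_morphism f.
  split=> [|x y].
    rewrite -(rmorph1 (@opb_residue p R X p_pr)); apply: fE.
    by exists 1%N; rewrite ?expr1n.
  have [[hx <-] [hy <-]] := (fP x, fP y).
  by rewrite -(rmorphM (@opb_residue p R X p_pr)) !fE //; have [] := frob_fixedD hx hy.
pose f1 := GRing.isZmodMorphism.Build _ _ f fz.
pose f2 := GRing.isMonoidMorphism.Build _ _ f fm.
pose fr : {rmorphism Fpbar -> opb} := HB.pack f f1 f2.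
have [[g gE] gK] : (exists g : {rmorphism Fpbar -> opb}, Fpbar_opb p_pr = g :> (Fpbar -> opb)) /\
    cancel (Fpbar_opb (X := X) p_pr) (@opb_residue p R X p_pr).
  rewrite /Fpbar_opb; case: xgetP => [h _ //|/(_ f) []]; split; first by exists fr.
  by move=> x; have [] := fP x.
split=> //; first by exists g.
move=> c cf; apply: frob_fixed_uniq => //.
have [r r0 xr] := Fpbar_finite (opb_residue c); exists r => //.
by rewrite gE -rmorphXn xr.
Qed.

End ResidueField.

(** * Lifting residue endomorphisms on finite sets of algebraic numbers *)

Section ConjugationOnFiniteLevels.
Variables (p : nat) (p_pr : prime p) (R : realType) (X : padic_fields p R).
Local Notation Qp := (Qp X).
Local Notation Qpbar := (Qpbar X).
Local Notation absp := (@absp p R X).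
Local Notation QpbarOf := (@QpbarOf p R X).
Local Notation CpOf := (CpOf X).
Local Notation oK := (oK X).
Local Notation Fpbar := (Fpbar X).
Local Notation "q ^Q" := (map_poly QpbarOf q) (at level 2, format "q ^Q").
Implicit Types (a b c : Qpbar) (q P : {poly Qp}).

Definition conjugate a b := forall q, root q^Q a -> root q^Q b.

Lemma conjugate_map a b P : conjugate a b -> conjugate P^Q.[a] P^Q.[b].
Proof.
move=> ab q; rewrite /root -!horner_comp -map_comp_poly => qa.
exact: ab.
Qed.

Lemma conjugate_rootP f a b : (forall q, root q^Q a -> f %| q) -> root f^Q b -> conjugate a b.
Proof.
move=> fmin fb q /fmin fq; rewrite -(divpK fq) rmorphM /root hornerM (eqP fb).
by rewrite mulr0.
Qed.

Lemma conjugate_absb_le1 a b : conjugate a b -> absb a <= 1 -> absb b <= 1.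
Proof.
have [f [fmon fa fmin]] := min_annihilator a.
by move=> ab; apply: (conjugate_le1 p_pr fmin fmon fa (ab _ fa)).
Qed.

(** Apply the bound by 1 to a^n / p, with n so large that |a|^n < 1/p. *)
Lemma conjugate_absb_lt1 a b : conjugate a b -> absb a < 1 -> absb b < 1.
Proof.
move=> ab a1; have [n nP] : exists n, absb a ^+ n < p%:R^-1.
  have [->|a0] := eqVneq a 0.
    by exists 1%N; rewrite /absb rmorph0 absp0 expr1 invr_gt0 pR_gt0.
  have a0' : 0 < absb a by rewrite absp_gt0 fmorph_eq0.
  have [|n nP] := @expr_unbounded _ (absb a)^-1 p%:R; first by rewrite invf_gt1.
  exists n; rewrite -[absb a ^+ n]invrK ltf_pV2 ?posrE ?invr_gt0 ?exprn_gt0 ?pR_gt0 //.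
  by rewrite -exprVn.
have vp c m : absb ((p%:R)^-1 * c ^+ m) = p%:R * absb c ^+ m.
  by rewrite /absb rmorphM fmorphV rmorphXn rmorph_nat abspM abspV absp_p invrK abspX.
pose P : {poly Qp} := (p%:R)^-1 *: 'X^n.
have PE c : P^Q.[c] = (p%:R)^-1 * c ^+ n.
  by rewrite map_polyZ map_polyXn hornerZ hornerXn fmorphV rmorph_nat.
have : absb P^Q.[b] <= 1.
  apply: conjugate_absb_le1 (@conjugate_map a b P ab) _.
  by rewrite PE vp mulrC -ler_pdivlMr ?pR_gt0 // div1r ltW.
rewrite PE vp mulrC -ler_pdivlMr ?pR_gt0 // div1r => bn.
rewrite ltNge; apply/negP => b1; move: bn; apply/negP; rewrite -ltNge.
by rewrite (lt_le_trans _ (exprn_ege1 _ b1)) // invf_lt1 ?pR_gt0 ?pR_gt1.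
Qed.

(** Extends z -> z' to a conjugate of the generator t. The resultant in X of f(X) and P(X) - Y is a
    polynomial in Y over Q_p whose roots are exactly the P(t') with t' a root of f; it kills z,
    hence also z'. *)
Lemma common_root (f P : {poly Qp}) (t z z' : Qpbar) :
  root f^Q t -> f != 0 -> P^Q.[t] = z -> conjugate z z' ->
  exists2 t', root f^Q t' & P^Q.[t'] = z'.
Proof.
(* A constant P is treated apart: P - Y would then have a leading coefficient depending on Y, and
   the resultant would not specialise well. *)
move=> ft f0 Pt zz'; have [sP|sP] := leqP (size P) 1.
  have vanish c : root ('X - P)^Q c = (c == P^Q.[t]).
    rewrite /root rmorphB /= map_polyX hornerD hornerN hornerX subr_eq0.
    by rewrite (size1_polyC sP) map_polyC !hornerC.
  exists t => //; apply/esym/eqP; rewrite -vanish; apply: zz'.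
  by rewrite vanish Pt.
pose A : {poly {poly Qp}} := map_poly polyC f.
pose B : {poly {poly Qp}} := map_poly polyC P - ('X)%:P.
have ev y : exists g : {rmorphism {poly Qp} -> Qpbar}, forall q, g q = q^Q.[y].
  by exists (horner_morph (fun w : Qp => mulrC y (QpbarOf w)) : {rmorphism _ -> _}).
have gA y (g : {rmorphism {poly Qp} -> Qpbar}) : (forall q, g q = q^Q.[y]) ->
    map_poly g A = f^Q /\ map_poly g B = P^Q - y%:P.
  move=> gE; have gC q : map_poly g (map_poly polyC q) = q^Q.
    rewrite -map_poly_comp; apply: eq_map_poly => c /=.
    by rewrite gE map_polyC hornerC.
  by rewrite rmorphB /= !gC map_polyC /= gE map_polyX hornerX.
have lA : lead_coef A = (lead_coef f)%:P by rewrite lead_coef_map_inj //; apply: polyC_inj.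
have sB : size (map_poly polyC P) = size P by rewrite size_map_inj_poly //; apply: polyC_inj.
have lB : lead_coef B = (lead_coef P)%:P.
  rewrite /B lead_coefDl ?lead_coef_map_inj //; try exact: polyC_inj.
  by rewrite size_polyN sB; apply: leq_ltn_trans (size_polyC_leq1 _) sP.
have resE y : root (resultant A B)^Q y <-> exists t', root f^Q t' /\ P^Q.[t'] = y.
  have [g gE] := ev y; have [gAE gBE] := gA y g gE.
  have P0 : P != 0 by rewrite -size_poly_gt0 (ltn_trans _ sP).
  rewrite /root -gE map_resultant; last first.
  - by rewrite lB gE map_polyC hornerC fmorph_eq0 lead_coef_eq0.
  - by rewrite lA gE map_polyC hornerC fmorph_eq0 lead_coef_eq0.
  rewrite gAE gBE resultant_eq0; split=> [sg|[t' [ft' Pt']]].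
    have [|t' /=] := closed_rootP (gcdp f^Q (P^Q - y%:P)) _.
      by apply: contraTneq sg => ->.
    rewrite root_gcd => /andP[ft' /eqP]; rewrite hornerD hornerN hornerC => /eqP.
    by rewrite subr_eq0 => /eqP e; exists t'.
  apply: (@root_size_gt1 _ t').
    by rewrite gcdp_eq0 map_poly_eq0 (negPf f0).
  by rewrite root_gcd /root ft' hornerD hornerN hornerC Pt' subrr eqxx.
have /zz'/resE[t' [ft' Pt']] : root (resultant A B)^Q z by apply/resE; exists t.
by exists t'.
Qed.

Lemma common_generator (S : seq Qpbar) :
  exists t, forall a, a \in S -> exists P : {poly Qp}, P^Q.[t] = a.
Proof.
elim: S => [|a S [t tP]]; first by exists 0.
have [f f0 fa] := Qpbar_algebraic a; have [g g0 gt] := Qpbar_algebraic t.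
have [n] := pchar0_PET f0 fa g0 gt (@Qp_char0 p p_pr R X).
move=> /= [[P Pa] [Q Qt]]; exists (t *+ n - a) => b.
rewrite inE => /orP[/eqP ->|/tP[P' P't]]; first by exists P.
by exists (P' \Po Q); rewrite map_comp_poly horner_comp Qt.
Qed.

Lemma prim_root_exists n : (0 < n)%N -> exists z : Qpbar, n.-primitive_root z.
Proof.
move=> n0; have [r rE] := closed_field_poly_normal ('X^n - 1 : {poly Qpbar}).
rewrite (monicP (monicXnsubC _ n0)) scale1r in rE.
have rn : all n.-unity_root r by apply/allP => z; rewrite -root_prod_XsubC -rE.
have sz : (n < (size r).+1)%N by rewrite -(size_prod_XsubC r id) -rE size_XnsubC.
have [|z _ zP] := hasP (has_prim_root n0 rn _ sz); last by exists z.
rewrite -separable_prod_XsubC -rE unlock derivB derivXn derivC subr0 -scaler_nat.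
rewrite coprimepZr; last by rewrite (pcharf0P _).1 -?lt0n //; exact: Qpbar_char0.
rewrite coprimep_expr // coprimepX /root hornerD hornerN hornerXn hornerC.
by rewrite expr0n eqn0Ngt n0 sub0r oppr_eq0 oner_eq0.
Qed.

(** Uniqueness is borrowed from the tilt: [x] and [y] are the sharp values of Frobenius-fixed
    elements with the same residue. *)
Lemma oK_frob_fixed_inj (x y : oK) r : (0 < r)%N -> x ^+ (p ^ r) = x -> y ^+ (p ^ r) = y ->
  resK X x = resK X y -> x = y.
Proof.
move=> r0 xr yr xy.
have [u ux ur] := oK_frob_fixed_tilt p_pr r0 xr; have [v vy vr] := oK_frob_fixed_tilt p_pr r0 yr.
have e : oK_tilt p_pr u = oK_tilt p_pr v.
  apply: frob_fixed_uniq; [by exists r|by exists r|].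
  by rewrite !opb_residueE !sharp_oK ux vy; exact: xy.
by apply: (@oK_op_inj p R X); rewrite -ux -vy -!(sharp_oK p_pr) e.
Qed.

(* The minimal polynomial of a root of unity of order prime to p has coefficients *)
(* in the prime field modulo the maximal ideal, so it kills the conjugate lifts.  *)
Lemma frob_fixed_conjugate (tau : {rmorphism Fpbar -> Fpbar}) (x y : oK) r : (0 < r)%N ->
  x ^+ (p ^ r) = x -> y ^+ (p ^ r) = y -> resK X y = tau (resK X x) ->
  conjugate (val x) (val y).
Proof.
move=> r0 xr yr yx; have [g [gmon gx gmin]] := min_annihilator (val x).
apply: (conjugate_rootP gmin).
have [s sE] := closed_field_poly_normal g^Q.
rewrite (monicP (monic_map _ gmon)) scale1r in sE.
have sP c : c \in s -> conjugate (val x) c.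
  by move=> cs; apply: (conjugate_rootP gmin); rewrite sE root_prod_XsubC.
have g1 i : absp (QpCp X g`_i) <= 1.
  have -> : absp (QpCp X g`_i) = absb (g^Q)`_i by rewrite coef_map.
  rewrite sE; apply: prod_XsubC_le1 => c /sP cx.
  by apply: (conjugate_absb_le1 cx); rewrite -oK_intP // (valP x).
have /choice[k kP] := fun i => Zp_residue p_pr (g1 i).
(* The minimal polynomial with its coefficients replaced by natural numbers congruent to them; it
   can be evaluated in any ring and commutes with [tau]. *)
pose G (A : pzRingType) (c : A) : A := \sum_(i < size g) (k i)%:R * c ^+ i.
have GM (A B : pzRingType) (f : {rmorphism A -> B}) (c : A) : f (G A c) = G B (f c).
  by rewrite rmorph_sum; apply: eq_bigr => i _; rewrite rmorphM rmorph_nat rmorphXn.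
have near (c : oK) : absp (CpOf g^Q.[val c] - G _ (CpOf (val c))) < 1.
  rewrite -horner_map -map_poly_comp horner_coef size_map_poly -sumrB.
  elim/big_ind: _ => [|d e|i _]; rewrite ?absp0 ?ltr01 //; first exact: abspD_lt.
  rewrite coef_map -mulrBl abspM abspX (le_lt_trans _ (kP i)) // ler_piMr ?absp_ge0 //.
  by rewrite exprn_ile1 ?absp_ge0 // vK_le1.
have Gx : resK X (G _ x) = 0.
  apply/eqP; rewrite resK_eq0 // /vK /absb.
  have -> : CpOf (val (G _ x)) = G _ (CpOf (val x)) := GM _ _ (CpOf \o (val : oK -> Qpbar)) x.
  by have := near x; rewrite (rootP gx) rmorph0 sub0r abspN.
have Gy : vK (G _ y) < 1.
  by rewrite -resK_eq0 // GM yx -!GM Gx rmorph0.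
have gy : absp (CpOf g^Q.[val y]) < 1.
  rewrite -[X in absp X](subrK (G _ (CpOf (val y)))); apply: abspD_lt; first exact: near.
  have <- : CpOf (val (G _ y)) = G _ (CpOf (val y)) := GM _ _ (CpOf \o (val : oK -> Qpbar)) y.
  exact: Gy.
have [c cs cy] : exists2 c, c \in s & absp (CpOf (val y - c)) < 1.
  apply: contrapT => nex; move: gy; rewrite sE horner_prod rmorph_prod.
  have h c : c \in s -> 1 <= absp (CpOf (val y - c)).
    by move=> cs; rewrite leNgt; apply/negP => h; apply: nex; exists c.
  apply/negP; rewrite -leNgt big_seq.
  elim/big_rec: _ => [|c d cs d1]; first by rewrite absp1.
  by rewrite abspM hornerXsubC mulr_ege1 // h.
have cK : c \in @oK_pred p R X.
  by rewrite oK_intP //; apply: (conjugate_absb_le1 (sP _ cs)); rewrite -oK_intP // (valP x).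
have cr : MkoK cK ^+ (p ^ r) = MkoK cK.
  apply: val_inj; rewrite rmorphXn /=; apply/eqP; rewrite -subr_eq0.
  have van b : root ('X^(p ^ r) - 'X)^Q b = (b ^+ (p ^ r) - b == 0).
    by rewrite /root rmorphB /= map_polyXn map_polyX hornerD hornerN hornerXn hornerX.
  rewrite -van; apply: (sP _ cs); rewrite van subr_eq0 -rmorphXn; apply/eqP.
  by rewrite xr.
have -> : val y = c.
  have -> : y = MkoK cK; last by [].
  apply: (oK_frob_fixed_inj r0 yr cr); apply/eqP; rewrite -subr_eq0 -rmorphB resK_eq0 //.
by rewrite sE root_prod_XsubC.
Qed.

Lemma common_residue_order (S : seq Qpbar) : exists2 r, (0 < r)%N &
  forall a : oK, val a \in S -> resK X a ^+ (p ^ r) = resK X a.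
Proof.
elim: S => [|c S [r r0 rP]]; first by exists 1%N.
have pow (x : Fpbar) m k : x ^+ (p ^ m) = x -> x ^+ (p ^ (m * k)) = x.
  move=> xm; elim: k => [|k IH]; first by rewrite muln0 expr1.
  by rewrite mulnS expnD exprM xm.
have [cK|cK] := boolP (c \in @oK_pred p R X); last first.
  exists r => // a; rewrite inE => /orP[/eqP ac|/rP //].
  by case/negP: cK; rewrite -ac (valP a).
have [r' r'0 r'P] := Fpbar_finite p_pr (resK X (MkoK cK)).
exists (r * r')%N; first by rewrite muln_gt0 r0.
move=> a; rewrite inE => /orP[/eqP ac|/rP ar]; last exact: pow.
by rewrite mulnC pow //; have -> : a = MkoK cK by exact: val_inj.
Qed.

(** The set [S] and a root of unity [zeta] of order p^r - 1 lie in some Q_p(t). Sending [zeta] to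
    the Teichmuller lift of the image of its residue extends to a conjugate t' of t, and h evaluates
    at t' the polynomials that represent elements at t. *)
Lemma finite_level_lift (tau : {rmorphism Fpbar -> Fpbar}) (S : seq Qpbar) :
  exists h : Qpbar -> Qpbar, [/\ forall u, h (QpbarOf u) = QpbarOf u,
    forall a b, a \in S -> b \in S -> h (a - b) = h a - h b /\ h (a * b) = h a * h b,
    forall a, a \in S -> conjugate a (h a) &
    forall a b : oK, val a \in S -> h (val a) = val b -> resK X b = tau (resK X a)].
Proof.
have [r r0 rP] := common_residue_order S.
set n := (p ^ r).-1.
have nE : (p ^ r)%N = n.+1 by rewrite /n prednK // expn_gt0 prime_gt0.
have n0 : (0 < n)%N by rewrite -ltnS -nE -{1}(expn0 p) ltn_exp2l // prime_gt1.
have [zeta zP] := prim_root_exists n0.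
have zn : zeta ^+ n = 1 := prim_expr_order zP.
have zK : zeta \in @oK_pred p R X.
  rewrite oK_intP // leNgt; apply/negP => z1.
  have : 1 < absb zeta ^+ n by rewrite exprn_egt1 // -lt0n.
  by rewrite /absb -abspX -rmorphXn zn rmorph1 absp1 ltxx.
set z : oK := MkoK zK.
have zr : z ^+ (p ^ r) = z by apply: val_inj; rewrite rmorphXn /= nE exprS zn mulr1.
have [w wE] := resK_surj p_pr (tau (resK X z)).
have [|z' z'r z'w] := oK_teichmuller p_pr (a := w) r0.
  by rewrite wE -rmorphXn -rmorphXn zr.
have z'E : resK X z' = tau (resK X z) by rewrite z'w.
have zz' := frob_fixed_conjugate r0 zr z'r z'E.
have [t tP] := common_generator (zeta :: S).
have [f [fmon ft fmin]] := min_annihilator t.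
have [Pz Pzt] := tP zeta (mem_head _ _).
have [t' ft' Pzt'] := common_root ft (monic_neq0 fmon) Pzt zz'.
have tt' : conjugate t t' := conjugate_rootP fmin ft'.
pose rep a : {poly Qp} := xget 0 [set P | P^Q.[t] = a]%classic.
pose h a := (rep a)^Q.[t'].
have hE P : h P^Q.[t] = P^Q.[t'].
  rewrite /h /rep; case: xgetP => [Q _ /= Qt|/(_ P)/(_ erefl)//].
  apply/eqP; rewrite -subr_eq0 -hornerN -hornerD -rmorphB; apply: tt'.
  by rewrite /root rmorphB hornerD hornerN Qt subrr.
have inS a : a \in S -> exists P : {poly Qp}, P^Q.[t] = a.
  by move=> aS; apply: tP; rewrite inE aS orbT.
exists h; split=> [u|a b /inS[P <-] /inS[Q <-]|a /inS[P <-]|a b aS hab].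
- by have := hE u%:P; rewrite map_polyC !hornerC.
- have eB : P^Q.[t] - Q^Q.[t] = (P - Q)^Q.[t] by rewrite rmorphB hornerD hornerN.
  have eM : P^Q.[t] * Q^Q.[t] = (P * Q)^Q.[t] by rewrite rmorphM hornerM.
  by rewrite eB eM !hE rmorphB rmorphM hornerD hornerN hornerM.
- by rewrite hE; apply: conjugate_map.
(* The Teichmuller part c of a is 0 or a power of [z], where the effect of replacing t by t' is
   known; a - c is in the maximal ideal, which conjugation preserves. *)
have [c cr ca] := oK_teichmuller p_pr r0 (rP a aS).
have [P Pa] := inS _ aS.
have [Q [c' [Qc Qc' cc']]] : exists Q : {poly Qp}, exists c' : oK,
    [/\ Q^Q.[t] = val c, Q^Q.[t'] = val c' & resK X c' = tau (resK X c)].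
  have [c0|c0] := eqVneq c 0.
    by exists 0, 0; rewrite c0 !rmorph0 !horner0.
  have cn : val c ^+ n = 1.
    have v0 : val c != 0 by rewrite (inj_eq val_inj c 0).
    apply: (mulfI v0); rewrite -exprS -nE mulr1.
    by have := congr1 val cr; rewrite rmorphXn.
  have [k ck] := prim_rootP zP cn.
  have ckz : c = z ^+ k by apply: val_inj; rewrite rmorphXn.
  exists (Pz ^+ k), (z' ^+ k); split.
  - by rewrite rmorphXn horner_exp ?Pzt ?Pzt' ?rmorphXn ?ckz ?rmorphXn.
  - by rewrite rmorphXn horner_exp ?Pzt ?Pzt' ?rmorphXn ?ckz ?rmorphXn.
  by rewrite ckz !rmorphXn z'E.
rewrite -ca -cc'; apply/eqP; rewrite -subr_eq0 -rmorphB resK_eq0 //.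
have e1 : absb (P - Q)^Q.[t'] < 1.
  apply: conjugate_absb_lt1 (@conjugate_map t t' (P - Q) tt') _.
  rewrite rmorphB hornerD hornerN Pa Qc.
  suff : vK (a - c) < 1 by [].
  by rewrite -resK_eq0 // rmorphB ca subrr.
by move: e1; rewrite rmorphB hornerD hornerN Qc' -hE Pa hab.
Qed.

End ConjugationOnFiniteLevels.

(** * Passage to the limit: residue endomorphisms lift to Galois elements *)

Section GaloisOntoResidue.
Variables (p : nat) (p_pr : prime p) (R : realType) (X : padic_fields p R).
Local Notation Qp := (Qp X).
Local Notation Qpbar := (Qpbar X).
Local Notation QpbarOf := (@QpbarOf p R X).
Local Notation CpOf := (CpOf X).
Local Notation oK := (oK X).
Local Notation Fpbar := (Fpbar X).
Local Open Scope classical_set_scope.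

Lemma ultra_finite_value (T : Type) (V : eqType) (U : set_system T) (f : T -> V) (r : seq V) :
  UltraFilter U -> U [set x | f x \in r] -> exists v, U [set x | f x = v].
Proof.
move=> ultraU; elim: r => [|v r IH] Ur.
  by case: (filter_not_empty U (filterS _ Ur)) => x /=.
have [Uv|Unv] := in_ultra_setVsetC [set x | f x = v] ultraU; first by exists v.
apply: IH; apply: filterS (filterI Ur Unv) => x /= [].
by rewrite inE => /orP[/eqP //|].
Qed.

(* Ultraproduct of the lifts of [tau] over finite subsets of Qpbar: each value has *)
(* finitely many conjugates, so the ultralimit exists.                            *)
Lemma residue_lift (tau : {rmorphism Fpbar -> Fpbar}) :
  exists g : gal X, forall a, resK X (gal_oK g a) = tau (resK X a).
Proof.
have [h hP] := choice (finite_level_lift p_pr tau).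
(* The filter of cones: any given finite set is contained in almost every [S], so identities between
   finitely many elements survive in the limit. *)
pose F : set_system (seq Qpbar) :=
  [set A | exists S0 : seq Qpbar, forall S : seq Qpbar, {subset S0 <= S} -> A S].
have FF : ProperFilter F.
  split; first by move=> [S0 /(_ S0)]; apply.
  split; first by exists [::].
    move=> A B [S1 A1] [S2 B2]; exists (S1 ++ S2) => S S12; split.
      by apply: A1 => a aS; apply: S12; rewrite mem_cat aS.
    by apply: B2 => a aS; apply: S12; rewrite mem_cat aS orbT.
  by move=> A B AB [S0 A0]; exists S0 => S /A0/AB.
have [U [ultraU FU]] := ultraFilterLemma FF.
have Ucone (S0 : seq Qpbar) : U [set S : seq Qpbar | {subset S0 <= S}] by apply: FU; exists S0.
have lim a : exists b, U [set S | h S a = b].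
  have [f [fmon fa _]] := min_annihilator a.
  have [r rE] := closed_field_poly_normal (map_poly QpbarOf f).
  apply: (@ultra_finite_value _ _ U (fun S => h S a) r ultraU).
  apply: filterS (Ucone [:: a]) => S /= aS; have [_ _ /(_ a) hc _] := hP S.
  have : root (map_poly QpbarOf f) (h S a) by apply: hc => //; apply: aS; rewrite mem_head.
  by rewrite rE rootZ ?root_prod_XsubC // lead_coef_eq0 map_poly_eq0 monic_neq0.
have [s sP] := choice lim.
have pick3 a b c : exists S, [/\ h S a = s a, h S b = s b, h S c = s c & {subset [:: a; b; c] <= S}].
  have [S [[Sa Sb] [Sc S0]]] := filter_ex (filterI (filterI (sP a) (sP b))
    (filterI (sP c) (Ucone [:: a; b; c]))).
  by exists S.
have sz : zmod_morphism s.
  move=> a b; have [S [Sa Sb Sc S0]] := pick3 a b (a - b).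
  rewrite -Sa -Sb -Sc; have [_ hS _ _] := hP S.
  by have [] := hS a b (S0 _ (mem_head _ _)) (S0 b _); rewrite ?inE ?eqxx ?orbT.
have sQ u : s (QpbarOf u) = QpbarOf u.
  have [S [Sa _ _ _]] := pick3 (QpbarOf u) (QpbarOf u) (QpbarOf u).
  by rewrite -Sa; have [] := hP S.
have sm : monoid_morphism s.
  split=> [|a b]; first by rewrite -(rmorph1 QpbarOf) sQ.
  have [S [Sa Sb Sc S0]] := pick3 a b (a * b).
  rewrite -Sa -Sb -Sc; have [_ hS _ _] := hP S.
  by have [] := hS a b (S0 _ (mem_head _ _)) (S0 b _); rewrite ?inE ?eqxx ?orbT.
pose s1 := GRing.isZmodMorphism.Build _ _ s sz.
pose s2 := GRing.isMonoidMorphism.Build _ _ s sm.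
pose sr : {rmorphism Qpbar -> Qpbar} := HB.pack s s1 s2.
have [|g gP] := @gal_of_hom p R X sr; first exact: sQ.
exists g => a; have [S [Sa _ _ S0]] := pick3 (val a) (val a) (val a).
have [_ _ _ /(_ a (gal_oK g a))] := hP S; apply; first by apply: S0; rewrite mem_head.
by rewrite Sa /= gP.
Qed.

End GaloisOntoResidue.

(** * The orbits that make up the check subset *)

Section CheckTriples.
Variables (p : nat) (p_pr : prime p) (R : realType) (X : padic_fields p R).
Local Notation oK := (oK X).
Local Notation op := (op X).
Local Notation opb := (tilt p_pr op).
Local Notation opc := (op_complete p_pr X).
Local Notation Fpbar := (Fpbar X).
Local Notation endo := (@endo_of_triple p R X p_pr).
Local Notation res := (@opb_residue p R X p_pr).
Local Notation teich := (@Fpbar_opb p R X p_pr).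
Local Open Scope classical_set_scope.

Lemma tilt_frob_zmod m : zmod_morphism (@tilt_frob p p_pr op m).
Proof.
move=> x y; case: m => k /=; last exact: tilt_eq.
by apply: (addIr (y ^+ (p ^ k))); rewrite -tilt_expD !subrK.
Qed.
Lemma tilt_frob_monoid m : monoid_morphism (@tilt_frob p p_pr op m).
Proof. by case: m => k; split=> [|x y] /=; rewrite ?expr1n ?exprMn //; apply: tilt_eq. Qed.
HB.instance Definition _ m := GRing.isZmodMorphism.Build opb opb (@tilt_frob p p_pr op m)
  (tilt_frob_zmod m).
HB.instance Definition _ m := GRing.isMonoidMorphism.Build opb opb (@tilt_frob p p_pr op m)
  (tilt_frob_monoid m).

Lemma tilt_frob_continuous m : tilt_continuous (@tilt_frob p p_pr op m).
Proof.
case: m => k x n.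
  by exists n => y yx i ik; rewrite /= !tiltX yx //.
by exists (n + k.+1)%N => y yx i ik; apply: yx; rewrite leq_add2r.
Qed.

Lemma tilt_frob_inj m (x : opb) : tilt_frob m x = 0 -> x = 0.
Proof.
case: m => k /=; first exact: opb_expf_eq0.
by move=> e; rewrite -(tilt_rootXK k.+1 x) e expr0n_gt0 // expn_gt0 prime_gt0.
Qed.

Lemma opb_residue_gal (g : gal X) (tau : {rmorphism Fpbar -> Fpbar}) :
  (forall a, resK X (gal_oK g a) = tau (resK X a)) ->
  forall x, res (gal_tilt g x) = tau (res x).
Proof.
move=> gt x; have [a xa] := modp_oK_op_surj p_pr (x 0%N).
by rewrite (opb_residue_modp xa) (opb_residue_modp (gal_tiltE g xa)); apply: gt.
Qed.

Lemma closed_endo_gal (phi : {rmorphism opb -> opb}) :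
  (forall x, (phi x == 0) = (nrm x < 1)) ->
  exists g : gal X, forall x, phi x = teich (res (gal_tilt g x)).
Proof.
move=> km; have [[e eE] eK eU] := Fpbar_opbP p_pr X.
have phires x : phi x = phi (e (res x)).
  apply/eqP; rewrite -subr_eq0 -rmorphB km -opb_residue_eq0 opb_residueB.
  by rewrite -eE eK subrr.
have [g gP] := residue_lift p_pr (res \o phi \o e : {rmorphism Fpbar -> Fpbar}).
(* [phi x] depends on the residue of [x] only, so it is fixed by a power of Frobenius and equals the
   Teichmuller lift of its own residue, which [g] realises. *)
exists g => x; rewrite (opb_residue_gal gP) /= eU -?phires //.
have [r r0 xr] := Fpbar_finite p_pr (res x); exists r => //.
by rewrite phires -2!rmorphXn xr.
Qed.

Lemma teich_res_End : exists phi : {rmorphism opb -> opb},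
  [/\ phi = teich \o res :> (opb -> opb), tilt_continuous phi &
      forall x, (phi x == 0) = (nrm x < 1)].
Proof.
have [[e eE] eK _] := Fpbar_opbP p_pr X.
exists (e \o res); split; first by rewrite eE.
  move=> x n; exists 0%N => y yx i _; rewrite /=; congr (e _ i).
  have [a xa] := modp_oK_op_surj p_pr (x 0%N).
  by rewrite (opb_residue_modp xa); apply: opb_residue_modp; rewrite yx.
move=> x; rewrite /= -opb_residue_eq0; apply/eqP/eqP => [h|->]; last exact: rmorph0.
by rewrite -[LHS]eK eE h rmorph0.
Qed.

Lemma generic_of_inj t : Ydiamond p_pr t -> (forall x, endo t x = 0 -> x = 0) ->
  forall a, a \in generic_pt (triple_pts t) -> a = 0.
Proof.
move=> Y inj a; have [u <-] := @plim_lift p oK a 0 (fun c => oK_pth_root p_pr c).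
rewrite (generic_endo Y) => /eqP/inj/(congr1 (@sharp p p_pr op)).
rewrite sharp_oK (sharp0 p_pr opc) => h.
by apply: (@oK_op_inj p R X); rewrite h rmorph0.
Qed.

Lemma generic_of_closed t : Ydiamond p_pr t -> (forall x, (endo t x == 0) = (nrm x < 1)) ->
  forall a, (a \in generic_pt (triple_pts t)) = (vK a < 1).
Proof.
move=> Y km a; have [u <-] := @plim_lift p oK a 0 (fun c => oK_pth_root p_pr c).
by rewrite (generic_endo Y) km /nrm sharp_oK.
Qed.

Lemma endo_orbit_gal (phi : opb -> opb) g : endo_orbit (phi \o gal_tilt g) = endo_orbit phi.
Proof.
have [g' [gg' g'g]] := gal_tilt_inv p_pr g.
apply/seteqP; split=> _ [s _ <-].
  by exists (gal_comp g s) => //; apply/funext => x /=; rewrite gal_tilt_comp.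
by exists (gal_comp g' s) => //; apply/funext => x /=; rewrite gal_tilt_comp gg'.
Qed.

Lemma frob_act_orbit m (phi : opb -> opb) :
  frob_act m (endo_orbit phi) = endo_orbit (phi \o tilt_frob m).
Proof.
have comm s : phi \o gal_tilt s \o tilt_frob m = phi \o tilt_frob m \o gal_tilt s.
  by apply/funext => x /=; rewrite rmorph_tilt_frob.
apply/seteqP; split=> [_ [_ [s _ <-] <-]|_ [s _ <-]]; first by exists s.
by exists (phi \o gal_tilt s); [exists s|].
Qed.

Lemma s0_of_closed (phi : {rmorphism opb -> opb}) :
  (forall x, (phi x == 0) = (nrm x < 1)) -> endo_orbit phi = s0 X p_pr.
Proof.
move=> /closed_endo_gal[g gP].
have -> : phi = (teich \o res) \o gal_tilt g :> (opb -> opb) by apply/funext.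
exact: endo_orbit_gal.
Qed.

Lemma identification_Ycheck : identification X p_pr @` Ycheck0 X p_pr =
  [set s0 X p_pr] `|` frob_orbit (eta0 X p_pr).
Proof.
apply/seteqP; split=> [_ [_ [t [Y tf] <-] <-]|O].
  rewrite identification_orbit //; have [[phi phiE] phic] := endo_of_End Y.
  have [k0|km] := endo_cases phi; [right|left].
    have [|g [m gm]] := @factors_gal_frob p p_pr R X t Y _ tf; first by rewrite phiE.
    exists m => //; rewrite /eta0 frob_act_orbit.
    have -> : endo t = tilt_frob m \o gal_tilt g by apply/funext => x; rewrite gm rmorph_tilt_frob.
    by rewrite endo_orbit_gal.
  by rewrite phiE /=; apply: s0_of_closed.
case=> [->|[m _ <-]].
  have [phi [phiE phic km]] := teich_res_End.
  have [t Y te] := endo_of_surj phic.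
  exists (triple_orbit t).
    exists t => //; split=> //; apply: (closed_point_factors Y).
    apply: (generic_of_closed Y) => x; rewrite te; exact: km.
  by rewrite identification_orbit // te; apply: s0_of_closed.
have [t Y te] := @endo_of_surj p p_pr R X (@tilt_frob p p_pr op m) (tilt_frob_continuous m).
exists (triple_orbit t).
  exists t => //; split=> //; apply: (frobenius_factors Y _ (m := m)) => [|z]; last by rewrite te.
  by apply: (generic_of_inj Y) => x; rewrite te; apply: tilt_frob_inj.
by rewrite identification_orbit // te /eta0 frob_act_orbit.
Qed.

(** Precomposition with Frobenius keeps the kernel, and by [s0_of_closed] the kernel alone singles
    out this orbit. *)
Lemma frob_act_s0 : frob_act 1 (s0 X p_pr) = s0 X p_pr.
Proof.
have [phi [phiE phic km]] := teich_res_End.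
rewrite {1}/s0 frob_act_orbit -phiE.
apply: (s0_of_closed (phi := phi \o tilt_frob 1)) => x /=.
rewrite -km rmorphXn; apply/eqP/eqP => [/opb_expf_eq0 //|->].
by rewrite expr0n_gt0 // expn_gt0 prime_gt0.
Qed.

Lemma frob_act_eta0_inj : injective (fun n : nat => frob_act n (eta0 X p_pr)).
Proof.
have [u u0] := @plim_lift p oK p%:R 0 (fun c => oK_pth_root p_pr c).
set w := oK_tilt p_pr u.
(* Since p is fixed by Galois, the sharp value at [w] is constant on each orbit and can tell orbits
   apart. *)
have gw g : sharp (gal_tilt g w) = p%:R.
  by rewrite gal_tilt_oK sharp_oK plim_mapE u0 !rmorph_nat.
have np n : absp (val (p%:R ^+ n : op)) = p%:R ^- n.
  by rewrite rmorphXn rmorph_nat absp_pX.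
move=> m n /=; rewrite /eta0 !frob_act_orbit => e.
have : endo_orbit (idfun \o tilt_frob m : opb -> opb) (tilt_frob m).
  by exists (gal_id X) => //; apply/funext => x /=; rewrite gal_tilt_id.
rewrite e => -[g _ /(congr1 (fun f => sharp (f w)))] /=.
rewrite !(sharpX opc) gw sharp_oK u0 rmorph_nat => /(congr1 (fun c => absp (val c))).
rewrite !np => /invr_inj h.
have inj2 := expnI (prime_gt1 p_pr); apply/inj2/inj2/eqP.
by rewrite -(eqr_nat R) !natrX h.
Qed.

Lemma frob_orbit_eta0_infinite : infinite_set (frob_orbit (eta0 X p_pr)).
Proof.
move=> /(finite_preimage (f := fun n : nat => frob_act n (eta0 X p_pr))) fin.
apply: infinite_nat; apply: sub_finite_set (fin _) => [n _|m n _ _].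
  by exists (Posz n).
exact: frob_act_eta0_inj.
Qed.

End CheckTriples.

Local Open Scope classical_set_scope.

Theorem proposition15p8 (p : nat) (p_pr : prime p) (R : realType)
    (X : padic_fields p R) :
  [/\ set_bij (Ydiamond0 X p_pr) (End_cont0 X p_pr) (identification X p_pr),
      identification X p_pr @` Ycheck0 X p_pr
        = [set s0 X p_pr] `|` frob_orbit (eta0 X p_pr),
      frob_act 1 (s0 X p_pr) = s0 X p_pr &
      infinite_set (frob_orbit (eta0 X p_pr))].
Proof.
split; first exact: identification_bij.
- exact: identification_Ycheck.
- exact: frob_act_s0.
- exact: frob_orbit_eta0_infinite.
Qed.
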